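(* As $d\to\infty$, the exponential growth rate $\dot{b}(\mathbb{Z}^d)$ of the number of site-interfaces of $\mathbb{Z}^d$ satisfies $$\dot{b}(\mathbb{Z}^d)=2de-O(1).$$
   Context: $\mathbb{Z}^d$, $d\ge 2$, denotes the hypercubic lattice, i.e. the graph with vertex set $\mathbb{Z}^d$ in which two vertices are adjacent when they are at Euclidean distance $1$; $o$ denotes the origin. $O(1)$ denotes a quantity bounded in absolute value by a constant for all large $d$; $e$ is Euler's number. Interfaces. Let $\mathcal{P}$ be the set of all 4-cycles of $\mathbb{Z}^d$ (the basis, in the sense of generating set, of the cycle space that is used to define interfaces). Each edge $vw$ gives rise to two directed edges $\vec{vw}$ (with head $w$) and $\vec{wv}$ (with head $v$). A $\mathcal{P}$-path connecting two directed edges $\vec{vw}$ and $\vec{xy}$ is a path $Q$ of $\mathbb{Z}^d$ with endvertices $w$ and $y$ (possibly a single vertex $w=y$) such that $vw,xy\notin E(Q)$ and $E(Q)\cup\{vw,xy\}$ is contained in the edge set of some element of $\mathcal{P}$. A $\mathcal{P}$-path connects an undirected edge $f$ to a set $J$ of directed edges if it connects one of the two directions of $f$ to some element of $J$. For a set $F$ of edges, a set $J$ of directed edges is called $F$-connected if for every partition of $J$ into two non-empty sets $J_1,J_2$ there is a $\mathcal{P}$-path in $\mathbb{Z}^d\setminus F$ (the graph obtained by deleting the edges in $F$) connecting an element of $J_1$ to an element of $J_2$. For a subgraph $D$ and an edge set $F$, let $\vec{F}^{D}:=\{\vec{vz} : vz\in F,\ z\in V(D)\}$. An interface is a pair $(P,\partial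 P)$ of sets of edges of $\mathbb{Z}^d$ such that: (i) $\partial P$ separates $o$ from infinity, i.e. the component of $o$ in $\mathbb{Z}^d\setminus\partial P$ is finite; (ii) there is a unique finite component $D$ of $\mathbb{Z}^d\setminus\partial P$ containing an endvertex of each edge of $\partial P$; (iii) $\vec{\partial P}^{D}$ is $\partial P$-connected; (iv) $P$ is the set of those edges $f\in E(D)$ for which there is a $\mathcal{P}$-path in $\mathbb{Z}^d\setminus\partial P$ connecting $f$ to $\vec{\partial P}^{D}$. Site-interfaces. An interface $(P,\partial P)$ is a site-interface if no edge of $\partial P$ has both endvertices in $V(P)$, the set of vertices incident with an edge of $P$. A site-interface is identified with the vertex set $V(P)$ together with its (vertex) boundary, which is the set of endvertices of edges of $\partial P$ that do not lie in $V(P)$. Its size is the number of vertices $|V(P)|$. Let $\dot{c}_n(\mathbb{Z}^d)$ be the number of site-interfaces of $\mathbb{Z}^d$ of size $n$, and let $\dot{b}(\mathbb{Z}^d):=\lim_{n\to\infty}\dot{c}_n(\mathbb{Z}^d)^{1/n}$. *)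

(* Defs.v *)
From mathcomp Require Import all_boot all_order all_algebra finmap.
From mathcomp Require Import all_classical all_reals all_analysis.
Import Order.TTheory GRing.Theory Num.Theory.
Import numFieldNormedType.Exports.

Set Implicit Arguments.
Unset Strict Implicit.
Unset Printing Implicit Defensive.

Local Open Scope classical_set_scope.
Local Open Scope ring_scope.

Notation vertex d := 'rV[int]_d (only parsing).

(* Euclidean distance 1, squared in order to stay in int. *)
Definition adj d (v w : vertex d) : bool :=
  \sum_(i < d) (v ord0 i - w ord0 i) ^+ 2 == 1.

(* The undirected edge vw is the unordered pair [set v; w]; the directed edge
   from v to w, with head w, is the ordered pair (v, w). *)
Notation edge d := (set (vertex d)) (only parsing).
Notation dedge d := (vertex d * vertex d)%type (only parsing).

Definition lattice_edges d : set (edge d) :=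
  [set e | exists v w : vertex d, adj v w /\ e = [set v; w]].
Arguments lattice_edges d : clear implicits.

(* The elements of the basis are represented by their edge sets. *)
Definition four_cycles d : set (set (edge d)) :=
  [set E | exists a b c f : vertex d,
     [/\ uniq [:: a; b; c; f],
         [&& adj a b, adj b c, adj c f & adj f a] &
         E = [set e | [\/ e = [set a; b], e = [set b; c],
                          e = [set c; f] | e = [set f; a]]]]].
Arguments four_cycles d : clear implicits.

(* The graph obtained from the lattice by deleting the edges in F. *)
Definition adj_minus d (F : set (edge d)) (v w : vertex d) : bool :=
  adj v w && ([set v; w] \notin F).

(* A walk or path is given by its first vertex x and the sequence p of its
   other vertices. *)
Fixpoint path_edges d (x : vertex d) (p : seq (vertex d)) : set (edge d) :=
  if p is y :: q then [set [set x; y]] `|` path_edges y q else set0.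

Definition Ppath_connects d (F : set (edge d)) (a b : dedge d) : Prop :=
  exists p : seq (vertex d),
    [/\ path (adj_minus F) a.2 p /\ last a.2 p = b.2,
        uniq (a.2 :: p),
        ~ path_edges a.2 p [set a.1; a.2] /\ ~ path_edges a.2 p [set b.1; b.2] &
        exists2 E, four_cycles d E &
          path_edges a.2 p `|` [set [set a.1; a.2]; [set b.1; b.2]] `<=` E].

Definition Ppath_connects_edge d (F : set (edge d)) (f : edge d)
    (J : set (dedge d)) : Prop :=
  exists v w : vertex d, f = [set v; w] /\
    exists2 b, J b & Ppath_connects F (v, w) b.

Definition F_connected d (F : set (edge d)) (J : set (dedge d)) : Prop :=
  forall J1 J2 : set (dedge d),
    J1 `|` J2 = J -> J1 `&` J2 = set0 -> J1 !=set0 -> J2 !=set0 ->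
    exists a b, [/\ J1 a, J2 b & Ppath_connects F a b].

(* Components are represented by their vertex sets, as they are induced
   subgraphs of the graph without F. *)
Definition component d (F : set (edge d)) (x : vertex d) : set (vertex d) :=
  [set y | exists2 p, path (adj_minus F) x p & last x p = y].

Definition component_edges d (F : set (edge d)) (D : set (vertex d)) :
    set (edge d) :=
  [set e | [/\ lattice_edges d e, ~ F e & e `<=` D]].

Definition directed_into d (F : set (edge d)) (D : set (vertex d)) :
    set (dedge d) :=
  [set a | F [set a.1; a.2] /\ D a.2].

Definition finite_component_meeting d (F : set (edge d)) (D : set (vertex d)) :
    Prop :=
  [/\ exists x, D = component F x,
      finite_set D &
      forall e, F e -> e `&` D !=set0].

Definition is_interface d (P dP : set (edge d)) : Prop :=
  [/\ P `<=` lattice_edges d /\ dP `<=` lattice_edges d,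
      finite_set (component dP 0) &
      exists D, [/\ unique (finite_component_meeting dP) D,
        F_connected dP (directed_into dP D) &
        P = [set f | component_edges dP D f /\
                     Ppath_connects_edge dP f (directed_into dP D)]]].

Definition vertices_of d (P : set (edge d)) : set (vertex d) :=
  \bigcup_(e in P) e.

Definition is_site_interface d (P dP : set (edge d)) : Prop :=
  is_interface P dP /\ forall e, dP e -> ~ (e `<=` vertices_of P).

(* A site-interface is determined by its vertex set and vertex boundary, so
   counting the pairs of edge sets counts the pairs of vertex sets. *)
Definition site_interfaces d (n : nat) :
    set (set (edge d) * set (edge d)) :=
  [set I | is_site_interface I.1 I.2 /\ (vertices_of I.1 #= `I_n)%card].
Arguments site_interfaces d n : clear implicits.

Definition cdot d (n : nat) : nat := #|` fset_set (site_interfaces d n)|.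

Definition cdot_root (R : realType) d (n : nat) : R :=
  (cdot d n)%:R `^ (n%:R^-1).

Definition bdot (R : realType) d : R := limn (cdot_root R d).

(* Main.v *)
(* A site-interface is the same thing as a finite connected set D of vertices
   containing o whose edge-boundary is connected through 4-cycles; its size is
   the number n of vertices in the rim of D.

   Upper bound: D is determined by one boundary edge together with the rim and
   the set of vertices across the boundary, of which there are at most about 2dn.
   Under site percolation of density 1/(2d+1), at most 2n sets of size n occur
   simultaneously, each with probability at least about ((2d+1)e)^-n.

   Existence of the limit: a highest vertex of one set can be joined to a lowest
   vertex of another through a single extra vertex, so the counts are
   supermultiplicative up to a shift of the index.

   Lower bound: rooted trees embedded without collisions are site-interfaces.
   Let F_h be the total weight, x per vertex, of those of height at most h, and
   y_h = 2d F_h.  Summing over the set A of occupied branches at the root,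
   F_(h+1) >= x * sum over A of F_h^|A| (1 - |A|^2 O(1/d)): colliding branches
   yield a short closed walk, and a random walk of length l closes up with
   probability at most about (l/2d)^(l/2).  Hence y_(h+1) >= 2dx (exp y_h - O(1/d)),
   and since exp y >= e y, for 2dx = (1 + C/d)/e the y_h increase geometrically.
   Once y_h is a large constant, using only binary branching keeps the collisions
   under control while y_h at least doubles at each step, so it exceeds any fixed
   power of d while h is still small compared with d.  If the growth rate were
   below 1/x, the bound on the counts given by supermultiplicativity would limit
   the weight of the trees polynomially in d. *)

Require Import Defs.
From mathcomp Require Import all_boot all_order all_algebra finmap.
From mathcomp Require Import boolp zify ring lra.
Import Order.TTheory GRing.Theory Num.Theory.

Set Implicit Arguments.
Unset Strict Implicit.
Unset Printing Implicit Defensive.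

Local Open Scope ring_scope.

(** * Boundaries and rims of finite vertex sets *)

(** Two sets whose rims avoid each other's outer vertices and which share one boundary edge are
    equal, since links carry the common edge along the whole boundary. Every enclosed set has a
    boundary edge among the first n of a fixed half-axis, in one of two orientations; this is the
    bound 2n on simultaneous occurrences. The density 1/(2d+1) maximises p^n (1-p)^(2dn). In the
    lower bound, with N = 2d, clashes at one height are controlled by a ratio carried up from the
    heights below: a given child is present with relative weight at most 2^7/N ([spread]). A level
    of a tree then weighs at most as much as a random walk with factor 2^7 per step, and the return
    estimates beat this factor while the height is a small fraction of N. With unrestricted
    branching the ratio grows with y_h and is available only for y_h <= 64; with binary branching it
    does not involve y_h, so the rule is switched there. The excess C/d in x has to carry y_h from
    1/e to 64 within about N/2^21 steps, yet changes 1/x only by O(1). *)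

Ltac vec := apply/rowP => ?; rewrite !mxE; ring.

Section Lattice.
Local Open Scope fset_scope.
Local Open Scope ring_scope.
Variable d : nat.
Notation V := 'rV[int]_d.
Definition dir := ('I_d * bool)%type.

Definition stp : dir -> V :=
  locked (fun s : dir => \row_j (if j == s.1 then (-1) ^+ s.2 else 0)).
Definition opd (s : dir) : dir := (s.1, ~~ s.2).
Definition perp (s t : dir) : bool := s.1 != t.1.

Lemma stpE s j : stp s ord0 j = if j == s.1 then (-1) ^+ s.2 else 0.
Proof. by rewrite /stp -lock mxE. Qed.

Lemma stp_opd s : stp (opd s) = - stp s.
Proof.
apply/rowP => j; rewrite !(mxE, stpE) /=; case: ifP => _; rewrite ?oppr0 //.
by case: s.2.
Qed.

Lemma opdK : involutive opd. Proof. by move=> [i b]; rewrite /opd /= negbK. Qed.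

Lemma stp_inj : injective stp.
Proof.
move=> [i b] [j c] /rowP /(_ i); rewrite !stpE /= eqxx.
by case: (eqVneq i j) => [-> | _]; case: b; case: c.
Qed.

Lemma stp_neq0 s : stp s != 0.
Proof.
apply/eqP => /rowP /(_ s.1); rewrite stpE mxE eqxx; by case: s.2.
Qed.

Lemma perp_sym s t : perp s t = perp t s. Proof. by rewrite /perp eq_sym. Qed.
Lemma perp_opr s t : perp s (opd t) = perp s t. Proof. by []. Qed.
Lemma perp_opl s t : perp (opd s) t = perp s t. Proof. by []. Qed.
Lemma perp_neq s t : perp s t -> s != t.
Proof. by apply: contraNneq => ->. Qed.

Lemma card_dir : #|{: dir}| = (2 * d)%N.
Proof. by rewrite card_prod card_ord card_bool mulnC. Qed.

Lemma stp_le1 s i : `|stp s ord0 i| <= 1.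
Proof. by rewrite stpE; case: ifP => // _; case: s.2. Qed.

Lemma sqr_sum1 (v : V) : \sum_i v ord0 i ^+ 2 = 1 -> exists s, v = stp s.
Proof.
move=> vs.
have [i vi0] : exists i, v ord0 i != 0.
  case: (pickP (fun i => v ord0 i != 0)) => [i h|h]; first by exists i.
  by move: vs; rewrite big1 // => i _; move/eqP: (h i) => /= ->; rewrite expr0n.
move: vs; rewrite (bigD1 i) //=.
set S := \sum_(_ | _) _ => vs.
have S0 : 0 <= S by apply: sumr_ge0 => j _; rewrite sqr_ge0.
have vi1 : 1 <= v ord0 i ^+ 2.
  have : 0 < v ord0 i ^+ 2 by rewrite lt0r sqr_ge0 sqrf_eq0 vi0.
  lia.
have Sz : S = 0 by lia.
have oth j : j != i -> v ord0 j = 0.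
  move=> ji; move/eqP: Sz; rewrite psumr_eq0; last by move=> k _; rewrite sqr_ge0.
  by move=> /allP /(_ j (mem_index_enum _)); rewrite ji /= sqrf_eq0 => /eqP.
have : v ord0 i ^+ 2 == 1 by apply/eqP; lia.
rewrite sqrf_eq1 => h.
exists (i, v ord0 i == -1); apply/rowP => j; rewrite stpE /=.
case: eqP => [->|/eqP /oth -> //].
by case/orP: h => /eqP ->.
Qed.

Lemma stp_sqr s : \sum_i stp s ord0 i ^+ 2 = 1.
Proof.
rewrite (bigD1 s.1) //= big1 ?addr0; first by rewrite stpE eqxx -exprM mulnC exprM sqrrN expr1n.
by move=> i si; rewrite stpE (negPf si) expr0n.
Qed.

(** Each step of a vanishing sum is cancelled by an opposite one; as neither the second nor the
    third step undoes its predecessor, only a square remains. The coordinates along the first three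
    steps decide every case. *)
Lemma stp_sum4 s t s' t' : stp s + stp t + stp s' + stp t' = 0 ->
  t != opd s -> s' != opd t -> [/\ perp s t, s' = opd s & t' = opd t].
Proof.
move=> /rowP h ts st.
have hs := h s.1; have ht := h t.1; have hs' := h s'.1.
move: hs ht hs' ts st; rewrite !(mxE, stpE) /perp /opd.
case: s {h} => i b; case: t => j c; case: s' => k e; case: t' => l f /=.
rewrite !xpair_eqE !eqxx.
case: (eqVneq i j) => [<-|ij]; case: (eqVneq i k) => [<-|ik]; rewrite ?eqxx;
 case: (eqVneq i l) => [<-|il]; rewrite ?eqxx ?(negPf ij) ?(negPf ik) ?(negPf il);
 rewrite ?(eq_sym _ i) ?(negPf ij) ?(negPf ik) ?(negPf il) /=;
 try (case: (eqVneq j k) => [<-|jk]); rewrite ?eqxx;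
 try (case: (eqVneq j l) => [<-|jl]); rewrite ?eqxx;
 case: b; case: c; case: e; case: f => //=;
 rewrite ?(eq_sym _ i) ?(negPf ij) ?(negPf ik) ?(negPf il) //;
 rewrite ?(eq_sym _ j) ?(negPf jk) ?(negPf jl) //.
Qed.


Lemma stpD_opd x s : x + stp s + stp (opd s) = x.
Proof. by rewrite stp_opd addrK. Qed.

Implicit Types D : {fset V}.

(* The pair (w, s) encodes the directed edge from w + stp s to its head w. *)
Definition in_bdry D (a : V * dir) := (a.1 \in D) && (a.1 + stp a.2 \notin D).

Definition link D (a b : V * dir) : Prop :=
  [\/ b.1 = a.1 /\ perp a.2 b.2,
      exists2 t, perp a.2 t & b = (a.1 + stp t, a.2)
    | exists2 t, perp a.2 t &
        a.1 + stp t \in D /\ b = (a.1 + stp a.2 + stp t, opd t)].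

(** Connectedness as an induction principle: what holds at one boundary edge and passes along links
    holds at all of them. No chains of edges are needed. *)
Definition bdry_connected D : Prop :=
  forall K : V * dir -> Prop, (exists2 a, in_bdry D a & K a) ->
    (forall a b, in_bdry D a -> in_bdry D b -> K a -> link D a b -> K b) ->
    forall a, in_bdry D a -> K a.

Definition vertex_connected D : Prop :=
  forall (K : V -> Prop) x, x \in D -> K x ->
    (forall y s, y \in D -> y + stp s \in D -> K y -> K (y + stp s)) ->
    forall y, y \in D -> K y.

(** Within [D] this describes V(P): x is the head of a boundary edge, or it is joined inside [D] to
    the head of a boundary edge perpendicular to the joining edge, so that both edges lie on a
    common 4-cycle. *)
Definition rimb D (x : V) :=
  [exists s, x + stp s \notin D] ||
  [exists s, (x + stp s \in D) &&
     [exists t, perp s t && (x + stp s + stp t \notin D)]].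
Definition rim D : {fset V} := [fset x in D | rimb D x].

(** The vertex boundary, written as an image of the rim so that its size is visibly at most 2d times
    that of the rim. *)
Definition outer D : {fset V} :=
  [fset v in [seq x + stp s | x <- (rim D : seq V), s <- enum {: dir}] | v \notin D].

Lemma link_sym D a b : in_bdry D a -> in_bdry D b -> link D a b -> link D b a.
Proof.
case: a b => [w s] [w' s'] /andP[/= wD wsD] /andP[/= wD' wsD'] [] /=.
- by move=> [-> p]; apply: Or31; rewrite perp_sym.
- move=> [t p [-> ->]]; apply: Or32; exists (opd t) => //=.
  by rewrite stpD_opd.
- move=> [t p [tD [-> ->]]]; apply: Or33; exists (opd s) => /=.
    by rewrite perp_sym.
  rewrite opdK !stp_opd; split; last by congr (_, _); vec.
  by rewrite addrAC addrK.
Qed.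

Lemma link_sub D D' a b : D `<=` D' -> link D a b -> link D' a b.
Proof.
move=> /fsubsetP DD []; [exact: Or31|exact: Or32|].
by move=> [t p [tD e]]; apply: Or33; exists t => //; split => //; exact: DD.
Qed.

Lemma in_rim D x : (x \in rim D) = (x \in D) && rimb D x.
Proof. by rewrite !inE. Qed.

Lemma rim_sub D x : x \in rim D -> x \in D.
Proof. by rewrite in_rim => /andP[]. Qed.

Lemma rim_head D w s : w \in D -> w + stp s \notin D -> w \in rim D.
Proof.
by move=> wD wsD; rewrite in_rim wD; apply/orP; left; apply/existsP; exists s.
Qed.

Lemma rim_perp D w s t : w \in D -> w + stp s \notin D -> perp s t ->
  w + stp t \in D -> w + stp t \in rim D.
Proof.
move=> wD wsD st tD; rewrite in_rim tD; apply/orP; right; apply/existsP.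
exists (opd t); rewrite stpD_opd wD; apply/existsP; exists s.
by rewrite wsD perp_opl perp_sym st.
Qed.

Lemma rim_opp D w s t : w + stp s \notin D ->
  w + stp s + stp t \in D -> w + stp s + stp t \in rim D.
Proof. by move=> wsD tD; apply: (@rim_head _ _ (opd t)); rewrite // stpD_opd. Qed.

Lemma in_outer D v : (v \in outer D) = (v \notin D) && [exists s, v + stp s \in D].
Proof.
rewrite /outer !inE /= andbC; case vD: (v \in D) => //=.
apply/allpairsP/existsP => /=.
  move=> [[w s] /= [xr _ ->]].
  by exists (opd s); rewrite stpD_opd; exact: rim_sub.
move=> [s vs]; exists (v + stp s, opd s); split; rewrite /= ?mem_enum ?stpD_opd //.
by apply: (@rim_head _ _ (opd s)); rewrite // stpD_opd vD.
Qed.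

Lemma card_outer D : (#|` outer D| <= 2 * d * #|` rim D|)%N.
Proof.
rewrite mulnC -card_dir cardE -(size_allpairs (fun x s => x + stp s)).
apply: uniq_leq_size; first exact: fset_uniq.
by move=> x; rewrite !inE /= => /andP[].
Qed.

Lemma rim_outer_disj D x : x \in rim D -> x \notin outer D.
Proof. by rewrite in_outer => /rim_sub ->. Qed.
End Lattice.

(** * Sets that share a boundary edge, and the extent of a boundary *)

Section Boundary.
Local Open Scope fset_scope.
Local Open Scope ring_scope.
Variable d : nat.
Notation V := 'rV[int]_d.
Notation dir := (dir d).
Implicit Types D : {fset V}.

Definition compatible D D' :=
  [disjoint rim D & outer D']%fset && [disjoint rim D' & outer D]%fset.

(** A common boundary edge is pushed along the links of [D]. The corners of a link's 4-cycle that
    lie in [D] are in the rim of [D], so they are not outer vertices of [D'] and [D'] cannot stop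
    before them; the tails are outer vertices of [D], so they are not in the rim of [D']. *)
Lemma compatible_sub D D' : bdry_connected D -> compatible D D' ->
  (exists2 a, in_bdry D a & in_bdry D' a) ->
  forall a, in_bdry D a -> in_bdry D' a.
Proof.
move=> JD /andP[/fdisjointP dA /fdisjointP dB] ex.
apply: (JD (fun a => in_bdry D' a) ex) => -[w s] [w' s'] /andP[/= wD wsD] /andP[/= wD' wsD'].
have enter x t : x \in D' -> x + stp t \in rim D -> x + stp t \in D'.
  move=> xD' /dA; apply: contraNT => nD'; rewrite in_outer nD'; apply/existsP.
  by exists (opd t); rewrite stpD_opd.
have outD x t : x \in D -> x + stp t \notin D -> x + stp t \notin rim D'.
  move=> xD xtD; apply/negP => /dB /negP; apply; rewrite in_outer xtD; apply/existsP.
  by exists (opd t); rewrite stpD_opd.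
move=> /andP[/= wD1 wsD1] []; rewrite /in_bdry /=.
- move=> [e p]; move: wD' wsD'; rewrite e wD1 => wD' wsD'.
  by apply: contra _ (outD _ _ wD' wsD'); exact: (rim_perp wD1 wsD1 p).
- move=> [t p [e1 e2]]; move: wD' wsD'; rewrite e1 e2 => wD' wsD'.
  rewrite enter //; last exact: rim_perp wD wsD p wD'.
  apply: contra _ (outD _ _ wD' wsD'); rewrite addrAC; exact: rim_opp.
- move=> [t p [tD [e1 e2]]]; move: wD' wsD'; rewrite e1 e2 => wD' wsD'.
  rewrite stpD_opd wsD1 andbT addrAC enter //; first by rewrite (enter _ _ wD1) //; exact: (rim_perp wD wsD p tD).
  rewrite addrAC; exact: rim_opp.
Qed.

(** A walk inside [D] that starts at a common head can leave [D'] only across a boundary edge of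
    [D']; this is also one of [D], which a walk inside [D] does not cross. *)
Lemma bdry_inj D D' : vertex_connected D -> vertex_connected D' ->
  (exists a, in_bdry D a) ->
  (forall a, in_bdry D a = in_bdry D' a) -> D = D'.
Proof.
move=> cD cD' [[w s] wsJ] eJ.
have h E E' : vertex_connected E -> in_bdry E (w, s) -> (forall a, in_bdry E a = in_bdry E' a) ->
    forall y, y \in E -> y \in E'.
  move=> cE ws e; apply: (cE (fun y => y \in E') w); first by case/andP: ws.
    by move: ws; rewrite e => /andP[].
  move=> y t yE ytE yE'; apply: contraT => ytE'.
  have : in_bdry E' (y, t) by rewrite /in_bdry yE' ytE'.
  by rewrite -e /in_bdry /= ytE andbF.
apply/fsetP => y; apply/idP/idP; first exact: h.
by apply: h => //; rewrite -?eJ.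
Qed.

Lemma compatible_inj D D' : vertex_connected D -> vertex_connected D' ->
  bdry_connected D -> bdry_connected D' -> compatible D D' ->
  (exists2 a, in_bdry D a & in_bdry D' a) -> D = D'.
Proof.
move=> cD cD' jD jD' co ex; apply: bdry_inj => //.
  by case: ex => a aD _; exists a.
move=> a; apply/idP/idP; first exact: compatible_sub.
apply: compatible_sub => //; first by rewrite /compatible andbC.
by case: ex => b b1 b2; exists b.
Qed.

Lemma stp_coord_lt (x : V) (t : dir) i (j : int) :
  x ord0 i < j -> (x + stp t) ord0 i <= j.
Proof.
move=> xj; rewrite mxE; have := stp_le1 t i; rewrite ler_norml => /andP[_].
move: (stp t ord0 i) (x ord0 i) xj => a b; lia.
Qed.

(* Consecutive links move the head inside the rim by unit steps, so no value of a
   coordinate is skipped. *)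
Lemma rim_crossing D i (j : int) a b : bdry_connected D ->
  in_bdry D a -> in_bdry D b -> a.1 ord0 i <= j -> j <= b.1 ord0 i ->
  exists2 z, z \in rim D & z ord0 i = j.
Proof.
move=> JD aD bD aj jb; apply: contrapT => nz.
have nj z : z \in rim D -> z ord0 i != j.
  by move=> zr; apply/negP => /eqP e; apply: nz; exists z.
have lt z : z \in rim D -> z ord0 i <= j -> z ord0 i < j.
  by move=> zr zj; rewrite lt_neqAle nj.
have hr c : in_bdry D c -> c.1 \in rim D.
  by case/andP => *; apply: rim_head; eassumption.
have : b.1 ord0 i < j.
  apply: (JD (fun c => c.1 ord0 i < j)) bD; first by exists a => //; apply: lt; rewrite ?hr.
  move=> [w s] [w' s'] J1 J2 /=; have := hr _ J2; have := hr _ J1 => /= r1 r2.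
  case/andP: J1 => /= wD wsD.
  move=> wj [] /=; first by move=> [->].
    by move=> [t p [e _]]; apply: lt => //; rewrite e; exact: stp_coord_lt.
  move=> [t p [tD [e _]]]; apply: (lt w') => //; rewrite e addrAC; apply: stp_coord_lt.
  by apply: (lt _ _ (stp_coord_lt t wj)); exact: (rim_perp wD wsD p tD).
by rewrite ltNge jb.
Qed.

(** By [rim_crossing] each of the m + 1 intermediate values of the coordinate is attained in the
    rim. *)
Lemma rim_span D i (m : nat) a b : bdry_connected D ->
  in_bdry D a -> in_bdry D b -> a.1 ord0 i + m%:Z <= b.1 ord0 i -> (m < #|` rim D|)%N.
Proof.
move=> JD aD bD ab.
have ex (k : 'I_m.+1) : exists z, (z \in rim D) && (z ord0 i == a.1 ord0 i + k%:Z).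
  have [||z zr /eqP ze] := @rim_crossing D i (a.1 ord0 i + k%:Z) a b JD aD bD.
  - by lia.
  - have := ltn_ord k; lia.
  by exists z; rewrite zr ze.
pose f k := xchoose (ex k).
have fP k : (f k \in rim D) && (f k ord0 i == a.1 ord0 i + k%:Z) := xchooseP (ex k).
have finj : injective f.
  move=> k l e; have /andP[_ /eqP h1] := fP k; have /andP[_ /eqP h2] := fP l.
  by apply: val_inj => /=; move: h1; rewrite e h2; lia.
have := @uniq_leq_size _ [seq f k | k <- enum 'I_m.+1] (rim D).
rewrite size_map size_enum_ord; apply.
  by rewrite map_inj_uniq ?enum_uniq.
by move=> z /mapP[k _ ->]; case/andP: (fP k).
Qed.

(** * Gluing two sets along a single edge *)

Section Glue.
Variables (D1 D2 : {fset V}) (z : V) (s : dir).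
Hypothesis z1 : z \in D1.
Hypothesis w2 : z + stp s \in D2.
Hypothesis disj : [disjoint D1 & D2]%fset.
Hypothesis uniq_edge : forall p t, p \in D1 -> p + stp t \in D2 -> p = z /\ t = s.
Let D := D1 `|` D2.

Let D2N1 x : x \in D2 -> x \notin D1.
Proof. by move: disj; rewrite fdisjoint_sym => /fdisjointP; apply. Qed.
Let D1N2 x : x \in D1 -> x \notin D2. Proof. by apply/fdisjointP. Qed.

Lemma uniq_edge' p t : p \in D2 -> p + stp t \in D1 -> p = z + stp s /\ t = opd s.
Proof.
move=> p2 pt; have [|e1 e2] := @uniq_edge (p + stp t) (opd t) pt; first by rewrite stpD_opd.
by rewrite -e1 -e2 stpD_opd opdK.
Qed.

Lemma glue_connected : vertex_connected D1 -> vertex_connected D2 -> vertex_connected D.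
Proof.
move=> c1 c2 K x xD Kx cl.
have cl1 E : E `<=` D -> forall y t, y \in E -> y + stp t \in E -> K y -> K (y + stp t).
  by move=> /fsubsetP ED y t /ED yE /ED ytE; exact: cl.
have S1 : D1 `<=` D by rewrite fsubsetUl.
have S2 : D2 `<=` D by rewrite fsubsetUr.
have f1 y : y \in D1 -> K y -> forall y', y' \in D1 -> K y'.
  by move=> y1 Ky; apply: (c1 K y) => //; exact: cl1.
have f2 y : y \in D2 -> K y -> forall y', y' \in D2 -> K y'.
  by move=> y1 Ky; apply: (c2 K y) => //; exact: cl1.
have zw : K z -> K (z + stp s) by apply: cl; rewrite !inE ?z1 ?w2 ?orbT.
have wz : K (z + stp s) -> K z.
  by rewrite -{2}(stpD_opd z s); apply: cl; rewrite ?stpD_opd !inE ?z1 ?w2 ?orbT.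
move=> y; move: xD; rewrite !inE => /orP[x1|x2] /orP[y1|y2].
- exact: f1 x1 Kx y y1.
- by apply: f2 w2 _ y y2; apply: zw; exact: f1 x1 Kx z z1.
- by apply: f1 z1 _ y y1; apply: wz; exact: f2 x2 Kx _ w2.
- exact: f2 x2 Kx y y2.
Qed.

Lemma in_bdry_glue1 a : in_bdry D1 a -> a <> (z, s) -> in_bdry D a.
Proof.
case: a => p t /andP[/= p1 pt] ne; rewrite /in_bdry /= !inE p1 (negPf pt) /=.
by apply/negP => /(uniq_edge p1) [e1 e2]; apply: ne; rewrite e1 e2.
Qed.

Lemma in_bdry_glue2 a : in_bdry D2 a -> a <> (z + stp s, opd s) -> in_bdry D a.
Proof.
case: a => p t /andP[/= p1 pt] ne; rewrite /in_bdry /= !inE p1 (negPf pt) orbT orbF /=.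
by apply/negP => /(uniq_edge' p1) [e1 e2]; apply: ne; rewrite e1 e2.
Qed.

Lemma in_bdry_unglue a : in_bdry D a -> in_bdry D1 a \/ in_bdry D2 a.
Proof.
rewrite /in_bdry !inE negb_or => /andP[/orP[]-> /andP[-> ->]]; [by left|by right].
Qed.

Hypothesis noperp : forall u, perp s u -> z + stp u \notin D1.
Hypothesis third : forall t t' : dir, exists2 u, perp t u & perp t' u.

(** Gluing destroys one boundary edge on each side, the joining edge in its two directions. The
    edges (z, u) with u perpendicular to s serve as a hub: a link that used a lost edge is rerouted
    through the hub. *)
Lemma glue_bdry_connected : bdry_connected D1 -> bdry_connected D2 -> bdry_connected D.
Proof.
move=> J1 J2.
have alphaD u : perp s u -> in_bdry D (z, u).
  move=> su; apply: in_bdry_glue1; first by rewrite /in_bdry /= z1 noperp.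
  by move=> [e]; move: su; rewrite e /perp eqxx.
have core (K : V * dir -> Prop) :
  (forall a b, in_bdry D a -> in_bdry D b -> K a -> link D a b -> K b) ->
  (forall u, perp s u -> K (z, u)) -> forall a, in_bdry D a -> K a.
  move=> cl Kal a aD; case: (in_bdry_unglue aD) => aE.
  (* The lost edge is added to [K], so that connectedness of the boundary of [D1] applies; by
     [noperp] its links in [D1] all end in the hub. *)
  - pose K1 b := b = (z, s) \/ K b.
    have : K1 a.
      apply: (J1 K1) aE.
        exists (z, s); last by left.
        by rewrite /in_bdry z1 D2N1.
      move=> b c bE cE Kb lbc; have [->|cN] := pselect (c = (z, s)); first by left.
      right; have cD := in_bdry_glue1 cE cN.
      have [eb|bN] := pselect (b = (z, s)); last first.
        case: Kb => // Kb; apply: (cl b) => //; first exact: in_bdry_glue1.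
        by apply: link_sub lbc; rewrite fsubsetUl.
      move: lbc; rewrite eb; case => /=.
      + by case: c cE cN cD => c1 c2 _ _ _ /= [-> p]; exact: Kal.
      + by move=> [t p e]; move: cE; rewrite e /in_bdry /= (negPf (noperp p)).
      + by move=> [t p [h _]]; rewrite (negPf (noperp p)) in h.
    by case=> // e; move: aD; rewrite e /in_bdry /= !inE w2 orbT andbF.
  - pose K2 b := b = (z + stp s, opd s) \/ K b.
    have : K2 a.
      apply: (J2 K2) aE.
        exists (z + stp s, opd s); last by left.
        by rewrite /in_bdry /= w2 stpD_opd D1N2.
      move=> b c bE cE Kb lbc; have [->|cN] := pselect (c = (z + stp s, opd s)); first by left.
      right; have cD := in_bdry_glue2 cE cN.
      have [eb|bN] := pselect (b = (z + stp s, opd s)); last first.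
        case: Kb => // Kb; apply: (cl b) => //; first exact: in_bdry_glue2.
        by apply: link_sub lbc; rewrite fsubsetUr.
      move: lbc; rewrite eb; case => /=.
      (* The edge (z + s, c2) is parallel to the hub edge (z, c2), one step further along s. *)
      + case: c cE cN cD => c1 c2 cE cN cD /= [e p].
        apply: (cl (z, c2)) => //; [exact: alphaD|exact: Kal|].
        by apply: Or32; exists s; rewrite /= ?e // perp_sym.
      (* The edge with head z + s + t has the same tail z + t as the hub edge (z, t). *)
      + move=> [t p e]; rewrite perp_opl in p.
        apply: (cl (z, t)) => //; [exact: alphaD|exact: Kal|].
        apply: Or33; exists s; rewrite /= 1?perp_sym //; split; first by rewrite !inE w2 orbT.
        by rewrite e addrAC.
      + move=> [t p [tD e]]; move: cE; rewrite e /in_bdry /= stpD_opd => /andP[h _].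
        by have [_ e2] := uniq_edge z1 h; rewrite perp_opl e2 /perp eqxx in p.
    by case=> // e; move: aD; rewrite e /in_bdry /= !inE stpD_opd z1 /= andbF.
move=> K [a0 a0D Ka0] cl.
(* Hub directions on the same axis are joined through a direction perpendicular to them and to s. *)
have all_al u : perp s u -> K (z, u) -> forall v, perp s v -> K (z, v).
  move=> su Ku v sv; have [t ut vt] := third u v.
  have [t' ut' st'] := third u s.
  have step u' v' : perp s u' -> perp s v' -> perp u' v' -> K (z, u') -> K (z, v').
    move=> h1 h2 h3 h; apply: (cl (z, u')) => //; try exact: alphaD.
    by apply: Or31.
  case uv: (perp u v); first exact: step uv Ku.
  apply: (step t' v) => //; last exact: step ut' Ku.
  move: ut' uv; rewrite /perp => h /negbFE /eqP <-; by rewrite eq_sym.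
(* If no hub edge has [K], then, links being symmetric, the negation of [K] spreads from the hub to
   the whole boundary, against [a0]. *)
have [[u [su Ku]]|nK] := pselect (exists u, perp s u /\ K (z, u)).
  by apply: core => //; exact: all_al Ku.
have : forall a, in_bdry D a -> ~ K a.
  apply: core; last by move=> u su Ku; apply: nK; exists u.
  move=> a b aD bD nKa lab Kb; apply: nKa; apply: (cl b) => //; exact: link_sym.
by move=> /(_ _ a0D Ka0).
Qed.

Hypothesis free1 : exists u v, [/\ perp s u, perp s v, perp u v,
  z + stp u \notin D1 & z + stp v \notin D1].
Hypothesis free2 : exists u v, [/\ perp s u, perp s v, perp u v,
  z + stp s + stp u \notin D2 & z + stp s + stp v \notin D2].

(** A vertex that owed its place in the rim to the lost edge needs another witness. The two free
    directions at either end are perpendicular to each other, so one of them is perpendicular to any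
    prescribed direction. *)
Lemma glue_rim : rim D = rim D1 `|` rim D2.
Proof.
have half (E E' : {fset V}) y r : D = E `|` E' -> [disjoint E & E']%fset ->
    (forall p t, p \in E -> p + stp t \in E' -> p = y /\ t = r) ->
    y \in E -> y + stp r \in E' ->
    (exists u v, [/\ perp r u, perp r v, perp u v, y + stp u \notin E & y + stp v \notin E]) ->
    forall x, x \in E -> (x \in rim D) = (x \in rim E).
  move=> -> dis ue yE yrE' [u [v [ru rv uv uE vE]]] x xE.
  have EN q : q \in E' -> q \notin E.
    by move: dis; rewrite fdisjoint_sym => /fdisjointP; apply.
  have fr t : perp r t -> y + stp t \notin E -> y + stp t \notin E `|` E'.
    move=> rt tE; rewrite !inE (negPf tE) /=; apply/negP => /(ue _ _ yE) [_ e].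
    by move: rt; rewrite e /perp eqxx.
  rewrite !in_rim !inE xE /=; apply/idP/idP.
  - case/orP=> /existsP[t]; rewrite !inE ?negb_or.
      by move=> /andP[h _]; apply/orP; left; apply/existsP; exists t.
    case/andP=> /orP[tE|tE'] /existsP[q]; rewrite !inE negb_or => /andP[tq /andP[qE qE']].
      apply/orP; right; apply/existsP; exists t; rewrite tE /=.
      by apply/existsP; exists q; rewrite tq.
    by apply/orP; left; apply/existsP; exists t; exact: EN.
  - case/orP=> /existsP[t].
      case tE': (x + stp t \in E') => tE; last first.
        by apply/orP; left; apply/existsP; exists t; rewrite !inE (negPf tE) tE'.
      have [-> _] := ue _ _ xE tE'.
      by apply/orP; left; apply/existsP; exists u; exact: fr.
    case/andP=> tE /existsP[q /andP[tq qE]].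
    apply/orP; right; apply/existsP; exists t; rewrite !inE tE /=.
    case qE': (x + stp t + stp q \in E'); last first.
      by apply/existsP; exists q; rewrite !inE (negPf qE) qE' tq.
    have [-> _] := ue _ _ tE qE'.
    case tu: (perp t u); apply/existsP; first by exists u; rewrite tu fr.
    exists v; rewrite fr // andbT; move: tu uv; rewrite /perp => /negbFE /eqP -> //.
have sub1 x : x \in D1 -> (x \in rim D) = (x \in rim D1).
  by apply: (half D1 D2 z s).
have sub2 x : x \in D2 -> (x \in rim D) = (x \in rim D2).
  apply: (half D2 D1 (z + stp s) (opd s)); rewrite ?stpD_opd ?(fdisjoint_sym D2) //.
  - by rewrite /D fsetUC.
  - exact: uniq_edge'.
apply/fsetP => x; rewrite [RHS]in_fsetU.
case x1: (x \in D1).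
  rewrite sub1 // (_ : x \in rim D2 = false) ?orbF //.
  by apply/negP => /rim_sub; rewrite (negPf (D1N2 x1)).
have -> /= : x \in rim D1 = false by apply/negP => /rim_sub; rewrite x1.
case x2: (x \in D2); first by rewrite sub2.
by rewrite !in_rim !inE x1 x2.
Qed.
End Glue.

End Boundary.

(** * Invariance under translations *)

Section Shift.
Local Open Scope fset_scope.
Local Open Scope ring_scope.
Variable d : nat.
Notation V := 'rV[int]_d.
Notation dir := (dir d).
Implicit Types D : {fset V}.

Definition good D := vertex_connected D /\ bdry_connected D.

Definition translate (v : V) D : {fset V} := [fset x + v | x in D].

Lemma in_translate v D x : (x \in translate v D) = (x - v \in D).
Proof.
apply/imfsetP/idP => /= [[y yD ->]|xD]; first by rewrite addrK.
by exists (x - v) => //; rewrite subrK.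
Qed.

Lemma card_translate v D : #|` translate v D| = #|` D|.
Proof. by rewrite card_imfset //; exact: addIr. Qed.

Lemma translateK v D : translate (- v) (translate v D) = D.
Proof. by apply/fsetP => x; rewrite !in_translate opprK addrK. Qed.

Lemma translate_inj v : injective (translate v).
Proof. by move=> D D' e; rewrite -(translateK v D) e translateK. Qed.

Lemma in_bdry_translate v D a : in_bdry (translate v D) a = in_bdry D (a.1 - v, a.2).
Proof. by rewrite /in_bdry !in_translate /= addrAC. Qed.

Lemma link_translate v D a b : link D a b -> link (translate v D) (a.1 + v, a.2) (b.1 + v, b.2).
Proof.
case=> /=; first by move=> [-> p]; exact: Or31.
  by move=> [t p ->]; apply: Or32; exists t => //=; rewrite addrAC.
move=> [t p [tD ->]]; apply: Or33; exists t => //=; split.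
  by rewrite in_translate addrAC addrK.
by congr (_, _); rewrite addrAC; congr (_ + _); rewrite addrAC.
Qed.

Lemma good_translate v D : good D -> good (translate v D).
Proof.
move=> [cD jD]; split.
- move=> K x xD Kx cl y yD.
  have := cD (fun u => K (u + v)) (x - v); rewrite -in_translate subrK => /(_ xD Kx) h.
  have -> : y = y - v + v by rewrite subrK.
  apply: h; last by rewrite -in_translate.
  by move=> u s uD usD Ku; rewrite addrAC; apply: cl => //; rewrite in_translate ?addrK // addrAC addrK.
- move=> K [a aD Ka] cl b bD.
  have e (c : V * dir) : c = (c.1 - v + v, c.2) by rewrite subrK -surjective_pairing.
  rewrite (e b).
  apply: (jD (fun c => K (c.1 + v, c.2)) _ _ (b.1 - v, b.2)); last by rewrite -in_bdry_translate.
    by exists (a.1 - v, a.2); rewrite -?in_bdry_translate -?e.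
  move=> c c' cD' cD'' Kc lc; apply: (cl (c.1 + v, c.2)) => //.
  + by rewrite in_bdry_translate /= addrK -surjective_pairing.
  + by rewrite in_bdry_translate /= addrK -surjective_pairing.
  + exact: link_translate.
Qed.

Lemma rim_translate v D : rim (translate v D) = translate v (rim D).
Proof.
apply/fsetP => x; rewrite in_translate !in_rim in_translate; congr andb.
have e y s : (y + stp s \in translate v D) = (y - v + stp s \in D) by rewrite in_translate addrAC.
rewrite /rimb; congr orb; apply: eq_existsb => s; rewrite e //.
congr andb; apply: eq_existsb => t; by rewrite e (addrAC x).
Qed.

Lemma card_rim_translate v D : #|` rim (translate v D)| = #|` rim D|.
Proof. by rewrite rim_translate card_translate. Qed.

End Shift.

(** * Sets grown by successive leaves *)

Section Grow.
Local Open Scope fset_scope.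
Local Open Scope ring_scope.
Variable d : nat.
Notation V := 'rV[int]_d.
Notation dir := (dir d).
Implicit Types D : {fset V}.
Variables i0 i1 i2 : 'I_d.
Hypotheses (i01 : i0 != i1) (i02 : i0 != i2) (i12 : i1 != i2).

Lemma third (t t' : dir) : exists2 u, perp t u & perp t' u.
Proof.
rewrite /perp; case: (pickP [pred i | (t.1 != i) && (t'.1 != i)]) => [i /= /andP[h1 h2]|h].
  by exists (i, false).
have := h i0; have := h i1; have := h i2; rewrite /=.
case: (eqVneq t.1 i0) => [->|_] /=; case: (eqVneq t'.1 i0) => [->|_] /=; rewrite ?i01 ?i02 //=.
- by case: (eqVneq t'.1 i1) => [->|] //=; rewrite i12.
- by case: (eqVneq t.1 i1) => [->|] //=; rewrite i12.
Qed.

Definition leaf D z s := [/\ z \notin D, z + stp s \in D & forall t, z + stp t \in D -> t = s].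

Lemma in_set1_stp (z : V) s : z + stp s \in [fset z] = false.
Proof.
by rewrite inE -[X in _ == X]addr0 (inj_eq (addrI z)); apply/negbTE/stp_neq0.
Qed.

Lemma good1 (z : V) : good [fset z].
Proof.
split; first by move=> K x /[!inE] /eqP -> Kz _ y /[!inE] /eqP ->.
have zJ s : in_bdry [fset z] (z, s) by rewrite /in_bdry /= in_set1_stp inE eqxx.
move=> K [[x s] /andP[/= /[!inE]/eqP-> _] Ks] cl [y t] /andP[/= /[!inE]/eqP-> _].
have [u su tu] := third s t.
apply: (cl (z, u)) => //; last by apply: Or31; rewrite /= perp_sym.
by apply: (cl (z, s)) => //; apply: Or31.
Qed.

Lemma leaf_uniq_edge D z s : leaf D z s ->
  forall p t, p \in [fset z] -> p + stp t \in D -> p = z /\ t = s.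
Proof. by move=> [_ _ u] p t /[!inE]/eqP-> /u. Qed.

Lemma leaf_disj D z s : leaf D z s -> [disjoint [fset z] & D]%fset.
Proof. by move=> [zD _ _]; apply/fdisjointP => x /[!inE]/eqP->. Qed.

Lemma leaf_good D z s : leaf D z s -> good D -> good (z |` D).
Proof.
move=> lf [cD jD]; have [zD wD u] := lf.
have [c1 j1] := good1 z; have z1 : z \in [fset z] by rewrite inE.
split; first exact: (glue_connected z1 wD).
apply: (glue_bdry_connected z1 wD (leaf_disj lf) (leaf_uniq_edge lf) _ third) => //.
by move=> v _; rewrite in_set1_stp.
Qed.

(** Induced trees of the lattice: a new vertex has exactly one neighbour in the set so far, so that
    adding it is a gluing with a singleton. *)
Inductive grow (r : V) : {fset V} -> Prop :=
| grow1 : grow r [fset r]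
| grow_leaf D z s : grow r D -> leaf D z s -> grow r (z |` D).

Lemma grow_good r D : grow r D -> good D.
Proof.
elim=> [|E z s _ gE lf]; [exact: good1|exact: leaf_good lf gE].
Qed.

Lemma grow_root r D : grow r D -> r \in D.
Proof. by elim=> [|E z s _ rE lf]; rewrite !inE ?rE ?orbT. Qed.

(** The vertex of a 4-cycle that was added last would have had two neighbours. *)
Lemma grow_squarefree r D : grow r D -> forall x s t, perp s t -> x \in D ->
  x + stp s \in D -> x + stp t \in D -> x + stp s + stp t \notin D.
Proof.
elim=> [|E z q _ IH lf] x s t st.
  by move=> /[!inE]/eqP->; rewrite -in_fset1 in_set1_stp.
have [zE zqE ue] := lf.
have two a b : a != b -> z + stp a \in z |` E -> z + stp b \in z |` E -> False.
  move=> ab; rewrite !in_fset1U -!in_fset1 !in_set1_stp /= => /ue e1 /ue e2.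
  by rewrite e1 e2 eqxx in ab.
have ts : perp t s by rewrite perp_sym.
have nst := perp_neq st.
have nsot : s != opd t by apply: perp_neq.
have ntos : t != opd s by apply: perp_neq.
have noo : opd s != opd t by apply: perp_neq.
move=> xD xs xt; apply/negP => xst.
have [e|xz] := eqVneq x z; first by move: xs xt; rewrite e; exact: two nst.
have [e|xsz] := eqVneq (x + stp s) z.
  by subst z; apply: (two t (opd s)) => //; rewrite stpD_opd.
have [e|xtz] := eqVneq (x + stp t) z.
  by subst z; apply: (two s (opd t)) => //; rewrite ?stpD_opd // addrAC.
have [e|xstz] := eqVneq (x + stp s + stp t) z.
  by subst z; apply: (two (opd s) (opd t)) => //; rewrite ?stpD_opd // addrAC stpD_opd.
move: xD xs xt xst; rewrite !in_fset1U (negPf xz) (negPf xsz) (negPf xtz) (negPf xstz) /=.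
by move=> h1 h2 h3; apply/negP; exact: IH.
Qed.

(** If all neighbours of x are present, then x + s + t is missing for perpendicular s and t, since a
    tree contains no 4-cycle; so x + s is the head of a boundary edge perpendicular to s. *)
Lemma grow_rim r D : grow r D -> rim D = D.
Proof.
move=> gD; apply/fsetP => x; rewrite in_rim; case xD: (x \in D) => //=.
have [/existsP nb|/existsPn nb] := boolP [exists s, x + stp s \notin D].
  by rewrite /rimb; apply/orP; left; apply/existsP.
have {}nb s : x + stp s \in D by have := nb s; rewrite negbK.
apply/orP; right.
pose s : dir := (i0, false); have [t st _] := third s s.
apply/existsP; exists s; rewrite nb /=; apply/existsP; exists t; rewrite st /=.
exact: grow_squarefree gD _ _ _ st xD (nb s) (nb t).
Qed.

(** The growth of [D] is replayed on top of [K]; only the root of [D] touches [K], so the later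
    leaves remain leaves. *)
Lemma grow_union r D : grow r D -> forall q K s, grow q K -> leaf K r s ->
  (forall x, x \in D -> x \notin K) ->
  (forall x t, x \in D -> x + stp t \in K -> x = r) -> grow q (K `|` D).
Proof.
elim=> [|E z t gE IH lf] q K s gK lK dis ue.
  by rewrite fsetUC; exact: grow_leaf gK lK.
rewrite fsetUCA; have [zE ztE uz] := lf.
apply: (@grow_leaf _ _ _ t).
  apply: (IH _ _ s) => //; first by move=> x xE; apply: dis; rewrite !inE xE orbT.
  by move=> x u xE; apply: ue; rewrite !inE xE orbT.
split; rewrite ?inE ?ztE ?orbT //.
  by rewrite negb_or zE dis // !inE eqxx.
move=> u; rewrite inE => /orP[h|/uz //].
have e : z = r by apply: ue h; rewrite !inE eqxx.
by move: zE; rewrite e (grow_root gE).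
Qed.

Lemma grow_translate r D v : grow r D -> grow (r + v) (translate v D).
Proof.
elim=> [|E z s _ IH [h1 h2 h3]].
  rewrite (_ : translate v _ = [fset r + v]); first exact: grow1.
  by apply/fsetP => x; rewrite in_translate !inE subr_eq.
rewrite (_ : translate v (z |` E) = (z + v) |` translate v E); last first.
  apply/fsetP => x; rewrite !(in_translate, inE) subr_eq //.
apply: (grow_leaf (s := s)) => //; split.
- by rewrite in_translate addrK.
- by rewrite in_translate addrAC addrK.
- by move=> t; rewrite in_translate addrAC addrK; exact: h3.
Qed.

End Grow.

(* Coordinates of vertices occur with several convertible types, which defeats lia. *)
Ltac clia := intros;
  repeat match goal with H : context [@fun_of_matrix _ _ _ _ _ _] |- _ =>
    match type of H with is_true _ => revert H | _ = _ => revert H end end;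
  repeat match goal with |- context [@fun_of_matrix ?T ?m ?n ?A ?i ?j] =>
    move: (@fun_of_matrix T m n A i j) => ? end; lia.

(** * Concatenation through an extra vertex *)

Section Concat.
Local Open Scope fset_scope.
Local Open Scope ring_scope.
Variable d : nat.
Notation V := 'rV[int]_d.
Notation dir := (dir d).
Implicit Types D : {fset V}.
Variables i0 i1 i2 : 'I_d.
Hypotheses (i01 : i0 != i1) (i02 : i0 != i2) (i12 : i1 != i2).

Lemma fset_argmax (f : V -> int) D : D != fset0 ->
  exists2 w, w \in D & forall x, x \in D -> f x <= f w.
Proof.
elim/finSet_rect: D => D IH /fset0Pn[y yD].
have [e|ne] := eqVneq (D `\ y) fset0.
  exists y => // x xD; have [->|xy] := eqVneq x y; first exact: lexx.
  by have : x \in D `\ y; [rewrite !inE xy|rewrite e inE].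
have [|w wD wm] := IH (D `\ y) _ ne; first exact: fproperD1.
have wD' : w \in D by move: wD; rewrite !inE => /andP[].
have [h|h] := leP (f y) (f w).
  exists w => // x xD; have [->//|xy] := eqVneq x y; apply: wm; by rewrite !inE xy.
exists y => // x xD; have [->|xy] := eqVneq x y; first exact: lexx.
by apply: le_trans (ltW h); apply: wm; rewrite !inE xy.
Qed.

(* b = false : a highest vertex in direction i0, b = true : a lowest one. *)
Definition extreme (b : bool) D (w : V) :=
  [/\ w \in D, forall x : V, x \in D -> (-1) ^+ b * x ord0 i0 <= (-1) ^+ b * w ord0 i0,
      w + stp (i1, b) \notin D & w + stp (i2, b) \notin D].

(** Among the vertices extreme along [i0], take one that maximises the signed sum of the coordinates
    [i1] and [i2]. This leaves the two perpendicular directions free that [glue_rim] asks for. *)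
Lemma extreme_exists b D : D != fset0 -> exists w, extreme b D w.
Proof.
move=> D0; have [w0 w0D w0m] := fset_argmax (fun x => (-1) ^+ b * x ord0 i0) D0.
pose E := [fset x in D | x ord0 i0 == w0 ord0 i0].
have [|w] := @fset_argmax (fun x => (-1) ^+ b * (x ord0 i1 + x ord0 i2)) E.
  by apply/fset0Pn; exists w0; rewrite !inE w0D eqxx.
rewrite !inE => /andP[wD /eqP ww0] wm.
have sg : (-1) ^+ b * (-1) ^+ b = 1 :> int by case: b {w0m wm}.
have out j : j = i1 \/ j = i2 -> w + stp (j, b) \notin D.
  move=> hj; apply/negP => h.
  have : w + stp (j, b) \in E.
    rewrite !inE h !mxE stpE /= ww0; case: hj => ->; rewrite ?(negPf i01) ?(negPf i02) addr0 //.
  move/wm; rewrite !mxE !stpE /=; case: hj => ->; rewrite ?eqxx ?(negPf i12) ?(eq_sym i2) ?(negPf i12);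
  move: (w _ i1) (w _ i2) => p q; clear; case: b; rewrite ?expr0 ?expr1; lia.
by exists w; split => //; [move=> x /w0m; rewrite ww0|apply: out; left|apply: out; right].
Qed.

Lemma extreme_translate b D r : extreme b D r -> extreme b (translate (- r) D) 0.
Proof.
move=> [rD rm h1 h2]; split; rewrite ?in_translate ?opprK ?add0r //; try by rewrite addrC.
move=> y; rewrite in_translate opprK => /rm; rewrite mxE mulrDr [(0 : V) _ _]mxE mulr0.
by rewrite -[leRHS]add0r lerD2r.
Qed.

Definition up : dir := (i0, false).

Lemma up_coord (x : V) : (x + stp up) ord0 i0 = x ord0 i0 + 1.
Proof. by rewrite mxE stpE eqxx. Qed.

Definition joint (w : V) : V := w + stp up.
(** The extra vertex [joint w] has no neighbour perpendicular to [up], as [glue_bdry_connected]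
    demands at one end of the joining edge; a highest vertex of [D1] need not have this property. *)
Definition join D1 w D2 := (joint w |` D1) `|` translate (joint w + stp up) D2.

Section Join.
Variables (D1 D2 : {fset V}) (w : V).
Hypotheses (top : extreme false D1 w) (bot : extreme true D2 0).
Let z : V := joint w.

Let coord1 (x : V) : x \in D1 -> x ord0 i0 <= w ord0 i0.
Proof. by case: top => _ h _ _ /h; rewrite !expr0 !mul1r. Qed.
Let coord2 (x : V) : x \in D2 -> 0 <= x ord0 i0.
Proof. by case: bot => _ h _ _ /h; rewrite !expr1 mxE mulr0 mulN1r oppr_le0. Qed.
Let zc : z ord0 i0 = w ord0 i0 + 1. Proof. exact: up_coord. Qed.

(** At the height of [joint w] there is no other vertex of the union, so heights tell the two parts
    apart. *)
Lemma join_below (x : V) : x \in join D1 w D2 -> (x ord0 i0 < w ord0 i0 + 1) = (x \in D1).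
Proof.
rewrite !inE in_translate; case x1: (x \in D1).
  by move=> _; apply/idP; have := coord1 x1; clia.
rewrite orbF => /orP[/eqP ->|]; first by rewrite zc ltxx.
move=> /coord2; rewrite 2!mxE up_coord zc => h; apply/negbTE; rewrite -leNgt.
clia.
Qed.

Lemma join_above (x : V) : x \in join D1 w D2 ->
  (w ord0 i0 + 1 < x ord0 i0) = (x - (z + stp up) \in D2).
Proof.
rewrite !inE -in_translate; case x2: (x \in translate _ D2).
  move=> _; apply/idP.
  by move: x2; rewrite in_translate => /coord2; rewrite 2!mxE up_coord zc; clia.
by rewrite orbF => /orP[/eqP ->|/coord1 h]; apply/negbTE; rewrite -leNgt ?zc ?lexx //; clia.
Qed.

Lemma join_leaf : leaf D1 z (opd up).
Proof.
split; rewrite ?stpD_opd; last 2 first.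
- by case: top.
- move=> t /coord1; rewrite mxE zc stpE; case: t => j b /=.
  by case: eqP => [<-|_]; case: b => /= h; first [by [] | exfalso; clia].
by apply/negP => /coord1; rewrite zc; clia.
Qed.

Let D1' := z |` D1.
Let D2' := translate (z + stp up) D2.
Let coord1' (x : V) : x \in D1' -> x = z \/ x ord0 i0 < z ord0 i0.
Proof. by rewrite !inE => /orP[/eqP|/coord1 h]; [left|right; rewrite zc; clia]. Qed.
Let coord2' (x : V) : x \in D2' -> z ord0 i0 + 1 <= x ord0 i0.
Proof. by rewrite in_translate => /coord2; rewrite 2!mxE up_coord; clia. Qed.
Let z1 : z \in D1'. Proof. by rewrite !inE eqxx. Qed.
Let w2 : z + stp up \in D2'. Proof. by rewrite in_translate subrr; case: bot. Qed.
Let disj : [disjoint D1' & D2']%fset.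
Proof.
apply/fdisjointP => x /coord1' h; apply/negP => /coord2'.
by case: h => [->|]; clia.
Qed.
Let uniq_edge (p : V) t : p \in D1' -> p + stp t \in D2' -> p = z /\ t = up.
Proof.
move=> /coord1' h /coord2'; rewrite [(p + _) _ _]mxE stpE; case: t => j b /=.
case: h => [->|hp]; case: eqP => [<-|_]; case: b => /= h1; first [by [] | exfalso; clia].
Qed.
Let noperp u : perp up u -> z + stp u \notin D1'.
Proof.
move=> pu; apply/negP => /coord1' []; first by rewrite -[RHS]addr0 => /addrI/eqP; rewrite (negPf (stp_neq0 u)).
by rewrite mxE stpE (negPf pu) addr0 ltxx.
Qed.

Lemma join_good : good D1 -> good D2 -> good (join D1 w D2).
Proof.
move=> g1 g2; have [c1 j1] : good D1' := leaf_good i01 i02 i12 join_leaf g1.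
have [c2 j2] : good D2' := good_translate _ g2.
split; first exact: (glue_connected z1 w2 c1 c2).
exact: (glue_bdry_connected z1 w2 disj uniq_edge noperp (third i01 i02 i12) j1 j2).
Qed.

Lemma join_rim : rim (join D1 w D2) = (z |` rim D1) `|` translate (z + stp up) (rim D2).
Proof.
have -> : z |` rim D1 = rim D1'.
  have [_ wD1 _] := join_leaf.
  rewrite (glue_rim (z := z) (s := opd up)) //.
  - congr fsetU; apply/fsetP => x; rewrite in_rim !inE; case: eqP => // -> /=.
    by apply/esym/orP; left; apply/existsP; exists up; rewrite in_set1_stp.
  - by rewrite inE.
  - exact: leaf_disj join_leaf.
  - exact: leaf_uniq_edge join_leaf.
  - by exists (i1, false), (i2, false); rewrite !in_set1_stp.
  - by exists (i1, false), (i2, false); case: top => _ _ h1 h2; rewrite stpD_opd.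
rewrite -rim_translate; apply: (glue_rim z1 w2) => //.
- by exists (i1, false), (i2, false); split => //; apply: noperp.
- exists (i1, true), (i2, true); case: bot => _ _ h1 h2.
  by split => //; rewrite in_translate addrAC subrr.
Qed.

Lemma join_card_rim : #|` rim (join D1 w D2)| = (#|` rim D1| + #|` rim D2| + 1)%N.
Proof.
have zr : z \notin rim D1 by apply/negP => /rim_sub /coord1; rewrite zc; clia.
rewrite join_rim cardfsU disjoint_fsetI0; last first.
  apply/fdisjointP => x xr; apply: contraL (_ : x \in D1').
    rewrite in_translate => h; apply/negP => /(fdisjointP disj); rewrite in_translate.
    by rewrite (rim_sub h).
  by move: xr; rewrite !inE => /orP[->|/andP[->]]; rewrite ?orbT.
by rewrite cardfs0 subn0 cardfsU1 zr card_translate; clia.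
Qed.

Lemma join_extreme : extreme true D1 0 -> extreme true (join D1 w D2) 0.
Proof.
move=> [h0 h1 h2 h3].
have c (x : V) : x \in D1 -> 0 <= x ord0 i0.
  by move=> /h1; rewrite !expr1 mxE mulr0 mulN1r oppr_le0.
have wD1 : w \in D1 by case: top.
have no j : i0 != j -> 0 + stp (j, true) \notin D1 -> 0 + stp (j, true) \notin join D1 w D2.
  move=> ij nD; apply/negP => h; move: nD; rewrite -join_below // add0r stpE (negPf ij).
  by rewrite ltzD1 (c _ wD1).
split; rewrite ?no //; first by rewrite !inE h0 orbT.
move=> x xD; rewrite expr1 mxE mulr0 mulN1r oppr_le0.
case: (boolP (x \in D1)) => [/c //|]; rewrite -join_below // -leNgt.
by apply: le_trans; rewrite addr_ge0 // c.
Qed.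

End Join.

(** Only the height of the cut has to be recovered, and the rim size of the lower part fixes it: if
    the first cut were lower, [D1'] would have the whole rim of [D1] and also the joint in its rim,
    which would be too large. *)
Lemma join_inj D1 w D2 D1' w' D2' :
  extreme false D1 w -> extreme true D2 0 ->
  extreme false D1' w' -> extreme true D2' 0 ->
  #|` rim D1| = #|` rim D1'| -> (D1 = D1' -> w = w') ->
  join D1 w D2 = join D1' w' D2' -> D1 = D1' /\ D2 = D2'.
Proof.
move=> t1 b2 t1' b2' ec ew e.
have half E v F E' v' F' : extreme false E v -> extreme true F 0 ->
    extreme false E' v' -> extreme true F' 0 -> #|` rim E| = #|` rim E'| ->
    join E v F = join E' v' F' -> v' ord0 i0 <= v ord0 i0.
  move=> h1 h2 h3 h4 ecE eE; rewrite leNgt; apply/negP => lt.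
  have : (#|` joint v |` rim E| <= #|` rim E'|)%N.
    apply: fsubset_leq_card; apply/fsubsetP => x xr.
    have xr' : x \in rim (join E v F) by rewrite join_rim // inE xr.
    have xj := rim_sub xr'.
    have : x \in E'.
      rewrite eE in xj; rewrite -(join_below h3 h4) //.
      move: xr; rewrite !inE => /orP[/eqP->|/andP[xE _]]; first by rewrite up_coord; clia.
      by case: h1 => _ /(_ _ xE) + _ _; rewrite !expr0 !mul1r; clia.
    move: xr'; rewrite eE join_rim // !inE in_translate => /orP[/orP[/eqP->|//]|].
      by case: h3 => _ h _ _ /h; rewrite !expr0 !mul1r up_coord; clia.
    move=> /rim_sub; rewrite -in_translate => h xE'.
    rewrite eE in xj; have := join_above h3 h4 xj; have := join_below h3 h4 xj.
    by rewrite xE' -in_translate h; clia.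
  rewrite cardfsU1 ecE; suff -> : joint v \notin rim E by rewrite add1n ltnn.
  apply/negP => /rim_sub; case: h1 => _ h _ _ /h; rewrite !expr0 !mul1r up_coord; clia.
have ew0 : w ord0 i0 = w' ord0 i0.
  by apply/eqP; rewrite eq_le (half _ _ _ _ _ _ t1 b2 t1' b2') ?(half _ _ _ _ _ _ t1' b2' t1 b2).
have eD : D1 = D1'.
  apply/fsetP => x; apply/idP/idP => xD.
  - have xj : x \in join D1 w D2 by rewrite !inE xD orbT.
    by rewrite -(join_below t1' b2') -?ew0 -?e // (join_below t1 b2).
  - have xj : x \in join D1' w' D2' by rewrite !inE xD orbT.
    by rewrite -(join_below t1 b2) ?ew0 ?e // (join_below t1' b2').
split=> //; move/ew: (eD) => eww; subst w' D1'.
apply: (@translate_inj _ (joint w + stp up)); apply/fsetP => x; apply/idP/idP => xD.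
- have xj : x \in join D1 w D2 by rewrite inE xD orbT.
  by rewrite in_translate -(join_above t1' b2') -?e // (join_above t1 b2) // -in_translate.
- have xj : x \in join D1 w D2' by rewrite inE xD orbT.
  by rewrite in_translate -(join_above t1 b2) ?e // (join_above t1' b2') // -in_translate.
Qed.

End Concat.

(** * Walks and embedded trees *)

Section Walks.
Variables (R : realFieldType) (d : nat).
Notation V := 'rV[int]_d.
Notation dir := (dir d).
Local Notation N := ((2 * d)%:R : R).

Fixpoint walks k (phi : V -> R) : R :=
  if k is k'.+1 then \sum_(s : dir) walks k' (fun z => phi (stp s + z)) else phi 0.

Definition walk_count k (z : V) : R := walks k (fun v => (v == z)%:R).

Lemma eq_walks k phi psi : phi =1 psi -> walks k phi = walks k psi.
Proof.
elim: k phi psi => [|k IH] phi psi e /=; first exact: e.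
by apply: eq_bigr => s _; apply: IH => z; exact: e.
Qed.

Lemma walks_ge0 k phi : (forall z, 0 <= phi z) -> 0 <= walks k phi.
Proof.
elim: k phi => [|k IH] phi p /=; first exact: p.
by apply: sumr_ge0 => s _; apply: IH => z; exact: p.
Qed.

Lemma walksD k phi psi : walks k (fun z => phi z + psi z) = walks k phi + walks k psi.
Proof.
elim: k phi psi => [|k IH] phi psi //=.
by rewrite -big_split /=; apply: eq_bigr => s _; rewrite IH.
Qed.

Lemma walksZ k a phi : walks k (fun z => a * phi z) = a * walks k phi.
Proof.
elim: k phi => [|k IH] phi //=; rewrite mulr_sumr.
by apply: eq_bigr => s _; rewrite IH.
Qed.

Lemma walks_sum k (I : finType) (P : pred I) (phi : I -> V -> R) :
  walks k (fun z => \sum_(i | P i) phi i z) = \sum_(i | P i) walks k (phi i).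
Proof.
elim: k phi => [|k IH] phi //=.
rewrite exchange_big /=; apply: eq_bigr => s _; exact: IH.
Qed.

Lemma walks_opp k phi : walks k (fun z => phi (- z)) = walks k phi.
Proof.
elim: k phi => [|k IH] phi /=; first by rewrite oppr0.
rewrite [RHS](reindex_onto (@opd d) (@opd d)) /=; last by move=> *; rewrite opdK.
rewrite [RHS](eq_bigl xpredT) //=; last by move=> s; rewrite opdK eqxx.
apply: eq_bigr => s _; rewrite -[RHS]IH; apply: eq_walks => z.
by rewrite stp_opd opprD.
Qed.

(** Steps being symmetric, the second walk can be reversed and appended to the first. *)
Lemma walks_walks k j psi :
  walks k (fun u => walks j (fun v => psi (u - v))) = walks (k + j) psi.
Proof.
elim: k psi => [|k IH] psi /=.
  by rewrite add0n -[RHS]walks_opp; apply: eq_walks => z; rewrite sub0r.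
apply: eq_bigr => s _; rewrite -IH; apply: eq_walks => u; apply: eq_walks => v.
by rewrite addrA.
Qed.

Lemma walk_countS k z : walk_count k.+1 z = \sum_s walk_count k (z - stp s).
Proof.
apply: eq_bigr => s _; apply: eq_walks => v.
by rewrite [in RHS]eq_sym subr_eq eq_sym addrC.
Qed.

Lemma walk_count_ge0 k z : 0 <= walk_count k z.
Proof. by apply: walks_ge0 => v; rewrite ler0n. Qed.

Lemma sum_dir_const (c : R) : \sum_(s : dir) c = N * c.
Proof. by rewrite sumr_const card_dir mulr_natl. Qed.

Lemma walk_count_le k z : walk_count k z <= N ^+ k.
Proof.
elim: k z => [|k IH] z; first by rewrite /walk_count /= expr0; case: eqP.
by rewrite walk_countS exprS -sum_dir_const; apply: ler_sum.
Qed.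

Definition coord (s : dir) (z : V) : int := (-1) ^+ s.2 * z ord0 s.1.

Lemma coord_stp s a : coord s (stp a) = (a == s)%:R - (a == opd s)%:R.
Proof.
case: s a => i b [j c]; rewrite /coord stpE /opd /= !xpair_eqE eq_sym.
by case: eqP => _ //; case: b; case: c.
Qed.

Lemma coordB s z w : coord s (z - w) = coord s z - coord s w.
Proof. by rewrite /coord !mxE mulrBr. Qed.

(* A walk reaching a point with positive coordinate along s takes the step s. *)
Lemma walk_count_peel k z s : 0 < coord s z -> walk_count k.+1 z <= k.+1%:R * walk_count k (z - stp s).
Proof.
elim: k z => [|k IH] z zs; rewrite walk_countS (bigD1 s) //=.
  rewrite mul1r big1 ?addr0 // => a as_; rewrite /walk_count /= eq_sym subr_eq0.
  case: eqP => // e; move: zs; rewrite e coord_stp (negPf as_); by case: (a == _).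
rewrite -natr1 mulrDl mul1r addrC lerD2r.
apply: (@le_trans _ _ (\sum_(a | a != s) k.+1%:R * walk_count k (z - stp s - stp a))).
  apply: ler_sum => a as_; rewrite (addrAC z); apply: IH.
  by rewrite coordB coord_stp (negPf as_); case: (a == _); lia.
rewrite -mulr_sumr; apply: ler_wpM2l; first exact: ler0n.
by rewrite walk_countS [leRHS](bigD1 s) //= lerDr walk_count_ge0.
Qed.


(** A closed walk contains the opposite of its first step. Deleting both leaves a closed walk, and
    there are at most N (k + 1) ways to insert them again instead of N^2. No walk of one step is
    closed, which allows exponents up to (k + 1)/2. *)
Lemma walk_count_bound0 k p : (2 * p <= k.+1)%N -> walk_count k 0 * N ^+ p <= k%:R ^+ p * N ^+ k.
Proof.
move: p; elim/ltn_ind: k => k IH [|p] pk; first by rewrite !expr0 mulr1 mul1r walk_count_le.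
case: k IH pk => [|[|k]] IH pk; first by move: pk; lia.
  rewrite walk_countS big1 ?mul0r ?mulr_ge0 ?exprn_ge0 ?ler0n //.
  by move=> s _; rewrite /walk_count /= sub0r eq_sym oppr_eq0 (negPf (stp_neq0 s)).
have pk' : (2 * p <= k.+1)%N by lia.
have IHk := IH k (ltnW (ltnSn _)) p pk'.
have c2 : walk_count k.+2 0 <= N * (k.+1%:R * walk_count k 0).
  rewrite walk_countS -sum_dir_const; apply: ler_sum => s _.
  rewrite sub0r -stp_opd.
  have := @walk_count_peel k (stp (opd s)) (opd s); rewrite subrr; apply.
  by rewrite coord_stp eqxx; case: s => i [] /=; rewrite /opd /= xpair_eqE eqxx.
apply: (@le_trans _ _ (N * (k.+1%:R * walk_count k 0) * N ^+ p.+1)).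
  by apply: ler_wpM2r => //; exact: exprn_ge0.
have -> : N * (k.+1%:R * walk_count k 0) * N ^+ p.+1 = N ^+ 2 * (k.+1%:R * (walk_count k 0 * N ^+ p)).
  by rewrite !exprS; ring.
have -> : k.+2%:R ^+ p.+1 * N ^+ k.+2 = N ^+ 2 * (k.+2%:R * (k.+2%:R ^+ p * N ^+ k)) :> R.
  by rewrite !exprS; ring.
apply: ler_wpM2l; first exact: exprn_ge0.
apply: ler_pM => //; rewrite ?ler0n ?ler_nat ?mulr_ge0 ?walk_count_ge0 ?exprn_ge0 //.
apply: le_trans IHk _; apply: ler_wpM2r; first exact: exprn_ge0.
by apply: lerXn2r; rewrite ?nnegrE ?ler0n // ler_nat; lia.
Qed.

(** The forced step of [walk_count_peel] is worth one more factor (k + 1)/N. *)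
Lemma walk_count_boundS z s k p : 0 < coord s z -> walk_count k (z - stp s) * N ^+ p <= k%:R ^+ p * N ^+ k ->
  walk_count k.+1 z * N ^+ p.+1 <= k.+1%:R ^+ p.+1 * N ^+ k.+1.
Proof.
move=> zs h; apply: (@le_trans _ _ (k.+1%:R * walk_count k (z - stp s) * N ^+ p.+1)).
  by apply: ler_wpM2r; [exact: exprn_ge0|exact: walk_count_peel].
have -> : k.+1%:R * walk_count k (z - stp s) * N ^+ p.+1 = k.+1%:R * N * (walk_count k (z - stp s) * N ^+ p).
  by rewrite exprS; ring.
have -> : k.+1%:R ^+ p.+1 * N ^+ k.+1 = k.+1%:R * N * (k.+1%:R ^+ p * N ^+ k) :> R.
  by rewrite !exprS; ring.
apply: ler_wpM2l; first by rewrite mulr_ge0 ?ler0n.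
apply: le_trans h _; apply: ler_wpM2r; first exact: exprn_ge0.
by apply: lerXn2r; rewrite ?nnegrE ?ler0n // ler_nat; lia.
Qed.

Lemma walk_count_bound1 s k p : (2 * p <= k.+2)%N -> walk_count k (stp s) * N ^+ p <= k%:R ^+ p * N ^+ k.
Proof.
case: p => [|p] pk; first by rewrite !expr0 mulr1 mul1r walk_count_le.
case: k pk => [|k] pk.
  rewrite /walk_count /= eq_sym (negPf (stp_neq0 s)) mul0r.
  by rewrite mulr_ge0 ?exprn_ge0 ?ler0n.
apply: (@walk_count_boundS _ s); last by rewrite subrr; apply: walk_count_bound0; lia.
by rewrite coord_stp eqxx; case: s => i [] /=; rewrite /opd /= xpair_eqE eqxx.
Qed.

Lemma walk_count_bound2 s t k p : s != t -> (2 * p <= k.+3)%N ->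
  walk_count k (stp s - stp t) * N ^+ p <= k%:R ^+ p * N ^+ k.
Proof.
move=> st; case: p => [|p] pk; first by rewrite !expr0 mulr1 mul1r walk_count_le.
case: k pk => [|k] pk.
  rewrite /walk_count /= eq_sym subr_eq0 (inj_eq (@stp_inj d)) (negPf st) mul0r.
  by rewrite mulr_ge0 ?exprn_ge0 ?ler0n.
apply: (@walk_count_boundS _ s); last first.
  by rewrite addrAC subrr sub0r -stp_opd; apply: walk_count_bound1; lia.
rewrite coordB !coord_stp eqxx (eq_sym t) (negPf st) (_ : s == opd s = false); first by case: (t == _).
by case: s {st} => i [] /=; rewrite /opd /= xpair_eqE eqxx.
Qed.

(* Indicators of near collisions: of the vertex u of a branch rooted at the end of
   the step s with the root or its neighbours, and of vertices u, v of two branches. *)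
Definition psi1 s (u : V) : R := (u == - stp s)%:R + \sum_(a | a != s) (u == stp a - stp s)%:R.
Definition psi2 s t (w : V) : R :=
  (w == stp t - stp s)%:R + \sum_a (w == stp t - stp s - stp a)%:R.

Lemma psi1_ge0 s u : 0 <= psi1 s u.
Proof. by rewrite addr_ge0 ?ler0n ?sumr_ge0. Qed.
Lemma psi2_ge0 s t u : 0 <= psi2 s t u.
Proof. by rewrite addr_ge0 ?ler0n ?sumr_ge0. Qed.

Hypothesis d0 : (0 < d)%N.
Let N0 : 0 < N. Proof. by rewrite ltr0n muln_gt0. Qed.

(** The sum over neighbours in [psi1] and [psi2] costs a factor N, which turns one factor (k + 1)/N
    of the walk estimate into k + 1; the other summand is at most as large, whence the 2. *)
Definition near_bound k : R := k.+1%:R *+ 2 * (k.+1%:R / N) ^+ (k.-1)./2.+1.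

Let ratio c k p : c * N ^+ p <= k%:R ^+ p * N ^+ k -> c / N ^+ k <= (k%:R / N) ^+ p.
Proof.
move=> h; rewrite ler_pdivrMr ?exprn_gt0 // expr_div_n mulrAC ler_pdivlMr ?exprn_gt0 //.
Qed.

Let ratioS k p : (k%:R / N) ^+ p <= (k.+1%:R / N) ^+ p.
Proof.
apply: lerXn2r; rewrite ?nnegrE ?divr_ge0 ?ler0n //.
by rewrite ler_pM2r ?invr_gt0 // ler_nat.
Qed.

Lemma walks_psi2 s t k : s != t -> walks k (psi2 s t) / N ^+ k <= near_bound k.
Proof.
move=> st; have ts : t != s by rewrite eq_sym.
have -> : walks k (psi2 s t) = walk_count k (stp t - stp s) + walk_count k.+1 (stp t - stp s).
  by rewrite walksD walks_sum walk_countS.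
rewrite mulrDl /near_bound; set p := (k.-1)./2.+1; set y := k.+1%:R / N.
have y0 : 0 <= y by rewrite divr_ge0 ?ler0n.
have h1 : walk_count k (stp t - stp s) / N ^+ k <= y ^+ p.
  apply: le_trans (ratioS _ _); apply: ratio; apply: walk_count_bound2 => //; rewrite /p; lia.
have h2 : walk_count k.+1 (stp t - stp s) / N ^+ k <= k.+1%:R * y ^+ p.
  have : walk_count k.+1 (stp t - stp s) / N ^+ k.+1 <= y ^+ p.+1.
    by apply: ratio; apply: walk_count_bound2 => //; rewrite /p; lia.
  rewrite exprSr exprS invfM mulrA ler_pdivrMr // => /le_trans; apply.
  by rewrite mulrAC {1}/y divfK ?gt_eqF.
apply: le_trans (lerD h1 h2) _.
rewrite mulr2n mulrDl lerD2r ler_peMl ?exprn_ge0 // ler1n //.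
Qed.

Lemma walks_psi1 s k : walks k (psi1 s) / N ^+ k <= near_bound k.
Proof.
have -> : walks k (psi1 s) = walk_count k (- stp s) + \sum_(a | a != s) walk_count k (stp a - stp s).
  by rewrite walksD walks_sum.
rewrite mulrDl /near_bound; set p := (k.-1)./2.+1; set y := k.+1%:R / N.
have y0 : 0 <= y by rewrite divr_ge0 ?ler0n.
have h1 : walk_count k (- stp s) / N ^+ k <= y ^+ p.
  apply: le_trans (ratioS _ _); apply: ratio; rewrite -stp_opd; apply: walk_count_bound1; rewrite /p; lia.
have h2 : (\sum_(a | a != s) walk_count k (stp a - stp s)) / N ^+ k <= k.+1%:R * y ^+ p.
  case: k @p @y y0 {h1} => [|k] p y y0.
    rewrite big1; first by rewrite mul0r mulr_ge0 ?ler0n // exprn_ge0.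
    by move=> a as_; rewrite /walk_count /= eq_sym subr_eq0 (inj_eq (@stp_inj d)) (negPf as_).
  rewrite mulr_suml; apply: (@le_trans _ _ (\sum_(a : dir) (k.+1%:R / N) ^+ p.+1)).
    rewrite big_mkcond; apply: ler_sum => a _; case: ifP => as_; last first.
      by rewrite exprn_ge0 // divr_ge0 ?ler0n.
    by apply: ratio; apply: walk_count_bound2 => //; rewrite /p; lia.
  rewrite sum_dir_const exprS mulrA [N * _]mulrC divfK ?gt_eqF //.
  by apply: ler_pM (ratioS _ _); rewrite ?ler0n ?exprn_ge0 ?divr_ge0 ?ler0n ?ler_nat.
apply: le_trans (lerD h1 h2) _.
rewrite mulr2n mulrDl lerD2r ler_peMl ?exprn_ge0 // ler1n //.
Qed.

Let iN : 0 <= N^-1. Proof. by rewrite invr_ge0. Qed.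

(** Every two steps gain a factor M^2 (k + 1)/N <= 1/16, hence 1/4 per step. This absorbs (k + 1)^2
    <= 4 * 2^k and still leaves 1/2 per step, while one factor 1/N is kept outside. *)
Lemma near_bound_le (M : R) h k : 1 <= M -> (16 * h.+1)%:R * M ^+ 2 <= N -> (k <= h)%N ->
  M ^+ k * near_bound k <= 128 * M ^+ 2 / N * 2^-1 ^+ k.
Proof.
move=> M1 hN kh; rewrite /near_bound; set q := (k.-1)./2; set y := k.+1%:R / N.
have M0 : 0 <= M by apply: le_trans M1.
have y0 : 0 <= y by rewrite divr_ge0 ?ler0n.
have My : M ^+ 2 * y <= 16^-1.
  rewrite /y mulrA ler_pdivrMr // mulrC ler_pdivlMl // mulrA -natrM.
  by apply: le_trans hN; apply: ler_wpM2r; rewrite ?exprn_ge0 // ler_nat; lia.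
have Mk : M ^+ k <= M ^+ 2 * (M ^+ 2) ^+ q.
  by rewrite -exprM -exprD; apply: ler_weXn2l => //; rewrite /q; clear; lia.
have k2 : k.+1%:R ^+ 2 <= 4 * 2 ^+ k :> R.
  rewrite -!natrX -natrM ler_nat; elim: (k) => [|[|[|n]] IH] //.
  by rewrite [(2 ^ n.+3)%N]expnS; move: IH; move: (2 ^ n.+2)%N => e; rewrite -!mulnn; clear; lia.
have q16 : (M ^+ 2 * y) ^+ q <= 16 * (4^-1 ^+ k).
  apply: (@le_trans _ _ (16^-1 ^+ q)).
    by apply: lerXn2r; rewrite ?nnegrE ?mulr_ge0 ?exprn_ge0 ?invr_ge0.
  have -> : 16^-1 = 4^-1 ^+ 2 :> R by rewrite exprVn; congr (_^-1); ring.
  rewrite -exprM.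
  have -> : 4^-1 ^+ (2 * q) = 16 * 4^-1 ^+ (2 * q).+2 :> R by rewrite !exprS; field.
  apply: ler_wpM2l => //; apply: ler_wiXn2l; rewrite ?invr_ge0 ?invf_le1 ?ler1n //.
  by rewrite /q; clear; lia.
apply: (@le_trans _ _ (M ^+ 2 * (M ^+ 2) ^+ q * (k.+1%:R *+ 2 * y ^+ q.+1))).
  by apply: ler_wpM2r => //; rewrite mulr_ge0 ?mulrn_wge0 ?ler0n ?exprn_ge0.
have -> : M ^+ 2 * (M ^+ 2) ^+ q * (k.+1%:R *+ 2 * y ^+ q.+1) =
    2 * M ^+ 2 / N * (k.+1%:R ^+ 2 * (M ^+ 2 * y) ^+ q).
  rewrite [(M ^+ 2 * y) ^+ q]exprMn [y ^+ q.+1]exprS -mulr_natl {1}/y; set a := (M ^+ 2) ^+ q; set b := y ^+ q.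
  by field; rewrite pnatr_eq0 -lt0n.
have -> : 128 * M ^+ 2 / N * 2^-1 ^+ k = 2 * M ^+ 2 / N * (4 * 2 ^+ k * (16 * 4^-1 ^+ k)).
  have -> : 4^-1 = 2^-1 * 2^-1 :> R by field.
  rewrite exprMn; have : 2 ^+ k * 2^-1 ^+ k = 1 :> R by rewrite -exprMn mulfV ?expr1n ?pnatr_eq0.
  rewrite -![_ * M ^+ 2 / N]mulrA; move: (2 ^+ k) (2^-1 ^+ k) (M ^+ 2 / N) => a b e ab.
  have -> : 2 * e * (4 * a * (16 * (b * b))) = 128 * e * (a * b) * b by ring.
  by rewrite ab; ring.
apply: ler_wpM2l; first by rewrite !mulr_ge0 // exprn_ge0.
apply: ler_pM => //; first by rewrite exprn_ge0 ?ler0n.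
by rewrite exprn_ge0 // mulr_ge0 // exprn_ge0.
Qed.

Lemma sum_half h : \sum_(k < h) 2^-1 ^+ k <= 2 :> R.
Proof.
suff -> : \sum_(k < h) 2^-1 ^+ k = 2 - 2 * 2^-1 ^+ h :> R.
  by rewrite gerBl mulr_ge0 // exprn_ge0 // invr_ge0.
elim: h => [|h IH]; first by rewrite big_ord0 expr0; ring.
by rewrite big_ord_recr IH exprS /=; field.
Qed.

Lemma sum_psi1 (M : R) h s : 1 <= M -> (16 * h.*2.+1)%:R * M ^+ 2 <= N ->
  \sum_(k < h.+1) (M / N) ^+ k * walks k (psi1 s) <= 512 * M ^+ 2 / N.
Proof.
move=> M1 hN; have M0 : 0 <= M by apply: le_trans M1.
have c0 : 0 <= 128 * M ^+ 2 / N by rewrite !mulr_ge0 // exprn_ge0.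
apply: (@le_trans _ _ (128 * M ^+ 2 / N * \sum_(k < h.+1) 2^-1 ^+ k)).
  rewrite mulr_sumr; apply: ler_sum => k _.
  have kh : (k <= h.*2)%N by have := ltn_ord k; lia.
  apply: le_trans (near_bound_le M1 hN kh).
  rewrite expr_div_n -mulrA; apply: ler_wpM2l; first exact: exprn_ge0.
  by rewrite mulrC; exact: walks_psi1.
apply: le_trans (ler_wpM2l c0 (sum_half _)) _.
rewrite -!mulrA; have : 0 <= M ^+ 2 / N by rewrite mulr_ge0 ?exprn_ge0 ?invr_ge0.
by move: (M ^+ 2 / N) => e; lra.
Qed.

(** 512 = 128 * 2 * 2, with one factor 2 for each geometric series. The two walks have up to 2h
    steps together, hence [h.*2] in the condition on N. *)
Lemma sum_psi2 (M : R) h s t : s != t -> 1 <= M -> (16 * h.*2.+1)%:R * M ^+ 2 <= N ->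
  \sum_(k < h.+1) \sum_(j < h.+1) (M / N) ^+ (k + j) * walks (k + j) (psi2 s t)
    <= 512 * M ^+ 2 / N.
Proof.
move=> st M1 hN; have M0 : 0 <= M by apply: le_trans M1.
have c0 : 0 <= 128 * M ^+ 2 / N by rewrite !mulr_ge0 // exprn_ge0.
apply: (@le_trans _ _ (128 * M ^+ 2 / N *
    ((\sum_(k < h.+1) 2^-1 ^+ k) * (\sum_(k < h.+1) 2^-1 ^+ k)))).
  rewrite mulr_suml mulr_sumr; apply: ler_sum => k _.
  rewrite mulr_sumr mulr_sumr; apply: ler_sum => j _.
  have kh : (k + j <= h.*2)%N by have := ltn_ord k; have := ltn_ord j; lia.
  rewrite -exprD; apply: le_trans (near_bound_le M1 hN kh).
  rewrite expr_div_n -mulrA; apply: ler_wpM2l; first exact: exprn_ge0.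
  by rewrite mulrC; exact: walks_psi2.
have s0 : 0 <= \sum_(k < h.+1) 2^-1 ^+ k :> R.
  by apply: sumr_ge0 => k _; rewrite exprn_ge0 // invr_ge0.
have s4 := ler_pM s0 s0 (sum_half h.+1) (sum_half h.+1).
apply: le_trans (ler_wpM2l c0 s4) _.
rewrite -!mulrA; have : 0 <= M ^+ 2 / N by rewrite mulr_ge0 ?exprn_ge0 ?invr_ge0.
by move: (M ^+ 2 / N) => e; lra.
Qed.

End Walks.

(** * Sums of product weights over finite functions *)

Lemma sum_ffun_prod (R : comNzRingType) (I J : finType) (g : I -> J -> R) :
  \sum_(f : {ffun I -> J}) \prod_i g i (f i) = \prod_i \sum_j g i j.
Proof. by rewrite bigA_distr_bigA. Qed.

Lemma sum_ffun_prod1 (R : comNzRingType) (I J : finType) (g : I -> J -> R) i0 (G : J -> R) :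
  \sum_(f : {ffun I -> J}) (\prod_i g i (f i)) * G (f i0) =
  (\sum_j g i0 j * G j) * \prod_(i | i != i0) \sum_j g i j.
Proof.
pose g' i j := g i j * (if i == i0 then G j else 1).
rewrite (eq_bigr (fun f : {ffun I -> J} => \prod_i g' i (f i))).
  rewrite sum_ffun_prod (bigD1 i0) //=; congr (_ * _).
    by apply: eq_bigr => j _; rewrite /g' eqxx.
  apply: eq_bigr => i /negPf ii; apply: eq_bigr => j _.
  by rewrite /g' ii mulr1.
move=> f _; rewrite big_split /=; congr (_ * _).
by rewrite (bigD1 i0) //= eqxx big1 ?mulr1 // => i /negPf ->.
Qed.

Lemma sum_ffun_prod2 (R : comNzRingType) (I J : finType) (g : I -> J -> R) i0 i1
    (G : J -> J -> R) : i0 != i1 ->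
  \sum_(f : {ffun I -> J}) (\prod_i g i (f i)) * G (f i0) (f i1) =
  (\sum_j \sum_k g i0 j * g i1 k * G j k) * \prod_(i | (i != i0) && (i != i1)) \sum_j g i j.
Proof.
move=> i01.
(* Expanding [G] in indicators makes each summand a product over all indices. *)
have e (f : {ffun I -> J}) : G (f i0) (f i1) = \sum_j \sum_k (f i0 == j)%:R * (f i1 == k)%:R * G j k.
  rewrite (bigD1 (f i0)) //= [X in _ + X]big1 ?addr0; last first.
    move=> j /negPf h; apply: big1 => k _; by rewrite eq_sym h !mul0r.
  rewrite (bigD1 (f i1)) //= !eqxx !mul1r big1 ?addr0 // => k /negPf h.
  by rewrite [_ == k]eq_sym h mulr0 mul0r.
rewrite (eq_bigr _ (fun (f : {ffun I -> J}) _ => congr1 (fun z => (\prod_i g i (f i)) * z) (e f))) /=.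
under eq_bigr => f _ do rewrite mulr_sumr.
rewrite exchange_big mulr_suml; apply: eq_bigr => j _.
under eq_bigr => f _ do rewrite mulr_sumr.
rewrite exchange_big mulr_suml; apply: eq_bigr => k _.
pose g' i l := g i l * (if i == i0 then (l == j)%:R else if i == i1 then (l == k)%:R else 1).
under eq_bigr => f _ do rewrite mulrA.
rewrite -mulr_suml [RHS]mulrAC; congr (_ * _).
rewrite (eq_bigr (fun f : {ffun I -> J} => \prod_i g' i (f i))).
  rewrite sum_ffun_prod (bigD1 i0) //= (bigD1 i1) /=; last by rewrite eq_sym.
  rewrite mulrA; congr (_ * _).
    congr (_ * _).
      rewrite (bigD1 j) //= /g' !eqxx mulr1 big1 ?addr0 // => l /negPf ->; exact: mulr0.
    rewrite (bigD1 k) //= /g' !eqxx [i1 == i0]eq_sym (negPf i01) mulr1 big1 ?addr0 //.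
    by move=> l /negPf ->; exact: mulr0.
  apply: eq_bigr => i /andP[/negPf h1 /negPf h2]; apply: eq_bigr => l _.
  by rewrite /g' h1 h2 mulr1.
move=> f _; rewrite big_split /=; congr (_ * _).
rewrite (bigD1 i0) //= (bigD1 i1) /=; last by rewrite eq_sym.
rewrite !eqxx [i1 == i0]eq_sym (negPf i01) mulrA big1 ?mulr1 //.
by move=> i /andP[/negPf -> /negPf ->].
Qed.

(** * Weighted codes of trees and their clashes *)

Section Codes.
Variables (R : realFieldType) (d : nat).
Notation V := 'rV[int]_d.
Notation dir := (dir d).
Local Notation N := ((2 * d)%:R : R).

(* Rooted trees of height at most h, as subtrees of the rooted 2d-ary tree. *)
Fixpoint tree_code (h : nat) : finType :=
  if h is h'.+1 then {ffun dir -> option (tree_code h')} : finType else unit.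

Fixpoint embed h : tree_code h -> {fset V} :=
  if h is h'.+1 then fun f : {ffun dir -> option (tree_code h')} =>
    (0 |` \bigcup_(s <- enum {: dir}) if f s is Some c then translate (stp s) (embed c) else fset0)%fset
  else fun _ => [fset 0]%fset.

(** Adjacency is excluded together with coincidence, because the embedded tree has to be an induced
    subgraph. The root of a branch is always adjacent to 0, whence [u != 0] in [clash1]. *)
Definition near (z : V) := (z == 0) || [exists a, z == stp a].
Definition clash1 s (D : {fset V}) := has (fun u => (u != 0) && near (stp s + u)) D.
Definition clash2 s D t D' :=
  has (fun u => has (fun v => near (stp s + u - (stp t + v))) (D' : {fset V})) (D : {fset V}).

Definition supp (T : Type) (f : dir -> option T) : {set dir} := [set s | isSome (f s)]%SET.

Variable off : nat -> nat -> bool.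

Definition no_clash (T : finType) (D : T -> {fset V}) (f : {ffun dir -> option T}) :=
  [forall s, if f s is Some c then ~~ clash1 s (D c) else true] &&
  [forall s, forall t, (s != t) ==>
    if f s is Some c then if f t is Some c' then ~~ clash2 s (D c) t (D c') else true else true].

(** [off h k] is the branching rule: whether a vertex may have k branches when these are codes of
    height h. Its dependence on h allows the rule to change between the two phases of growth. *)
Fixpoint valid h : tree_code h -> bool :=
  if h is h'.+1 then fun f : {ffun dir -> option (tree_code h')} =>
    [&& off h' #|supp f|, [forall s, if f s is Some c then valid c else true] &
        no_clash (@embed h') f]
  else fun _ => true.

Variable x : R.
Hypothesis x0 : 0 <= x.

Fixpoint tree_code_weight h : tree_code h -> R :=
  if h is h'.+1 then fun f : {ffun dir -> option (tree_code h')} =>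
    x * \prod_s (if f s is Some c then tree_code_weight c else 1)
  else fun _ => x.

Definition valid_weight h (c : tree_code h) : R := if valid c then tree_code_weight c else 0.
Definition tree_weight h : R := \sum_(c : tree_code h) valid_weight c.
Local Notation F := tree_weight.

Lemma tree_code_weight_ge0 h (c : tree_code h) : 0 <= tree_code_weight c.
Proof.
elim: h c => [|h IH] c //=; rewrite mulr_ge0 // prodr_ge0 // => s _.
by case: (c s) => [c'|//]; exact: IH.
Qed.

Lemma valid_weight_ge0 h (c : tree_code h) : 0 <= valid_weight c.
Proof. by rewrite /valid_weight; case: ifP => // _; exact: tree_code_weight_ge0. Qed.

Lemma tree_weight_ge0 h : 0 <= F h.
Proof. by apply: sumr_ge0 => c _; exact: valid_weight_ge0. Qed.

(** The sum of phi over the vertices at depth k, counted in the tree: positions that coincide count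
    repeatedly, so the sum also makes sense without validity. *)
Fixpoint level_sum h (k : nat) : tree_code h -> (V -> R) -> R :=
  match h, k with
  | _, 0 => fun _ phi => phi 0
  | 0, _.+1 => fun _ _ => 0
  | h'.+1, k'.+1 => fun (f : {ffun dir -> option (tree_code h')}) phi =>
      \sum_s if f s is Some c then @level_sum h' k' c (fun z => phi (stp s + z)) else 0
  end.

Lemma level_sum0 h (c : tree_code h) phi : level_sum 0 c phi = phi 0.
Proof. by case: h c. Qed.

Lemma level_sum_ge0 h k (c : tree_code h) phi : (forall z, 0 <= phi z) -> 0 <= level_sum k c phi.
Proof.
elim: h k c phi => [|h IH] [|k] c phi p //=.
by apply: sumr_ge0 => s _; case: (c s) => // c'; apply: IH => z; exact: p.
Qed.

Lemma level_sum_mono h k (c : tree_code h) phi psi : (forall z, phi z <= psi z) ->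
  level_sum k c phi <= level_sum k c psi.
Proof.
elim: h k c phi psi => [|h IH] [|k] c phi psi p //=.
by apply: ler_sum => s _; case: (c s) => // c'; apply: IH => z; exact: p.
Qed.

Lemma level_sumZ h k (c : tree_code h) a phi : level_sum k c (fun z => a * phi z) = a * level_sum k c phi.
Proof.
elim: h k c phi => [|h IH] [|k] c phi //=; first by rewrite mulr0.
rewrite mulr_sumr; apply: eq_bigr => s _; case: (c s) => [c'|]; last by rewrite mulr0.
exact: (IH k c' (fun z => phi (stp s + z))).
Qed.

Lemma level_sum_sum h k (c : tree_code h) (I : finType) (phi : I -> V -> R) :
  level_sum k c (fun z => \sum_i phi i z) = \sum_i level_sum k c (phi i).
Proof.
elim: h k c phi => [|h IH] [|k] c phi //=; first by rewrite big1.
rewrite exchange_big /=; apply: eq_bigr => s _; case: (c s) => [c'|]; last by rewrite big1.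
exact: (IH k c' (fun i z => phi i (stp s + z))).
Qed.

Lemma in_embed h (f : tree_code h.+1) z : (z \in embed f) =
  (z == 0) || [exists s, if (f : {ffun dir -> option (tree_code h)}) s is Some c
     then z - stp s \in embed c else false].
Proof.
rewrite /= !inE; congr orb; apply/bigfcupP/existsP => [[s _]|[s zs]].
  by case e: (f s) => [c|]; rewrite ?inE // in_translate => h1; exists s; rewrite e.
exists s; first by rewrite mem_enum.
by case: (f s) zs => // c; rewrite in_translate.
Qed.

Lemma embed_root h (c : tree_code h) : 0 \in embed c.
Proof. by case: h c => [|h] c; [rewrite inE|rewrite in_embed eqxx]. Qed.

Lemma embed_level_sum h (c : tree_code h) z phi : (forall z, 0 <= phi z) -> z \in embed c ->
  phi z <= \sum_(k < h.+1) level_sum k c phi.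
Proof.
elim: h c z phi => [|h IH] c z phi p.
  by rewrite inE => /eqP ->; rewrite big_ord_recl big_ord0 addr0.
rewrite in_embed big_ord_recl level_sum0 => /orP[/eqP->|/existsP[s]].
  by rewrite lerDl; apply: sumr_ge0 => k _; exact: level_sum_ge0.
case e: ((c : {ffun _ -> _}) s) => [c'|] // zc.
have := IH c' (z - stp s) (fun z => phi (stp s + z)) (fun z => p _) zc.
rewrite addrC subrK => /le_trans; apply; apply: ler_wpDl => //.
apply: ler_sum => k _ /=.
rewrite (bigD1 s) //= e lerDl; apply: sumr_ge0 => t _.
by case: (c t) => // c''; apply: level_sum_ge0 => ?; exact: p.
Qed.

Lemma clash1_level_sum h (c : tree_code h) s :
  (clash1 s (embed c))%:R <= \sum_(k < h.+1) level_sum k c (@psi1 R d s).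
Proof.
case: (boolP (clash1 s (embed c))) => [/hasP[u uc /andP[u0 nu]]|_]; last first.
  by apply: sumr_ge0 => k _; apply: level_sum_ge0 => z; exact: psi1_ge0.
apply: le_trans (embed_level_sum (@psi1_ge0 R d s) uc); rewrite /psi1.
case/orP: nu => [/eqP e|/existsP[a /eqP e]].
  have -> : u = - stp s by rewrite -[RHS]add0r -e [stp s + u]addrC addrK.
  by rewrite eqxx lerDl sumr_ge0.
have -> : u = stp a - stp s by rewrite -e addrC addKr.
have as_ : a != s by apply: contraNneq u0 => as_; rewrite -[u](addKr (stp s)) e as_ addNr.
by rewrite addrC (bigD1 a) //= eqxx -addrA lerDl addr_ge0 ?sumr_ge0.
Qed.

Lemma clash2_level_sum h (c c' : tree_code h) s t :
  (clash2 s (embed c) t (embed c'))%:R <=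
  \sum_(k < h.+1) \sum_(j < h.+1) level_sum k c (fun u => level_sum j c' (fun v => @psi2 R d s t (u - v))).
Proof.
have p2 u j : 0 <= level_sum j c' (fun v => @psi2 R d s t (u - v)).
  by apply: level_sum_ge0 => z; exact: psi2_ge0.
case: (boolP (clash2 _ _ _ _)) => [/hasP[u uc /hasP[v vc nu]]|_]; last first.
  by apply: sumr_ge0 => k _; apply: sumr_ge0 => j _; exact: level_sum_ge0.
under eq_bigr => k _ do rewrite -level_sum_sum.
pose phi u := \sum_(j < h.+1) level_sum j c' (fun v => @psi2 R d s t (u - v)).
have phi0 z : 0 <= phi z by apply: sumr_ge0 => j _; exact: p2.
apply: le_trans (embed_level_sum phi0 uc).
have := embed_level_sum (phi := fun v => @psi2 R d s t (u - v)) (fun z => psi2_ge0 _ _ _ _) vc.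
apply: le_trans.
have uv : u - v = stp s + u - (stp t + v) + (stp t - stp s).
  by apply/rowP => i; rewrite !mxE; ring.
rewrite /psi2; case/orP: nu => [/eqP e|/existsP[a /eqP e]]; rewrite e in uv.
  by rewrite uv add0r eqxx lerDl sumr_ge0.
rewrite addrC (bigD1 (opd a)) //= uv stp_opd opprK [stp a + _]addrC eqxx.
by rewrite -addrA lerDl addr_ge0 ?sumr_ge0.
Qed.

(** For a prescribed set [A] of occupied branches the weight becomes a product over all directions,
    which vanishes unless [A] is the support. *)
Definition marked_weight h (A : {set dir}) s (o : option (tree_code h)) : R :=
  if s \in A then (if o is Some c then valid_weight c else 0) else (o == None)%:R.

Lemma marked_weight_ge0 h A s (o : option (tree_code h)) : 0 <= marked_weight A s o.
Proof. by rewrite /marked_weight; case: ifP => // _; case: o => // c; exact: valid_weight_ge0. Qed.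

Lemma sum_option (T : finType) (g : option T -> R) :
  \sum_o g o = g None + \sum_(c : T) g (Some c).
Proof.
rewrite (bigD1 None) //=; congr (_ + _).
rewrite (reindex_omap Some id) /=; first by apply: eq_bigl => c; rewrite eqxx.
by case.
Qed.

Lemma sum_marked_weight h A s : \sum_(o : option (tree_code h)) marked_weight A s o = if s \in A then F h else 1.
Proof.
rewrite sum_option /marked_weight; case: ifP => _; first by rewrite add0r.
by rewrite eqxx big1 ?addr0.
Qed.

Lemma prod_marked_weight h (f : {ffun dir -> option (tree_code h)}) A :
  \prod_s marked_weight A s (f s) =
  (A == supp f)%:R * \prod_s (if f s is Some c then valid_weight c else 1).
Proof.
case: eqP => [->|ne].
  by rewrite mul1r; apply: eq_bigr => s _; rewrite /marked_weight inE; case: (f s).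
have [s] : exists s, (s \in A) != isSome (f s).
  apply/existsP; apply: contra_notT ne => /existsPn h1.
  by apply/setP => s; rewrite inE; apply/eqP; have := h1 s; rewrite negbK.
rewrite mul0r (bigD1 s) //= /marked_weight; case: (s \in A); case: (f s) => //= *; exact: mul0r.
Qed.

(** Only the term of the support of [f] survives in the sum over [A]. The sum is introduced so that
    the summation over [f] can be carried out at fixed [A]. *)
Lemma valid_weightE h (f : tree_code h.+1) : valid_weight f =
  x * \sum_(A : {set dir} | off h #|A|)
    (no_clash (@embed h) (f : {ffun dir -> option (tree_code h)}))%:R *
    \prod_s marked_weight A s ((f : {ffun dir -> option (tree_code h)}) s).
Proof.
rewrite /valid_weight /=; have [fs|nfs] := boolP (off h #|supp f|) => /=; last first.
  rewrite big1 ?mulr0 // => A oA; rewrite prod_marked_weight; case: eqP => [e|]; last by rewrite mul0r mulr0.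
  by rewrite e (negPf nfs) in oA.
rewrite (bigD1 (supp f)) //= [X in _ + X]big1 ?addr0; last first.
  by move=> A /andP[_ /negPf ne]; rewrite prod_marked_weight ne mul0r mulr0.
rewrite prod_marked_weight eqxx mul1r.
case nc: (no_clash _ _); rewrite ?andbF ?mul0r ?mulr0 // andbT mul1r.
case: ifP => [/forallP v|/negbT/forallPn[s]].
  by congr (_ * _); apply: eq_bigr => s _; have := v s; case: (f s) => // c; rewrite /valid_weight => ->.
by rewrite (bigD1 s) //= /valid_weight; case: (f s) => // c /negPf ->; rewrite mul0r mulr0.
Qed.

Lemma prod_if_card (A : {set dir}) (P : pred dir) (a : R) : {subset A <= P} ->
  \prod_(s | P s) (if s \in A then a else 1) = a ^+ #|A|.
Proof.
move=> AP; rewrite -big_mkcondr /= (eq_bigl (mem A)) ?prodr_const //.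
by move=> s /=; rewrite andb_idl //; exact: AP.
Qed.

Lemma sum_prod_marked_weight h A : \sum_(f : {ffun dir -> option (tree_code h)}) \prod_s marked_weight A s (f s) = F h ^+ #|A|.
Proof.
rewrite sum_ffun_prod (eq_bigr (fun s => if s \in A then F h else 1)); last first.
  by move=> s _; exact: sum_marked_weight.
by rewrite (prod_if_card (P := predT)).
Qed.

Lemma sum_prod_marked_weight1 h A s (G : option (tree_code h) -> R) : G None = 0 ->
  \sum_(f : {ffun dir -> option (tree_code h)}) (\prod_s marked_weight A s (f s)) * G (f s) =
  if s \in A then (\sum_(c : tree_code h) valid_weight c * G (Some c)) * F h ^+ #|A|.-1 else 0.
Proof.
move=> G0; rewrite sum_ffun_prod1 sum_option G0 mulr0 add0r; case: ifP => sA; last first.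
  by rewrite big1 ?mul0r // => c _; rewrite /marked_weight sA /= mul0r.
congr (_ * _); first by apply: eq_bigr => c _; rewrite /marked_weight sA.
rewrite (eq_bigr (fun t => if t \in A :\ s then F h else 1)); last first.
  by move=> t ts; rewrite sum_marked_weight !inE ts.
rewrite (prod_if_card (P := fun t => t != s)); last by move=> t; rewrite !inE => /andP[].
by congr (_ ^+ _); rewrite (cardsD1 s A) sA.
Qed.

Lemma sum_prod_marked_weight2 h A s t (G : option (tree_code h) -> option (tree_code h) -> R) : s != t ->
  (forall o, G None o = 0) -> (forall o, G o None = 0) ->
  \sum_(f : {ffun dir -> option (tree_code h)}) (\prod_s marked_weight A s (f s)) * G (f s) (f t) =
  if (s \in A) && (t \in A) then
    (\sum_(c : tree_code h) \sum_(c' : tree_code h) valid_weight c * valid_weight c' * G (Some c) (Some c')) * F h ^+ #|A|.-2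
  else 0.
Proof.
move=> st G0 G0'; rewrite sum_ffun_prod2 // sum_option big1 ?add0r; last first.
  by move=> o _; rewrite G0 mulr0.
have e (c : tree_code h) : \sum_k marked_weight A s (Some c) * marked_weight A t k * G (Some c) k =
    \sum_(c' : tree_code h) marked_weight A s (Some c) * marked_weight A t (Some c') * G (Some c) (Some c').
  by rewrite sum_option G0' mulr0 add0r.
rewrite (eq_bigr _ (fun (c : tree_code h) _ => e c)) {e}.
case: ifP => [/andP[sA tA]|/negbT]; last first.
  rewrite negb_and => h1; rewrite big1 ?mul0r // => c _; rewrite big1 // => c' _.
  by case/orP: h1 => /negPf e; rewrite /marked_weight e /= ?mul0r ?mulr0 ?mul0r.
congr (_ * _).
  by apply: eq_bigr => c _; apply: eq_bigr => c' _; rewrite /marked_weight sA tA.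
rewrite (eq_bigr (fun r => if r \in A :\ s :\ t then F h else 1)); last first.
  by move=> r /andP[rs rt]; rewrite sum_marked_weight !inE rs rt.
rewrite (prod_if_card (P := fun r => (r != s) && (r != t))); last first.
  by move=> r; rewrite !inE => /and3P[h1 h2 _]; rewrite unfold_in h1 h2.
congr (_ ^+ _); rewrite (cardsD1 s A) sA (cardsD1 t (A :\ s)) !inE tA eq_sym st /=.
by [].
Qed.

End Codes.

(** * The recursion for the total weight of trees *)

Section Recursion.
Variables (R : realFieldType) (d : nat).
Notation V := 'rV[int]_d.
Notation dir := (dir d).
Local Notation N := ((2 * d)%:R : R).
Variable off : nat -> nat -> bool.
Variable x : R.
Hypothesis x0 : 0 <= x.
Local Notation tree_code := (tree_code d).
Local Notation F := (@tree_weight R d off x).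
Local Notation valid_weight := (@valid_weight R d off x _).
Local Notation marked_weight := (@marked_weight R d off x _).

Lemma valid_weight_le h (f : tree_code h.+1) : valid_weight f <=
  x * \sum_(A : {set dir} | off h #|A|) \prod_s marked_weight A s ((f : {ffun dir -> option (tree_code h)}) s).
Proof.
rewrite valid_weightE; apply: ler_wpM2l => //; apply: ler_sum => A _.
rewrite -[leRHS]mul1r; apply: ler_wpM2r; first by apply: prodr_ge0 => s _; exact: marked_weight_ge0.
by case: no_clash.
Qed.

Lemma level_sum_bound (mu : R) H : 0 <= mu ->
  (forall h s, (h < H)%N ->
    x * F h * \sum_(A : {set dir} | off h #|A| && (s \in A)) F h ^+ #|A|.-1 <= mu * F h.+1) ->
  forall h, (h <= H)%N -> forall k phi, (forall z, 0 <= phi z) ->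
  \sum_(c : tree_code h) valid_weight c * level_sum k c phi <= F h * mu ^+ k * walks k phi.
Proof.
move=> mu0 step; elim=> [|h IH] hH k phi p.
  case: k => [|k] /=; first by rewrite -mulr_suml mulr1.
  rewrite big1; last by move=> c _; rewrite mulr0.
  by rewrite !mulr_ge0 ?tree_weight_ge0 ?exprn_ge0 ?sumr_ge0 // => s _; apply: walks_ge0 => z; exact: p.
case: k => [|k]; first by rewrite /= -mulr_suml mulr1.
pose G s (o : option (tree_code h)) := if o is Some c then level_sum k c (fun z => phi (stp s + z)) else 0 : R.
have G0 s o : 0 <= G s o by case: o => //= c; apply: level_sum_ge0 => z; exact: p.
apply: (@le_trans _ _ (x * \sum_(A : {set dir} | off h #|A|) \sum_s
    \sum_(f : {ffun dir -> option (tree_code h)}) (\prod_t marked_weight A t (f t)) * G s (f s))).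
  under [X in _ <= x * X]eq_bigr => A _ do rewrite exchange_big.
  rewrite exchange_big mulr_sumr; apply: ler_sum => f _.
  apply: le_trans (ler_wpM2r _ (valid_weight_le f)) _; first exact: level_sum_ge0.
  rewrite -mulrA mulr_suml le_eqVlt; apply/orP; left; apply/eqP; congr (_ * _).
  by apply: eq_bigr => A _ /=; rewrite mulr_sumr.
have inner A s : \sum_(f : {ffun dir -> option (tree_code h)}) (\prod_t marked_weight A t (f t)) * G s (f s) <=
    (if s \in A then F h ^+ #|A|.-1 else 0) * (F h * mu ^+ k * walks k (fun z => phi (stp s + z))).
  rewrite sum_prod_marked_weight1 //; case: ifP => _; last by rewrite mul0r.
  rewrite mulrC; apply: ler_wpM2l; first by rewrite exprn_ge0 ?tree_weight_ge0.
  by apply: IH => [|z]; [exact: ltnW|exact: p].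
apply: (@le_trans _ _ (x * \sum_(A : {set dir} | off h #|A|) \sum_s
   (if s \in A then F h ^+ #|A|.-1 else 0) * (F h * mu ^+ k * walks k (fun z => phi (stp s + z))))).
  by apply: ler_wpM2l => //; apply: ler_sum => A _; apply: ler_sum => s _; exact: inner.
rewrite exchange_big /= mulr_sumr mulr_sumr; apply: ler_sum => s _.
rewrite -mulr_suml -big_mkcondr /= !mulrA.
apply: ler_wpM2r; first by apply: walks_ge0 => z; exact: p.
rewrite exprS mulrA; apply: ler_wpM2r; first exact: exprn_ge0.
by rewrite mulrAC [F h.+1 * mu]mulrC; exact: step.
Qed.

Lemma no_clash_ge h (f : {ffun dir -> option (tree_code h)}) :
  1 - \sum_s (if f s is Some c then (clash1 s (embed c))%:R else 0) -
    \sum_s \sum_(t | t != s) (if f s is Some c then if f t is Some c' then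
       (clash2 s (embed c) t (embed c'))%:R else 0 else 0)
  <= (no_clash (@embed d h) f)%:R :> R.
Proof.
set S1 := \sum_s _; set S2 := \sum_s _.
have p1 s : 0 <= (if f s is Some c then (clash1 s (embed c))%:R else 0) :> R by case: (f s).
have p2 s t : 0 <= (if f s is Some c then if f t is Some c' then
       (clash2 s (embed c) t (embed c'))%:R else 0 else 0) :> R.
  by case: (f s) => // c; case: (f t).
have S10 : 0 <= S1 by apply: sumr_ge0.
have S20 : 0 <= S2 by apply: sumr_ge0 => s _; apply: sumr_ge0.
case: (boolP (no_clash _ _)) => [_|]; first by rewrite /=; lra.
rewrite negb_and => /orP[/forallPn[s]|/forallPn[s /forallPn[t]]].
  case e: (f s) => [c|//] /negPn cl; suff : 1 <= S1 by rewrite /=; lra.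
  rewrite /S1 (bigD1 s) //= e cl lerDl; exact: sumr_ge0.
rewrite negb_imply => /andP[st].
case e: (f s) => [c|//]; case e': (f t) => [c'|//] /negPn cl.
suff : 1 <= S2 by rewrite /=; lra.
rewrite /S2 (bigD1 s) //= (bigD1 t) /=; last by rewrite eq_sym.
rewrite e e' cl -addrA lerDl addr_ge0 //; apply: sumr_ge0 => i _; first by case: (f i).
by apply: sumr_ge0 => j _; exact: p2.
Qed.

(** Union bound: single branches and ordered pairs of branches cost |A| e + |A| (|A| - 1) e = |A|^2
    e. *)
Lemma tree_weight_lower h (e : R) :
  (forall s, \sum_(c : tree_code h) valid_weight c * (clash1 s (embed c))%:R <= e * F h) ->
  (forall s t, s != t -> \sum_(c : tree_code h) \sum_(c' : tree_code h)
     valid_weight c * valid_weight c' * (clash2 s (embed c) t (embed c'))%:R <= e * F h ^+ 2) ->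
  x * \sum_(A : {set dir} | off h #|A|) F h ^+ #|A| * (1 - #|A|%:R ^+ 2 * e) <= F h.+1.
Proof.
move=> c1 c2.
pose g1 s (o : option (tree_code h)) := if o is Some c then (clash1 s (embed c))%:R else 0 : R.
pose g2 s t (o o' : option (tree_code h)) := if o is Some c then if o' is Some c' then
   (clash2 s (embed c) t (embed c'))%:R else 0 else 0 : R.
rewrite {2}/tree_weight (eq_bigr _ (fun (f : tree_code h.+1) _ => valid_weightE off x f)) -mulr_sumr.
apply: ler_wpM2l => //; rewrite exchange_big /=; apply: ler_sum => A _.
apply: (@le_trans _ _ (\sum_(f : {ffun dir -> option (tree_code h)})
   (\prod_s marked_weight A s (f s) - \sum_s (\prod_s marked_weight A s (f s)) * g1 s (f s)
    - \sum_s \sum_(t | t != s) (\prod_s marked_weight A s (f s)) * g2 s t (f s) (f t)))); last first.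
  apply: ler_sum => f _; set P := \prod_s _.
  have P0 : 0 <= P by apply: prodr_ge0 => s _; exact: marked_weight_ge0.
  rewrite mulrC; apply: le_trans (ler_wpM2l P0 (no_clash_ge f)).
  rewrite !mulrBr mulr1 !mulr_sumr; apply: lerB => //.
  by apply: ler_sum => s _; rewrite mulr_sumr.
rewrite !sumrB sum_prod_marked_weight exchange_big [X in _ <= _ - X]exchange_big /=.
have F0 : 0 <= F h by exact: tree_weight_ge0.
have b1 : \sum_s \sum_(f : {ffun dir -> option (tree_code h)}) (\prod_s marked_weight A s (f s)) * g1 s (f s)
    <= #|A|%:R * (e * F h ^+ #|A|).
  apply: (@le_trans _ _ (\sum_(s in A) e * F h ^+ #|A|)); last by rewrite sumr_const mulr_natl.
  rewrite [leRHS]big_mkcond; apply: ler_sum => s _; rewrite sum_prod_marked_weight1 //.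
  case: ifP => // sA; have -> : F h ^+ #|A| = F h * F h ^+ #|A|.-1.
    by rewrite -exprS prednK // (cardsD1 s A) sA.
  by rewrite mulrA; apply: ler_wpM2r; [exact: exprn_ge0|exact: c1].
have b2 : \sum_s \sum_(f : {ffun dir -> option (tree_code h)})
     \sum_(t | t != s) (\prod_s marked_weight A s (f s)) * g2 s t (f s) (f t)
    <= #|A|%:R * (#|A|.-1%:R * (e * F h ^+ #|A|)).
  apply: (@le_trans _ _ (\sum_(s in A) #|A|.-1%:R * (e * F h ^+ #|A|))); last by rewrite sumr_const -[leLHS]mulr_natl.
  rewrite [leRHS]big_mkcond; apply: ler_sum => s _; rewrite exchange_big /=.
  case: ifP => sA; last first.
    rewrite big1 // => t ts; rewrite sum_prod_marked_weight2 ?sA //; first by rewrite eq_sym.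
    by case.
  apply: (@le_trans _ _ (\sum_(t in A :\ s) e * F h ^+ #|A|)); last first.
    have cA : #|A :\ s| = #|A|.-1 by rewrite (cardsD1 s A) sA.
    by rewrite sumr_const cA mulr_natl.
  rewrite big_mkcond [leRHS]big_mkcond; apply: ler_sum => t _; rewrite !inE.
  case: eqP => //= /eqP ts; rewrite sum_prod_marked_weight2 1?eq_sym //; last by case.
  rewrite sA /=; case: ifP => // tA.
  have -> : F h ^+ #|A| = F h ^+ 2 * F h ^+ #|A|.-2.
    by rewrite -exprD (cardsD1 s A) sA (cardsD1 t (A :\ s)) !inE tA ts.
  by rewrite mulrA; apply: ler_wpM2r; [exact: exprn_ge0|apply: c2; rewrite eq_sym].
apply: le_trans (lerB (lerB (lexx _) b1) b2).
case: (posnP #|A|) => [->|A0]; first by rewrite !mul0r expr0n /= mul0r !subr0 mulr1.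
rewrite -subn1 natrB //; set P := F h ^+ _; move: #|A|%:R => a.
by rewrite le_eqVlt; apply/orP; left; apply/eqP; ring.
Qed.

Hypothesis d0 : (0 < d)%N.

Lemma clash1_bound (M : R) h s : 1 <= M -> (16 * h.*2.+1)%:R * M ^+ 2 <= N ->
  (forall k phi, (forall z, 0 <= phi z) ->
    \sum_(c : tree_code h) valid_weight c * level_sum k c phi <= F h * (M / N) ^+ k * walks k phi) ->
  \sum_(c : tree_code h) valid_weight c * (clash1 s (embed c))%:R <= 512 * M ^+ 2 / N * F h.
Proof.
move=> M1 hN lb; apply: (@le_trans _ _ (\sum_(k < h.+1) \sum_(c : tree_code h) valid_weight c * level_sum k c (@psi1 R d s))).
  rewrite exchange_big; apply: ler_sum => c _; rewrite -mulr_sumr.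
  by apply: ler_wpM2l; [exact: valid_weight_ge0|exact: clash1_level_sum].
apply: (@le_trans _ _ (\sum_(k < h.+1) F h * ((M / N) ^+ k * walks k (@psi1 R d s)))).
  by apply: ler_sum => k _; rewrite mulrA; apply: lb; exact: psi1_ge0.
by rewrite -mulr_sumr mulrC; apply: ler_wpM2r; [exact: tree_weight_ge0|exact: sum_psi1].
Qed.

(** The weights of two branches are independent, so each is replaced by a random walk in turn; the
    difference of their endpoints is that of a single walk of length k + j. *)
Lemma clash2_bound (M : R) h s t : s != t -> 1 <= M -> (16 * h.*2.+1)%:R * M ^+ 2 <= N ->
  (forall k phi, (forall z, 0 <= phi z) ->
    \sum_(c : tree_code h) valid_weight c * level_sum k c phi <= F h * (M / N) ^+ k * walks k phi) ->
  \sum_(c : tree_code h) \sum_(c' : tree_code h) valid_weight c * valid_weight c' * (clash2 s (embed c) t (embed c'))%:R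
    <= 512 * M ^+ 2 / N * F h ^+ 2.
Proof.
move=> st M1 hN lb; have F0 : 0 <= F h by exact: tree_weight_ge0.
have mu0 : 0 <= M / N by rewrite divr_ge0 ?ler0n //; apply: le_trans M1.
pose psi := @psi2 R d s t.
apply: (@le_trans _ _ (\sum_(k < h.+1) \sum_(j < h.+1) \sum_(c : tree_code h) valid_weight c *
    level_sum k c (fun u => \sum_(c' : tree_code h) valid_weight c' * level_sum j c' (fun v => psi (u - v))))).
  under [leRHS]eq_bigr => k _ do rewrite exchange_big.
  rewrite [leRHS]exchange_big /=; apply: ler_sum => c _.
  have e (k j : nat) : level_sum k c (fun u => \sum_(c' : tree_code h) valid_weight c' * level_sum j c' (fun v => psi (u - v))) =
     \sum_(c' : tree_code h) valid_weight c' * level_sum k c (fun u => level_sum j c' (fun v => psi (u - v))).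
    by rewrite level_sum_sum; apply: eq_bigr => c' _; rewrite level_sumZ.
  under [leRHS]eq_bigr => k _ do under eq_bigr => j _ do rewrite e mulr_sumr.
  under [leRHS]eq_bigr => k _ do rewrite exchange_big.
  rewrite [leRHS]exchange_big /=; apply: ler_sum => c' _.
  under [leRHS]eq_bigr => k _ do under eq_bigr => j _ do rewrite mulrA.
  under [leRHS]eq_bigr => k _ do rewrite -mulr_sumr.
  rewrite -mulr_sumr; apply: ler_wpM2l; first by rewrite mulr_ge0 ?valid_weight_ge0.
  exact: clash2_level_sum.
apply: (@le_trans _ _ (\sum_(k < h.+1) \sum_(j < h.+1)
   F h ^+ 2 * ((M / N) ^+ (k + j) * walks (k + j) psi))); last first.
  under eq_bigr => k _ do rewrite -mulr_sumr.
  rewrite -mulr_sumr mulrC; apply: ler_wpM2r; first exact: exprn_ge0.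
  exact: sum_psi2.
apply: ler_sum => k _; apply: ler_sum => j _.
have W0 u : 0 <= walks j (fun v => psi (u - v)) by apply: walks_ge0 => z; exact: psi2_ge0.
apply: (@le_trans _ _ (\sum_(c : tree_code h) valid_weight c *
    level_sum k c (fun u => F h * (M / N) ^+ j * walks j (fun v => psi (u - v))))).
  apply: ler_sum => c _; apply: ler_wpM2l; first exact: valid_weight_ge0.
  by apply: level_sum_mono => u; apply: lb => z; exact: psi2_ge0.
apply: le_trans (lb _ _ _) _; first by move=> z; rewrite mulr_ge0 ?W0 // mulr_ge0 ?exprn_ge0.
rewrite walksZ walks_walks exprD expr2 le_eqVlt; apply/orP; left; apply/eqP.
by move: (walks _ _) => w; ring.
Qed.

End Recursion.

(** * Valid codes as grown vertex sets *)

Section Embedding.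
Variable d : nat.
Notation V := 'rV[int]_d.
Notation dir := (dir d).
Variable off : nat -> nat -> bool.
Variables i0 i1 i2 : 'I_d.
Hypotheses (i01 : i0 != i1) (i02 : i0 != i2) (i12 : i1 != i2).

Lemma near0 : near (0 : V). Proof. by rewrite /near eqxx. Qed.
Lemma near_stp (s : dir) : near (stp s).
Proof. by rewrite /near; apply/orP; right; apply/existsP; exists s. Qed.

Definition branch h (f : {ffun dir -> option (tree_code d h)}) s : {fset V} :=
  if f s is Some c then translate (stp s) (embed c) else fset0.

Section Branches.
Variables (h : nat) (f : {ffun dir -> option (tree_code d h)}).
Hypothesis nc : no_clash (@embed d h) f.

Lemma branch_root s x : x \in branch f s -> near x -> x = stp s.
Proof.
rewrite /branch; case e: (f s) => [c|]; last by rewrite inE.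
rewrite in_translate => xc nx; case/andP: nc => /forallP /(_ s) + _.
rewrite e => /hasPn /(_ _ xc); rewrite [stp s + _]addrC subrK nx andbT negbK subr_eq0.
by move/eqP.
Qed.

Lemma branch_neq0 s x : x \in branch f s -> x != 0.
Proof.
move=> xb; apply/eqP => x0; have := branch_root xb; rewrite x0 => /(_ near0) /esym /eqP.
by rewrite (negPf (stp_neq0 s)).
Qed.

Lemma branch_far s t x y : x \in branch f s -> y \in branch f t -> near (x - y) -> s = t.
Proof.
rewrite /branch; case e: (f s) => [c|]; last by rewrite inE.
case e': (f t) => [c'|]; last by rewrite inE.
rewrite !in_translate => xc yc n; apply/eqP; apply: contraT => st.
case/andP: nc => _ /forallP /(_ s) /forallP /(_ t); rewrite st e e' /= => /hasPn /(_ _ xc) /hasPn /(_ _ yc).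
by rewrite ![stp _ + _]addrC !subrK n.
Qed.

Lemma stp_branch s t : stp s \in branch f t -> s = t.
Proof. by move=> h1; have := branch_root h1 (near_stp s) => /stp_inj. Qed.

Lemma in_branches x : (x \in embed (f : tree_code d h.+1)) = (x == 0) || [exists s, x \in branch f s].
Proof.
rewrite in_embed; congr orb; apply: eq_existsb => s; rewrite /branch.
by case: (f s) => [c|]; rewrite ?in_translate ?inE.
Qed.

Lemma stp_embed s : (stp s \in embed (f : tree_code d h.+1)) = isSome (f s).
Proof.
rewrite in_branches (negPf (stp_neq0 s)) /=; apply/existsP/idP.
  by move=> [t h1]; move: (h1); rewrite -(stp_branch h1) /branch; case: (f s) => //; rewrite inE.
by move=> fs; exists s; rewrite /branch; case: (f s) fs => // c _; rewrite in_translate subrr embed_root.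
Qed.

End Branches.

(** The branches are attached to 0 one after another, each as a whole by [grow_union]: without
    clashes its root is a leaf over the part already built, and its other vertices stay away from
    that part. The branches being disjoint, the weight counts the vertices of the image. *)
Lemma valid_grow (R : realFieldType) (x : R) h (c : tree_code d h) : valid off c -> grow 0 (embed c) /\ tree_code_weight x c = x ^+ #|` embed c|.
Proof.
elim: h c => [|h IH] c; first by move=> _; split; [exact: grow1|rewrite /= cardfs1].
move: c => f /and3P[_ /forallP vf nc].
pose K r : {fset V} := (0 |` \bigcup_(s <- r) branch f s)%fset.
have inK r z : z \in K r -> z = 0 \/ exists2 s, s \in r & z \in branch f s.
  rewrite !inE => /orP[/eqP|/bigfcupP[s]]; first by left.
  by rewrite andbT => sr zs; right; exists s.
have : forall r, uniq r -> grow 0 (K r) /\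
    x * \prod_(s <- r) (if f s is Some c then tree_code_weight x c else 1) = x ^+ #|` K r|.
  elim=> [|s r IHr] /=.
    rewrite /K !big_nil fsetU0 mulr1 cardfs1 expr1; split => //; exact: grow1.
  move=> /andP[sr ur]; have [gK wK] := IHr ur.
  have eK : K (s :: r) = (K r `|` branch f s)%fset.
    by apply/fsetP => z; rewrite /K big_cons !inE -orbA [(z \in branch f s) || _]orbC.
  rewrite eK big_cons; case e: (f s) => [c|]; last first.
    by rewrite /branch e fsetU0 mul1r.
  have := vf s; rewrite e => /IH [gc wc].
  have bs : branch f s = translate (stp s) (embed c) by rewrite /branch e.
  have dis z : z \in branch f s -> z \notin K r.
    move=> zs; apply/negP => /inK [z0|[t tr zt]].
      by have := branch_neq0 nc zs; rewrite z0 eqxx.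
    have := branch_far nc zs zt; rewrite subrr => /(_ (near0)) st.
    by rewrite st tr in sr.
  have ss : stp s \in branch f s by rewrite bs in_translate subrr embed_root.
  split.
    rewrite bs; apply: (@grow_union _ (stp s) _ _ _ _ (opd s)) => //.
    - by rewrite -{1}[stp s]add0r; exact: grow_translate.
    - split; first exact: dis.
        by rewrite -[stp s]add0r stpD_opd !inE eqxx.
      move=> t /inK [z0|[q qr zq]].
        by apply: (@stp_inj d); rewrite stp_opd; apply/eqP; rewrite -addr_eq0 addrC z0.
      have := branch_far nc zq ss; rewrite addrAC subrr add0r => /(_ (near_stp t)) qs.
      by rewrite -qs qr in sr.
    - by move=> z; rewrite -bs; exact: dis.
    - move=> z t; rewrite -bs => zs /inK [z0|[q qr zq]].
        have ez : z = stp (opd t) by rewrite stp_opd; apply/eqP; rewrite -addr_eq0 z0.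
        by apply: (branch_root nc zs); rewrite ez; exact: near_stp.
      have := branch_far nc zq zs; rewrite addrAC subrr add0r => /(_ (near_stp t)) qs.
      by rewrite -qs qr in sr.
  have -> : #|` (K r `|` branch f s)%fset| = (#|` K r| + #|` embed c|)%N.
    rewrite cardfsU disjoint_fsetI0; last first.
      by rewrite fdisjoint_sym; apply/fdisjointP.
    by rewrite cardfs0 subn0 bs card_translate.
  by rewrite exprD -wK -wc mulrCA [_ * tree_code_weight x c]mulrC.
move=> /(_ (enum {: dir}) (enum_uniq _)) [g w]; split; first exact: g.
rewrite -[RHS]w; congr (_ * _); rewrite [RHS]big_enum_cond; exact: eq_bigl.
Qed.

Lemma valid_good h (c : tree_code d h) : valid off c -> good (embed c).
Proof. by move=> /(valid_grow (0 : rat)) [gc _]; exact: (grow_good i01 i02 i12 gc). Qed.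

Lemma valid_rim h (c : tree_code d h) : valid off c -> rim (embed c) = embed c.
Proof. by move=> /(valid_grow (0 : rat)) [gc _]; exact: (grow_rim i01 i02 i12 gc). Qed.

(** Distinct branches are never within distance 1, so a walk inside one branch of a code cannot
    change branches of the other code. Starting from the common vertex [stp s], this identifies the
    branches in direction s, and induction applies to their codes. *)
Lemma embed_inj h (c c' : tree_code d h) : valid off c -> valid off c' -> embed c = embed c' -> c = c'.
Proof.
elim: h c c' => [|h IH] c c'; first by case: c; case: c'.
move: c c' => f f' v v' e.
have [/and3P[_ /forallP vf nc] /and3P[_ /forallP vf' nc']] := (v, v').
apply/ffunP => s.
have sub (g g' : {ffun dir -> option (tree_code d h)}) r r' : no_clash (@embed d h) g -> no_clash (@embed d h) g' ->
    (forall s, if g s is Some c then valid off c else true) ->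
    embed (g : tree_code d h.+1) = embed (g' : tree_code d h.+1) ->
    g s = Some r -> g' s = Some r' -> forall z, z \in embed r -> z \in embed r'.
  move=> ng ng' vg eg gs gs'.
  have vr : valid off r by have := vg s; rewrite gs.
  have [cr _] := valid_good vr.
  apply: (cr (fun z => z \in embed r') 0); rewrite ?embed_root // => y t yr ytr yr'.
  have bz w : w \in embed r -> w + stp s \in branch g s by rewrite /branch gs in_translate addrK.
  have bz' w : w \in embed r' -> w + stp s \in branch g' s by rewrite /branch gs' in_translate addrK.
  have : y + stp t + stp s \in embed (g' : tree_code d h.+1).
    by rewrite -eg in_branches; apply/orP; right; apply/existsP; exists s; exact: bz.
  rewrite in_branches (negPf (branch_neq0 ng (bz _ ytr))) /= => /existsP[q qb].
  have := branch_far ng' qb (bz' _ yr').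
  have -> : y + stp t + stp s - (y + stp s) = stp t by apply/rowP => j; rewrite !mxE; ring.
  by move=> /(_ (near_stp t)) qs; move: qb; rewrite qs /branch gs' in_translate addrK.
case fs: (f s) => [r|]; case fs': (f' s) => [r'|] //.
- congr Some; apply: IH.
  + by have := vf s; rewrite fs.
  + by have := vf' s; rewrite fs'.
  + by apply/fsetP => z; apply/idP/idP; [exact: (sub f f')|exact: (sub f' f)].
- by have := stp_embed nc' s; rewrite -e stp_embed // fs fs'.
- by have := stp_embed nc' s; rewrite -e stp_embed // fs fs'.
Qed.
End Embedding.

From mathcomp Require Import all_classical all_reals all_analysis.
Import Order.TTheory GRing.Theory Num.Theory.
Import numFieldNormedType.Exports.

(** * Growth of the weight of embedded trees *)

Lemma bernoulli_ge (R : realFieldType) (a : R) n : -1 <= a -> 1 + n%:R * a <= (1 + a) ^+ n.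
Proof.
move=> a1; elim: n => [|n IH]; first by rewrite mul0r addr0 expr0.
rewrite exprS; apply: le_trans (ler_wpM2l _ IH); last by rewrite -lerBlDl sub0r.
have : 0 <= n%:R * (a * a) by rewrite mulr_ge0 ?ler0n // -expr2 sqr_ge0.
by rewrite -natr1; move: (n%:R) => b; nra.
Qed.

Lemma expR1_le4 (R : realType) : expR 1 <= 4 :> R.
Proof.
have h : expR (- 2^-1) >= 2^-1 :> R.
  by apply: le_trans (expR_ge1Dx _); lra.
rewrite (_ : expR 1 = expR 2^-1 * expR 2^-1); last by rewrite -expRD; congr expR; field.
have h2 : expR 2^-1 <= 2 :> R.
  by rewrite -[expR _]invrK -expRN -[leRHS]invrK lef_pV2 ?posrE ?expR_gt0 // invr_gt0.
have -> : 4 = 2 * 2 :> R by ring.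
by apply: ler_pM; rewrite ?expR_ge0.
Qed.

(* (1 + F)(1 - F) <= exp(F)^-1 (1 + F) turns the product (1 + F)^n into exp(n F). *)
Lemma expR_lower (R : realType) (y : R) n : 0 <= y -> y <= n%:R -> (0 < n)%N ->
  expR y * (1 - y ^+ 2 / n%:R) <= (1 + y / n%:R) ^+ n.
Proof.
move=> y0 yn n0; set F := y / n%:R.
have nR : 0 < n%:R :> R by rewrite ltr0n.
have F0 : 0 <= F by rewrite divr_ge0 ?ler0n.
have F1 : F <= 1 by rewrite ler_pdivrMr // mul1r.
have -> : y = n%:R * F by rewrite mulrC divfK ?gt_eqF.
have -> : (n%:R * F) ^+ 2 / n%:R = n%:R * F ^+ 2 by field; rewrite gt_eqF.
rewrite expRM_natl; apply: (@le_trans _ _ (expR F ^+ n * (1 - F ^+ 2) ^+ n)).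
  apply: ler_wpM2l; first by rewrite exprn_ge0 ?expR_ge0.
  rewrite -mulrN; apply: bernoulli_ge; rewrite lerN2 expr_le1 //.
have F2 : 0 <= 1 - F ^+ 2 by rewrite subr_ge0 expr_le1.
rewrite -exprMn; apply: lerXn2r; rewrite ?nnegrE ?mulr_ge0 ?F2 ?expR_ge0 //; first exact: addr_ge0.
have -> : 1 - F ^+ 2 = (1 - F) * (1 + F) by ring.
rewrite mulrA -[leRHS]mul1r; apply: ler_wpM2r; first by rewrite addr_ge0.
apply: (@le_trans _ _ (expR F * expR (- F))); last by rewrite -expRD subrr expR0.
by apply: ler_wpM2l; rewrite ?expR_ge0 // expR_ge1Dx.
Qed.

(** * Sums over subsets *)

Section Sets.
Variables (R : realFieldType) (T : finType) (a : R).
Hypothesis a0 : 0 <= a.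

Lemma sum_sets : \sum_(A : {set T}) a ^+ #|A| = (1 + a) ^+ #|T|.
Proof.
rewrite -[in RHS]prodr_const addrC (eq_bigl xpredT) // bigA_distr.
by apply: eq_bigr => A _; rewrite -prodr_const big_mkcond.
Qed.

(** Requiring s in A replaces the factor 1 + a at s by a. *)
Lemma sum_sets_in s : \sum_(A : {set T} | s \in A) a ^+ #|A| <= a * (1 + a) ^+ #|T|.
Proof.
apply: (@le_trans _ _ (\prod_(t : T) (a + (t != s)%:R))).
  rewrite bigA_distr [leLHS]big_mkcond; apply: ler_sum => A _; case: ifP => sA.
    rewrite -prodr_const big_mkcond /=; apply: ler_prod => t _.
    case: ifP => tA; first by rewrite a0 lexx.
    by rewrite (_ : t != s) ?ler01 ?lexx //; apply: contraFneq tA => ->.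
  by apply: prodr_ge0 => t _; case: ifP.
rewrite (bigD1 s) //= eqxx addr0; apply: ler_wpM2l => //.
rewrite -prodr_const [leRHS](bigD1 s) //= -[leLHS]mul1r.
apply: ler_pM; rewrite ?lerDl //; first by apply: prodr_ge0 => t _; rewrite addr_ge0.
by apply: ler_prod => t ts; rewrite ts addr_ge0 //= addrC lexx.
Qed.

Lemma sum_sets_size k : \sum_(A : {set T} | #|A| == k) a ^+ #|A| = 'C(#|T|, k)%:R * a ^+ k.
Proof.
rewrite (eq_bigr (fun _ => a ^+ k)); last by move=> A /eqP ->.
rewrite sumr_const -card_draws mulr_natl; congr (_ *+ _).
by apply: eq_card => A; rewrite !inE.
Qed.

Lemma card_pairs_in (s : T) : (#|[pred A : {set T} | (#|A| == 2) && (s \in A)]| <= #|T|)%N.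
Proof.
apply: leq_trans (leq_imset_card (fun t => [set s; t]%SET) predT).
apply: subset_leq_card; apply/fintype.subsetP => A /andP[/cards2P[u [v [uv ->]]]].
by rewrite !inE => /orP[]/eqP->; apply/imsetP; [exists v|exists u; rewrite // finset.setUC].
Qed.
End Sets.

(** A code reads the rule only below its own height, so the rule may be altered above a height
    already treated. *)
Lemma valid_eq_off d (off off' : nat -> nat -> bool) H h (c : tree_code d h) :
  (forall h' k, (h' < H)%N -> off h' k = off' h' k) -> (h <= H)%N ->
  valid off c = valid off' c.
Proof.
move=> e; elim: h c => // h IH c hH; rewrite /= e //; congr (_ && (_ && _)).
by apply: eq_forallb => s; case: (c s) => // c'; apply: IH; exact: ltnW.
Qed.

Lemma eq_tree_weight (R : realFieldType) d (x : R) (off off' : nat -> nat -> bool) h :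
  (forall h' k, (h' < h)%N -> off h' k = off' h' k) -> tree_weight d off x h = tree_weight d off' x h.
Proof. by move=> e; apply: eq_bigr => c _; rewrite /valid_weight (valid_eq_off _ e). Qed.

(** * One generation, with unrestricted or with binary branching *)

Section Phases.
Variables (R : realType) (d : nat) (x : R).
Hypothesis d0 : (0 < d)%N.
Hypothesis x0 : 0 <= x.
Local Notation N := ((2 * d)%:R : R).
Local Notation F := (tree_weight d).
Implicit Type off : nat -> nat -> bool.

Definition mass off h : R := N * F off x h.

(** The hypothesis of [level_sum_bound] with mu = 2^7/N. It is propagated from height to height,
    being what bounds the clashes at the next one. *)
Definition spread off h := forall h' s, (h' < h)%N ->
  x * F off x h' * \sum_(A : {set dir d} | off h' #|A| && (s \in A)) F off x h' ^+ #|A|.-1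
    <= 2 ^+ 7 / N * F off x h'.+1.

Let N0 : 0 < N. Proof. by rewrite ltr0n muln_gt0. Qed.
Let N1 : 1 <= N. Proof. by rewrite ler1n muln_gt0. Qed.

(** For M = 2^7 the constants of the clash bounds are 16 M^2 = 2^18 and 512 M^2 = 2^23. *)
Lemma spread_lower off h : spread off h -> 2 ^+ 18 * h.*2.+1%:R <= N ->
  x * \sum_(A : {set dir d} | off h #|A|)
    F off x h ^+ #|A| * (1 - #|A|%:R ^+ 2 * (2 ^+ 23 / N)) <= F off x h.+1.
Proof.
move=> sp hN.
have M1 : 1 <= 2 ^+ 7 :> R by rewrite exprn_ege1 // ler1n.
have two n m : (2 ^+ n) ^+ m = 2 ^+ (n * m) :> R by rewrite exprM.
have e16 : 16%:R = 2 ^+ 4 :> R by rewrite -natrX.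
have hN' : (16 * h.*2.+1)%:R * (2 ^+ 7) ^+ 2 <= N.
  by apply: le_trans hN; rewrite natrM e16 mulrAC two -exprD.
have lb k phi : (forall z, 0 <= phi z) ->
    \sum_(c : tree_code d h) valid_weight off x c * level_sum k c phi <= F off x h * (2 ^+ 7 / N) ^+ k * walks k phi.
  by move=> p; apply: (level_sum_bound x0 (H := h)) => //; rewrite divr_ge0 ?exprn_ge0 // ltW.
have e : 512 * (2 ^+ 7) ^+ 2 / N = 2 ^+ 23 / N.
  have e512 : 512%:R = 2 ^+ 9 :> R by rewrite -natrX.
  by rewrite e512 two -exprD.
rewrite -e; apply: tree_weight_lower => // [s|s t st]; first exact: clash1_bound.
exact: clash2_bound.
Qed.
Let F0 off h : 0 <= F off x h. Proof. exact: tree_weight_ge0. Qed.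

Lemma spread_succ off h : spread off h ->
  (forall s, x * \sum_(A : {set dir d} | off h #|A| && (s \in A)) F off x h ^+ #|A|
    <= 2 ^+ 7 / N * F off x h.+1) -> spread off h.+1.
Proof.
move=> sp st h' s; rewrite ltnS leq_eqVlt => /orP[/eqP->|]; last exact: sp.
rewrite -mulrA mulr_sumr; apply: le_trans (st s).
apply: ler_wpM2l => //; apply: ler_sum => A /andP[_ sA].
by rewrite -exprS prednK // (cardsD1 s A) sA.
Qed.

(** By |A|^2 <= 2 * 2^|A| the clashes cost at most 2 (1 + 2F)^N 2^23/N, and (1 + 2F)^N <= exp (2y)
    <= exp 128 while y <= 64. *)
Definition loss : R := 2 * expR 128 * 2 ^+ 23.

Lemma sqr_le_pow2 k : k%:R ^+ 2 <= 2 * 2 ^+ k :> R.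
Proof.
rewrite -natrX -[2 ^+ k]natrX -natrM ler_nat.
elim: k => [|[|[|[|k]]] IH] //; rewrite [(2 ^ k.+4)%N]expnS; move: IH.
by move: (2 ^ k.+3)%N => e; rewrite -!mulnn; lia.
Qed.

Lemma all_step off h : (forall k, off h k) -> spread off h -> 2 ^+ 18 * h.*2.+1%:R <= N ->
  mass off h <= 64 -> x * ((1 + F off x h) ^+ (2 * d) - loss / N) <= F off x h.+1.
Proof.
move=> oh sp hN y64; apply: le_trans (spread_lower sp hN); apply: ler_wpM2l => //.
set f := F off x h.
rewrite (eq_bigl xpredT); last by move=> A; rewrite oh.
under eq_bigr => A _ do rewrite mulrBr mulr1.
rewrite sumrB sum_sets card_dir; apply: lerB => //.
apply: (@le_trans _ _ (\sum_(A : {set dir d}) (2 * f) ^+ #|A| * (2 * (2 ^+ 23 / N)))).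
  set E := 2 ^+ 23 / N; have E0 : 0 <= E by rewrite divr_ge0 ?exprn_ge0 // ltW.
  apply: ler_sum => A _.
  have -> : (2 * f) ^+ #|A| * (2 * E) = f ^+ #|A| * ((2 * 2 ^+ #|A|) * E) by rewrite exprMn; ring.
  apply: ler_wpM2l; first by rewrite exprn_ge0 ?F0.
  by apply: ler_wpM2r => //; exact: sqr_le_pow2.
rewrite -mulr_suml sum_sets card_dir /loss.
have -> : 2 * expR 128 * 2 ^+ 23 / N = expR 128 * (2 * (2 ^+ 23 / N)) by ring.
apply: ler_wpM2r; first by rewrite mulr_ge0 // divr_ge0 ?exprn_ge0 // ltW.
apply: (@le_trans _ _ (expR (2 * f) ^+ (2 * d))).
  by apply: lerXn2r; rewrite ?nnegrE ?expR_ge0 ?addr_ge0 ?mulr_ge0 ?F0 // expR_ge1Dx.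
rewrite -expRM_natl ler_expR mulrCA -/f; move: y64; rewrite /mass -/f.
by move: (N * f) => z; lra.
Qed.

(** Prescribing a branch costs a factor F, and x (1 + F)^N is at most twice the next weight because
    loss/N <= 1/2. The ratio is at most 2F = 2y/N <= 128/N, the origin of 2^7. *)
Lemma all_spread off h : (forall k, off h k) -> spread off h -> 2 ^+ 18 * h.*2.+1%:R <= N ->
  mass off h <= 64 -> 2 * loss <= N -> spread off h.+1.
Proof.
move=> oh sp hN y64 lN; apply: spread_succ => // s; set f := F off x h.
have f0 : 0 <= f by exact: F0.
have st := all_step oh sp hN y64; rewrite -/f in st.
have p1 : 1 <= (1 + f) ^+ (2 * d) by apply: exprn_ege1; rewrite lerDl.
have half : x * (1 + f) ^+ (2 * d) <= 2 * F off x h.+1.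
  apply: (@le_trans _ _ (2 * (x * ((1 + f) ^+ (2 * d) - loss / N)))); last by apply: ler_wpM2l.
  rewrite mulrCA; apply: ler_wpM2l => //.
  have : loss / N <= 2^-1 by rewrite ler_pdivrMr // ler_pdivlMl.
  by move: ((1 + f) ^+ _) (loss / N) p1 => a b *; lra.
apply: (@le_trans _ _ (x * (f * (1 + f) ^+ (2 * d)))).
  apply: ler_wpM2l => //; rewrite (eq_bigl (fun A : {set dir d} => s \in A)).
    by have := sum_sets_in f0 s; rewrite card_dir.
  by move=> A; rewrite oh.
rewrite mulrCA; apply: le_trans (ler_wpM2l f0 half) _.
rewrite mulrA; apply: ler_wpM2r; first exact: F0.
rewrite ler_pdivlMr //; have -> : 2 ^+ 7 = 128 :> R by rewrite -natrX.
have -> : f * 2 * N = 2 * (N * f) by ring.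
by move: y64; rewrite /mass -/f; move: (N * f) => z; lra.
Qed.

(** The second term pays for passing from (1 + F)^N to exp y by [expR_lower]. *)
Definition loss' : R := loss + 64 ^+ 2 * expR 64.

Lemma all_growth off h : (forall k, off h k) -> spread off h -> 2 ^+ 18 * h.*2.+1%:R <= N ->
  mass off h <= 64 -> 64 <= N ->
  N * x * (expR (mass off h) - loss' / N) <= mass off h.+1.
Proof.
move=> oh sp hN y64 N64; rewrite [leRHS]/mass -mulrA; apply: ler_wpM2l; first exact: ltW.
apply: le_trans (all_step oh sp hN y64); apply: ler_wpM2l => //.
set y := mass off h in y64 *; have y0 : 0 <= y by rewrite mulr_ge0 // ltW.
have -> : F off x h = y / N by rewrite /y /mass mulrC mulKf // gt_eqF.
have := @expR_lower R y (2 * d) y0 (le_trans y64 N64); rewrite muln_gt0 d0 => /(_ isT).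
have : expR y * (y ^+ 2 / N) <= 64 ^+ 2 * expR 64 / N.
  rewrite mulrA mulrC [_ * expR 64]mulrC -[leRHS]mulrC; apply: ler_wpM2l; first by rewrite invr_ge0 ltW.
  by apply: ler_pM; rewrite ?expR_ge0 ?exprn_ge0 ?ler_expR // lerXn2r ?nnegrE.
rewrite /loss' mulrBr mulr1 mulrDl.
set a := expR y * (y ^+ 2 / N); set b := loss / N; set c := 64 ^+ 2 * expR 64 / N; lra.
Qed.

(** For |A| = 2 the clash factor is 1 - 4 * 2^23/N, which is at least 1/2. *)
Lemma pair_step off h : (forall k, off h k = (k == 2)) -> spread off h ->
  2 ^+ 18 * h.*2.+1%:R <= N -> 2 ^+ 26 <= N ->
  x * ('C(2 * d, 2)%:R * F off x h ^+ 2) <= 2 * F off x h.+1.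
Proof.
move=> oh sp hN NN; apply: le_trans (ler_wpM2l _ (spread_lower sp hN)) => //.
rewrite [leRHS]mulrCA; apply: ler_wpM2l => //.
rewrite (eq_bigl (fun A : {set dir d} => #|A| == 2)); last by move=> A; rewrite oh.
rewrite (eq_bigr (fun A : {set dir d} => F off x h ^+ #|A| * (1 - 4 * (2 ^+ 23 / N)))); last first.
  by move=> A /eqP ->; rewrite -natrX.
rewrite -mulr_suml sum_sets_size card_dir; set c := 'C(2 * d, 2)%:R * _.
have c0 : 0 <= c by rewrite mulr_ge0 ?exprn_ge0 ?F0.
rewrite [leRHS]mulrCA; apply: ler_peMr => //.
have : 2 ^+ 23 / N <= 8^-1.
  rewrite ler_pdivrMr // ler_pdivlMl //; apply: le_trans NN.
  have -> : 8 = 2 ^+ 3 :> R by rewrite -natrX.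
  by rewrite -exprD.
by move: (2 ^+ 23 / N) => z; lra.
Qed.

Lemma binN2 : 'C(2 * d, 2)%:R = N * (N - 1) / 2 :> R.
Proof.
have d2 : (0 < 2 * d)%N by rewrite muln_gt0.
have : ('C(2 * d, 2) * 2 = 2 * d * (2 * d).-1)%N by rewrite mulnC -mul_bin_diag bin1.
move=> /(congr1 (fun n => n%:R : R)); rewrite !natrM -subn1 natrB // natrM => <-.
by field.
Qed.

(** A given direction lies in at most N of the N (N - 1)/2 pairs. The resulting ratio of order 1/N
    does not depend on the mass, unlike in [all_spread]. *)
Lemma pair_spread off h : (forall k, off h k = (k == 2)) -> spread off h ->
  2 ^+ 18 * h.*2.+1%:R <= N -> 2 ^+ 26 <= N -> spread off h.+1.
Proof.
move=> oh sp hN NN; apply: spread_succ => // s; set f := F off x h.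
have f0 : 0 <= f by exact: F0.
have st := pair_step oh sp hN NN; rewrite -/f binN2 in st.
apply: (@le_trans _ _ (x * (N * f ^+ 2))).
  apply: ler_wpM2l => //.
  rewrite (eq_bigl (fun A : {set dir d} => (#|A| == 2) && (s \in A))); last by move=> A; rewrite oh.
  rewrite (eq_bigr (fun _ => f ^+ 2)); last by move=> A /andP[/eqP ->].
  rewrite sumr_const -[leLHS]mulr_natl; apply: ler_wpM2r; first exact: exprn_ge0.
  by rewrite ler_nat -[leqRHS](card_dir d); exact: card_pairs_in.
rewrite mulrAC ler_pdivlMr //.
have -> : 2 ^+ 7 = 128 :> R by rewrite -natrX.
apply: (@le_trans _ _ (64 * (x * (N * (N - 1) / 2 * f ^+ 2)))); last by move: st; lra.
have xf : 0 <= x * f ^+ 2 by rewrite mulr_ge0 // exprn_ge0.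
have -> : x * (N * f ^+ 2) * N = (x * f ^+ 2) * (N * N) by ring.
have -> : 64 * (x * (N * (N - 1) / 2 * f ^+ 2)) = (x * f ^+ 2) * (32 * (N * (N - 1))) by field.
apply: ler_wpM2l => //; have N2 : 2 <= N by rewrite ler_nat leq_pmulr.
by rewrite mulrCA; apply: ler_wpM2l; [exact: ltW|lra].
Qed.

(** The recursion yields y' >= y^2/32, and this is at least 2y from y = 64 on, which fixes the
    threshold 64. *)
Lemma pair_growth off h : (forall k, off h k = (k == 2)) -> spread off h ->
  2 ^+ 18 * h.*2.+1%:R <= N -> 2 ^+ 26 <= N -> 4^-1 <= N * x -> 64 <= mass off h ->
  2 * mass off h <= mass off h.+1.
Proof.
move=> oh sp hN NN Nx y64; set y := mass off h in y64 *.
have st := pair_step oh sp hN NN; rewrite binN2 in st.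
have eF : F off x h = y / N by rewrite /y /mass mulrC mulKf // gt_eqF.
have N2 : 2 <= N by rewrite ler_nat leq_pmulr.
have y0 : 0 <= y by apply: le_trans y64.
have : N * (x * (N * (N - 1) / 2 * F off x h ^+ 2)) <= N * (2 * F off x h.+1).
  by apply: ler_wpM2l => //; exact: ltW.
have -> : N * (2 * F off x h.+1) = 2 * mass off h.+1 by rewrite /mass; ring.
have -> : N * (x * (N * (N - 1) / 2 * F off x h ^+ 2)) = (N * x) * ((N - 1) / (2 * N)) * y ^+ 2.
  by rewrite eF; field; rewrite pnatr_eq0 -lt0n.
have h4 : 4^-1 <= (N - 1) / (2 * N) by rewrite ler_pdivlMr ?mulr_gt0 //; lra.
have : 4^-1 * 4^-1 * y ^+ 2 <= (N * x) * ((N - 1) / (2 * N)) * y ^+ 2.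
  by apply: ler_wpM2r; [exact: exprn_ge0|apply: ler_pM; rewrite ?invr_ge0].
have : 64 * y <= y ^+ 2 by rewrite expr2; apply: ler_wpM2r.
set a := N * x * _ * _; set b := y ^+ 2; lra.
Qed.
End Phases.

(** * Growth of the mass through both phases *)

Section Mass.
Variables (R : realType) (d : nat) (x : R) (P : nat).
Hypothesis d0 : (0 < d)%N.
Local Notation N := ((2 * d)%:R : R).

(** At least N/2^22 steps with factor 1 + gain/N raise the mass by the factor 64 e that separates
    1/e from 64. *)
Definition gain : R := 2 ^+ 22 * (64 * expR 1).
Definition excess : R := gain + 2 * loss' R.

Hypothesis NN : 2 ^+ 26 <= N.
Hypothesis Nloss : 2 * loss R <= N.
Hypothesis Nexc : excess <= N.
Hypothesis NP : 2 ^+ 21 * P%:R <= N.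
Hypothesis NP1 : N <= 2 ^+ 21 * P.+1%:R.
Hypothesis Nx : N * x = (1 + excess / N) * expR (-1).

Let N0 : 0 < N. Proof. by rewrite ltr0n muln_gt0. Qed.
Let loss0 : 0 <= loss R. Proof. by rewrite !mulr_ge0 ?expR_ge0 ?exprn_ge0. Qed.
Let loss'0 : 0 <= loss' R.
Proof. by rewrite addr_ge0 // mulr_ge0 ?expR_ge0 ?exprn_ge0. Qed.
Let gain0 : 0 <= gain. Proof. by rewrite !mulr_ge0 ?expR_ge0 ?exprn_ge0. Qed.
Let exc0 : 0 <= excess. Proof. by rewrite addr_ge0 // mulr_ge0. Qed.
Let x0 : 0 <= x.
Proof.
rewrite -(pmulr_rge0 _ N0) Nx mulr_ge0 ?expR_ge0 // addr_ge0 // divr_ge0 // ltW.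
Qed.
Let N64 : 64 <= N.
Proof.
apply: le_trans NN; have -> : 64 = 2 ^+ 6 :> R by rewrite -natrX.
by apply: ler_weXn2l; rewrite ?ler1n.
Qed.
Let Nxe : expR (-1) <= N * x.
Proof. by rewrite Nx ler_peMl ?expR_ge0 // lerDl divr_ge0 // ltW. Qed.

(** Each phase takes at most P steps, and P <= N/2^21 keeps all heights in the range of
    [spread_lower]. *)
Let height h : (h <= 2 * P)%N -> 2 ^+ 18 * h.*2.+1%:R <= N.
Proof.
move=> hP; apply: (@le_trans _ _ (2 ^+ 18 * (4 * P%:R + 1))).
  apply: ler_wpM2l; first by rewrite exprn_ge0.
  rewrite -[4]/(4%:R) -natrM natr1 ler_nat ltnS -muln2.
  by apply: leq_trans (leq_mul hP (leqnn 2)) _; rewrite mulnAC.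
have e20 : 2 ^+ 20 * P%:R <= 2^-1 * N.
  by rewrite ler_pdivlMl // mulrA -exprS.
have -> : 2 ^+ 18 * (4 * P%:R + 1) = 2 ^+ 20 * P%:R + 2 ^+ 18 :> R.
  have -> : 2 ^+ 20 = 2 ^+ 18 * 2 ^+ 2 :> R by rewrite -exprD.
  by ring.
have : 2 ^+ 18 <= 2^-1 * N.
  rewrite ler_pdivlMl // -exprS; apply: le_trans NN.
  by apply: ler_weXn2l; rewrite ?ler1n.
by move: (2 ^+ 18) (2 ^+ 20 * _) e20 => a b; lra.
Qed.

(** Here exp (y - 1) >= y, and y >= 1/e turns the additive error into a relative one. With a =
    excess/N <= 1 and b = loss'/N the growth factor is at least (1 + a)(1 - b) >= 1 + a - 2b = 1 +
    gain/N, which explains [excess]. *)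
Lemma step_gain (off : nat -> nat -> bool) h : (forall k, off h k) -> spread d x off h -> (h <= 2 * P)%N ->
  expR (-1) <= mass d x off h <= 64 ->
  (1 + gain / N) * mass d x off h <= mass d x off h.+1.
Proof.
move=> oh sp hP /andP[y1 y64]; have := all_growth d0 x0 oh sp (height hP) y64 N64.
apply: le_trans; set y := mass d x off h in y1 y64 *.
rewrite Nx -mulrA; set a := excess / N; set b := loss' R / N.
have b0 : 0 <= b by rewrite divr_ge0 // ltW.
have a0 : 0 <= a by rewrite divr_ge0 // ltW.
have a1 : a <= 1 by rewrite ler_pdivrMr // mul1r.
have y0 : 0 <= y by apply: le_trans y1; exact: expR_ge0.
have : y - b * y <= expR (-1) * (expR y - b).
  rewrite mulrBr -expRD; apply: lerB.
    by have := expR_ge1Dx (-1 + y); rewrite addrA subrr add0r.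
  by rewrite mulrC; apply: ler_wpM2l.
have -> : gain / N = a - 2 * b by rewrite /a /b /excess; ring.
move=> h1; apply: le_trans (ler_wpM2l _ h1); last by rewrite addr_ge0.
have -> : (1 + a) * (y - b * y) = (1 + a - b - a * b) * y by ring.
apply: ler_wpM2r => //.
have : a * b <= b by rewrite ler_piMl.
by move: (a * b) => c; lra.
Qed.

Let all_off : nat -> nat -> bool := fun _ _ => true.

Lemma mass0 : expR (-1) <= mass d x all_off 0.
Proof.
rewrite /mass /tree_weight big_const card_unit iter_addr_0 /=.
by rewrite /valid_weight /= mulr1n.
Qed.

(** If the mass stayed below 64 for P steps, each of them would multiply it by 1 + gain/N, and
    Bernoulli's inequality would bring it to 64 after all. *)
Lemma first_phase : exists2 h, (h <= P)%N & spread d x all_off h /\ 64 <= mass d x all_off h.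
Proof.
apply: contrapT => no.
have all h : (h <= P)%N -> spread d x all_off h /\ expR (-1) * (1 + gain / N) ^+ h <= mass d x all_off h.
  elim: h => [|h IH] hP; first by split; [move=> ? ? | rewrite expr0 mulr1 mass0].
  have [sp lo] := IH (ltnW hP).
  have y64 : mass d x all_off h <= 64.
    by rewrite leNgt; apply/negP => h64; apply: no; exists h; [exact: ltnW|split => //; exact: ltW].
  have h2P : (h <= 2 * P)%N by apply: leq_trans (ltnW hP) _; rewrite leq_pmull.
  have g1 : 1 <= 1 + gain / N by rewrite lerDl divr_ge0 // ltW.
  split; first exact: all_spread (height h2P) y64 Nloss.
  have h1 : expR (-1) <= mass d x all_off h <= 64.
    rewrite y64 andbT; apply: le_trans lo; rewrite ler_peMr ?expR_ge0 //; exact: exprn_ege1.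
  apply: le_trans (step_gain _ sp h2P h1) => //.
  rewrite exprS mulrCA; apply: ler_wpM2l => //; exact: le_trans ler01 g1.
have [sp lo] := all P (leqnn P).
apply: no; exists P => //; split => //; apply: le_trans lo.
have g0 : 0 <= gain / N by rewrite divr_ge0 // ltW.
apply: (@le_trans _ _ (expR (-1) * (1 + P%:R * (gain / N)))); last first.
  by apply: ler_wpM2l; rewrite ?expR_ge0 // bernoulli_ge // (le_trans _ g0) // oppr_le0.
(* P is N/2^21 up to rounding, and N >= 2^26 makes the rounding harmless. *)
have PN : N <= 2 ^+ 22 * P%:R.
  have : 2 ^+ 22 <= 2^-1 * 2 ^+ 26 :> R.
    rewrite ler_pdivlMl // -exprS; apply: ler_weXn2l; rewrite ?ler1n //.
  have e22 : 2 ^+ 22 * P%:R = 2 * (2 ^+ 21 * P%:R) :> R by rewrite mulrA -exprS.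
  have e22' : 2 ^+ 22 = 2 * 2 ^+ 21 :> R by rewrite -exprS.
  have n1 : N <= 2 ^+ 21 * P%:R + 2 ^+ 21 by move: NP1; rewrite -[P.+1%:R]natr1 mulrDr mulr1.
  rewrite e22 e22'; move: N0 NN n1; set a := 2 ^+ 21 * P%:R; set b := 2 ^+ 21; set c := 2 ^+ 26.
  by move: a b c N => {e22 e22'} a b c n *; lra.
have : 64 * expR 1 <= P%:R * (gain / N).
  rewrite /gain mulrA ler_pdivlMr //.
  have -> : P%:R * (2 ^+ 22 * (64 * expR 1)) = (2 ^+ 22 * P%:R) * (64 * expR 1) :> R.
    by rewrite mulrCA mulrA.
  by rewrite mulrC; apply: ler_wpM2r PN; rewrite mulr_ge0 ?expR_ge0.
move=> h; apply: (@le_trans _ _ (expR (-1) * (64 * expR 1))).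
  by rewrite mulrCA -expRD addNr expR0 mulr1.
by apply: ler_wpM2l; rewrite ?expR_ge0 // (le_trans h) // lerDr.
Qed.

Lemma tree_mass : exists off h, 64 * 2 ^+ P <= mass d x off h.
Proof.
have [h1 hP [sp y64]] := first_phase.
(* The spliced rule agrees with the unrestricted one below [h1], so the ratio and the mass reached
   there carry over. *)
pose off h k := (h < h1)%N || (k == 2)%N.
have eoff h' k : (h' < h1)%N -> off h' k = all_off h' k by rewrite /off => ->.
have eF h : (h <= h1)%N -> tree_weight d off x h = tree_weight d all_off x h.
  by move=> hh; apply: eq_tree_weight => h' k h'h; apply: eoff; exact: leq_trans hh.
have Nx4 : 4^-1 <= N * x.
  apply: le_trans Nxe; rewrite expRN lef_pV2 ?posrE ?expR_gt0 //; exact: expR1_le4.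
suff all j : (j <= P)%N -> spread d x off (h1 + j) /\ 64 * 2 ^+ j <= mass d x off (h1 + j).
  by exists off, (h1 + P)%N; have [] := all P (leqnn P).
elim: j => [|j IH] jP.
  rewrite addn0 expr0 mulr1; split; last by rewrite /mass eF.
  move=> h' s hh; have := sp h' s hh; rewrite !eF ?(ltnW hh) //.
  by rewrite (eq_bigl (fun A : {set dir d} => off h' #|A| && (s \in A))) // => A; rewrite eoff.
have [spj lo] := IH (ltnW jP).
have oh k : off (h1 + j)%N k = (k == 2)%N by rewrite /off ltnNge leq_addr.
have hh : 2 ^+ 18 * (h1 + j).*2.+1%:R <= N.
  by apply: height; rewrite mul2n -addnn leq_add // ltnW.
rewrite addnS; split; first exact: pair_spread hh NN.
apply: le_trans (pair_growth _ _ oh spj hh NN Nx4 _) => //.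
  by rewrite exprS mulrCA; apply: ler_wpM2l.
by apply: le_trans lo; rewrite ler_peMr // exprn_ege1 // ler1n.
Qed.
End Mass.

(** The power 5 exceeds by one the degree 4 in N of the upper bound for the mass in [rate_lower]. *)
Lemma pow2_ge_pow5 (R : realFieldType) P : (P.+1%:R / 5) ^+ 5 <= 2 ^+ P :> R.
Proof.
pose m := (P %/ 5)%N; have em := divn_eq P 5; have rm := ltn_pmod P (isT : (0 < 5)%N).
apply: (@le_trans _ _ (m.+1%:R ^+ 5)).
  apply: lerXn2r; rewrite ?nnegrE ?divr_ge0 ?ler0n // ler_pdivrMr //.
  by rewrite -[5]/(5%:R) -natrM ler_nat; lia.
apply: (@le_trans _ _ ((2 ^+ m) ^+ 5)); last first.
  by rewrite -exprM; apply: ler_weXn2l; [rewrite ler1n|rewrite /m; lia].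
apply: lerXn2r; rewrite ?nnegrE ?exprn_ge0 ?ler0n //.
by rewrite -natrX ler_nat; exact: ltn_expl.
Qed.

(** * Site-interfaces as finite vertex sets *)

Section Components.
Local Open Scope classical_set_scope.
Local Open Scope ring_scope.
Variable d : nat.
Notation V := 'rV[int]_d.
Notation dir := (dir d).
Implicit Types (F : set (set V)) (x y z : V).

Lemma adjP (v w : V) : reflect (exists s, w = v + stp s) (adj v w).
Proof.
apply: (iffP eqP) => [h|[s ->]].
  have [|s e] := @sqr_sum1 d (v - w).
    by rewrite -h; apply: eq_bigr => i _; rewrite !mxE.
  by exists (opd s); rewrite stp_opd -e opprB addrC subrK.
rewrite -(stp_sqr s); apply: eq_bigr => i _.
by rewrite mxE opprD addrA subrr sub0r sqrrN.
Qed.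

Lemma adj_stp (v : V) s : adj v (v + stp s).
Proof. by apply/adjP; exists s. Qed.

Lemma adj_sym (v w : V) : adj v w = adj w v.
Proof. by apply/adjP/adjP => -[s ->]; exists (opd s); rewrite stpD_opd. Qed.

Lemma set2_eq (a b c e : V) : [set a; b] = [set c; e] ->
  (a = c /\ b = e) \/ (a = e /\ b = c).
Proof.
move=> h.
have ha : [set c; e] a by rewrite -h; left.
have hb : [set c; e] b by rewrite -h; right.
have hc : [set a; b] c by rewrite h; left.
have he : [set a; b] e by rewrite h; right.
case: ha hb hc he => /= -> [] /= -> [] /= hc [] /= he; subst; by [left|right].
Qed.

Lemma adj_minus_sym F x y : adj_minus F x y = adj_minus F y x.
Proof. by rewrite /adj_minus adj_sym setUC. Qed.

Lemma component_refl F x : component F x x.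
Proof. by exists [::]. Qed.

Lemma component_step F x y z : component F x y -> adj_minus F y z -> component F x z.
Proof.
move=> [p px py] yz; exists (rcons p z); last by rewrite last_rcons.
by rewrite rcons_path px py.
Qed.

Lemma component_ind F x (K : V -> Prop) : K x ->
  (forall y z, component F x y -> K y -> adj_minus F y z -> K z) ->
  forall y, component F x y -> K y.
Proof.
move=> Kx cl y [p]; elim/last_ind: p y => [|p z IH] y /=; first by move=> _ <-.
rewrite rcons_path last_rcons => /andP[px yz] <-.
by apply: cl yz; [exists p|exact: IH px _].
Qed.

Lemma component_trans F x y z : component F x y -> component F y z -> component F x z.
Proof.
by move=> xy; apply: component_ind => // u v _ ? ?; apply: component_step; eassumption.
Qed.

Lemma component_sym F x y : component F x y -> component F y x.
Proof.
move: y; apply: component_ind; first exact: component_refl.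
move=> y z _ yx yz; apply: component_trans yx.
by apply: component_step (component_refl _ _) _; rewrite adj_minus_sym.
Qed.

Lemma component_eq F x y : component F x y -> component F y = component F x.
Proof.
move=> xy; apply/seteqP; split => z; last by apply: component_trans; exact: component_sym.
exact: component_trans.
Qed.

Lemma path_component F x p y : path (adj_minus F) x p -> y \in x :: p -> component F x y.
Proof.
move=> px; rewrite inE => /predU1P[->|]; first exact: component_refl.
move=> yp; case/splitPr: yp px => p1 p2; rewrite cat_path /= => /and3P[h1 h2 _].
by apply: component_step h2; exists p1.
Qed.

Lemma path_edges_sub (A : set V) x p e : A x -> (forall y, y \in p -> A y) ->
  path_edges x p e -> e `<=` A.
Proof.
elim: p x => [|y p IH] x Ax Ap //= [-> z [->|->] //|]; first by apply: Ap; rewrite inE eqxx.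
by apply: IH => [|z zp]; apply: Ap; rewrite inE ?eqxx ?zp ?orbT.
Qed.

Definition square w (s t : dir) : set (set V) :=
  [set e | [\/ e = [set w; w + stp s], e = [set w; w + stp t],
     e = [set w + stp s; w + stp s + stp t] | e = [set w + stp t; w + stp s + stp t]]].

Lemma stp_neq w (s : dir) : w + stp s <> w.
Proof. by rewrite -[RHS]addr0 => /addrI/eqP; rewrite (negPf (stp_neq0 _)). Qed.

Lemma stp2_neq w (s t : dir) : perp s t -> w + stp s + stp t <> w.
Proof.
move=> st; rewrite -{2}(stpD_opd w s) => /addrI/stp_inj e.
by rewrite e perp_opr /perp eqxx in st.
Qed.

Lemma stp_perp_neq w (s t : dir) : perp s t -> w + stp s <> w + stp t.
Proof. by move=> st /addrI/stp_inj e; rewrite e /perp eqxx in st. Qed.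

Lemma square_four_cycle w s t : perp s t -> four_cycles d (square w s t).
Proof.
move=> st; exists w, (w + stp s), (w + stp s + stp t), (w + stp t); split.
- have ts : perp t s by rewrite perp_sym.
  rewrite /= !inE !negb_or !andbT; apply/and3P; split; [apply/and3P; split|apply/andP; split|].
  + by apply/eqP => /esym /stp_neq.
  + by apply/eqP => /esym /(stp2_neq st).
  + by apply/eqP => /esym /stp_neq.
  + by apply/eqP => /esym /stp_neq.
  + by apply/eqP => /(stp_perp_neq st).
  + by apply/eqP; rewrite addrAC => /stp_neq.
- rewrite !adj_stp /= (adj_sym _ w) adj_stp andbT adj_sym.
  by rewrite (addrAC w) adj_stp.
- apply/seteqP; split => e /=; case=> ->.
  + exact: Or41. + by apply: Or44; rewrite setUC. + exact: Or42.
  + by apply: Or43; rewrite setUC.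
  + exact: Or41. + exact: Or43. + by apply: Or44; rewrite setUC.
  + by apply: Or42; rewrite setUC.
Qed.

Lemma square_sym w s t : square w s t = square w t s.
Proof.
apply/seteqP; split => e [] ->; [exact: Or42|exact: Or41|apply: Or44|apply: Or43
 |exact: Or42|exact: Or41|apply: Or44|apply: Or43]; by rewrite (addrAC w).
Qed.

Lemma square_opp w s t : square w s t = square (w + stp s) (opd s) t.
Proof.
apply/seteqP; split => e [] ->; [apply: Or41|apply: Or43|apply: Or42|apply: Or44
 |apply: Or41|apply: Or43|apply: Or42|apply: Or44];
 by rewrite ?stpD_opd // setUC // addrAC stpD_opd // addrAC.
Qed.

Lemma square_edge a s t w r : perp s t -> [set w; w + stp r] = [set a; a + stp s] ->
  exists2 t', perp r t' & square a s t = square w r t'.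
Proof.
move=> st /set2_eq [] [-> e]; exists t.
- by move: e => /addrI/stp_inj ->.
- by move: e => /addrI/stp_inj ->.
- by move: e; rewrite -[RHS](stpD_opd a s) => /addrI/stp_inj ->.
- by move: e; rewrite -[RHS](stpD_opd a s) => /addrI/stp_inj ->; rewrite square_opp.
Qed.

(** The four steps round the cycle add up to 0 without backtracking, so [stp_sum4] makes it a
    square; the symmetries of squares then move the base point to the given edge. *)
Lemma four_cycle_square (E : set (set V)) w s : four_cycles d E -> E [set w; w + stp s] ->
  exists2 t, perp s t & E = square w s t.
Proof.
move=> [a [b [c [f [ua /and4P[/adjP[s1 eb] /adjP[t1 ec] /adjP[s2 ef] /adjP[t2 ea]] eE]]]]].
move: ua; rewrite /= !inE !negb_or !andbT => /and3P[/and3P[ab ac af] /andP[bc bf] cf].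
have [|||[p1 e2 e3]] := @stp_sum4 d s1 t1 s2 t2.
- by apply: (@addrI _ a); rewrite addr0 !addrA -eb -ec -ef -ea.
- by apply/eqP => e; move: ac; rewrite ec eb e stpD_opd eqxx.
- by apply/eqP => e; move: bf; rewrite ef ec e stpD_opd eqxx.
have {}eE : E = square a s1 t1.
  rewrite eE; apply/seteqP; split => e /=; rewrite ef ec eb e2 (addrAC _ _ (stp (opd s1))) ?stpD_opd.
  + by case=> ->; [exact: Or41|exact: Or43|apply: Or44; rewrite setUC|apply: Or42; rewrite setUC].
  + by case=> ->; [exact: Or41|apply: Or44; rewrite setUC|exact: Or42|apply: Or43; rewrite setUC].
have p1' : perp t1 s1 by rewrite perp_sym.
rewrite {}eE => -[] h.
- exact: square_edge h.
- by rewrite square_sym; apply: square_edge h.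
- rewrite square_opp square_sym; apply: square_edge h.
  by rewrite perp_opr.
- rewrite square_sym square_opp square_sym; apply: (@square_edge (a + stp t1)); first by [].
  by rewrite h (addrAC a).
Qed.
End Components.

(** * [P]-paths as links, and V(P) as the rim *)

Section Bridge.
Local Open Scope classical_set_scope.
Local Open Scope ring_scope.
Variable d : nat.
Notation V := 'rV[int]_d.
Notation dir := (dir d).
Implicit Types (F : set (set V)) (x y z : V) (D : {fset V}).
Variables i0 i1 i2 : 'I_d.
Hypotheses (i01 : i0 != i1) (i02 : i0 != i2) (i12 : i1 != i2).

Definition boundary D : set (set V) :=
  [set e | exists2 a, in_bdry D a & e = [set a.1 + stp a.2; a.1]].

Definition darrow (a : V * dir) : V * V := (a.1 + stp a.2, a.1).

Definition inner_edges D : set (set V) :=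
  [set f | component_edges (boundary D) [set` D] f /\
           Ppath_connects_edge (boundary D) f (directed_into (boundary D) [set` D])].

Lemma boundary_edge D x s : boundary D [set x; x + stp s] <-> (x \in D) != (x + stp s \in D).
Proof.
split.
- move=> [[w t] /andP[/= wD wtD]] /set2_eq [] [-> ->]; by rewrite wD (negPf wtD).
- case xD: (x \in D); case xsD: (x + stp s \in D) => // _.
    by exists (x, s); rewrite /in_bdry /= ?xD ?xsD // setUC.
  by exists (x + stp s, opd s); rewrite /in_bdry /= stpD_opd ?xD ?xsD.
Qed.

Lemma boundary_darrow D a : in_bdry D a -> boundary D [set (darrow a).1; (darrow a).2].
Proof. by exists a. Qed.

Lemma adj_minus_boundary D x y : adj_minus (boundary D) x y -> (x \in D) = (y \in D).
Proof.
move=> /andP[/adjP[s ->]] /negP h; apply/eqP; apply/negPn/negP => ne; apply: h.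
by rewrite inE; apply/boundary_edge.
Qed.

Lemma adj_minus_in D x s : x \in D -> x + stp s \in D -> adj_minus (boundary D) x (x + stp s).
Proof.
move=> xD xsD; rewrite /adj_minus adj_stp; apply/negP; rewrite inE => /boundary_edge.
by rewrite xD xsD.
Qed.

Lemma component_boundary_sub D x y : component (boundary D) x y -> (x \in D) = (y \in D).
Proof. by move: y; apply: component_ind => // y z _ -> /adj_minus_boundary. Qed.

Lemma component_boundary D x : vertex_connected D -> x \in D ->
  component (boundary D) x = [set` D].
Proof.
move=> cD xD; apply/seteqP; split => y /=; first by move=> /component_boundary_sub <-.
apply: (cD (fun y => component (boundary D) x y) x) => //; first exact: component_refl.
by move=> z s zD zsD xz; apply: component_step xz _; exact: adj_minus_in.
Qed.

Lemma directed_into_boundary D a :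
  directed_into (boundary D) [set` D] a <-> exists2 b, in_bdry D b & a = darrow b.
Proof.
split; last by move=> [b bD ->]; split; [exact: boundary_darrow|case/andP: bD].
case: a => v w [[[x s] xJ] /= + wD]; move=> /set2_eq [] [e1 e2].
  by exists (x, s) => //; rewrite e1 e2.
by case/andP: xJ => _; rewrite /= -e2 wD.
Qed.

Lemma square_in w s t e x : square w s t e -> e x ->
  [\/ x = w, x = w + stp s, x = w + stp t | x = w + stp s + stp t].
Proof.
by case=> -> [] /= ->; do ?[exact: Or41 | exact: Or42 | exact: Or43 | exact: Or44].
Qed.

Lemma square_rim D w s t e x : in_bdry D (w, s) -> perp s t -> square w s t e -> e x ->
  x \in D -> x \in rim D.
Proof.
move=> /andP[/= wD wsD] st sq ex xD.
case: (square_in sq ex) xD => -> xD.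
- exact: rim_head wsD.
- by rewrite xD in wsD.
- exact: rim_perp wsD st xD.
- exact: rim_opp wsD xD.
Qed.

Lemma link_Ppath D a b : in_bdry D a -> in_bdry D b -> link D a b ->
  Ppath_connects (boundary D) (darrow a) (darrow b).
Proof.
case: a b => [w s] [w' s'] aD bD; have := bD; have := aD => /andP[/= wD wsD] /andP[/= wD' wsD'].
have bnd p : (forall y, y \in p -> y \in D) ->
    ~ path_edges w p [set w + stp s; w] /\ ~ path_edges w p [set w' + stp s'; w'].
  move=> pD; split => /(@path_edges_sub d [set` D] w p _ wD pD) h.
    by move: wsD; rewrite (h (w + stp s)) //; left.
  by move: wsD'; rewrite (h (w' + stp s')) //; left.
case=> /=.
- move=> [e st]; subst w'; exists [::]; split => //=; first by apply: (bnd [::]).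
  exists (square w s s'); first exact: square_four_cycle.
  by move=> e [] // [] ->; [apply: Or41|apply: Or42]; rewrite setUC.
- move=> [t st [e1 e2]]; subst w' s'; exists [:: w + stp t]; split => /=.
  + by rewrite adj_minus_in.
  + by rewrite inE andbT; apply/eqP => /esym/stp_neq.
  + by apply: (bnd [:: w + stp t]) => y; rewrite inE => /eqP ->.
  + exists (square w s t); first exact: square_four_cycle.
    move=> e [[] // ->|[] ->]; [exact: Or42|apply: Or41|apply: Or44]; rewrite setUC //.
    by rewrite (addrAC w).
- move=> [t st [tD [e1 e2]]]; subst w' s'; exists [:: w + stp t; w + stp s + stp t]; split => /=.
  + by rewrite adj_minus_in //= (addrAC w) adj_minus_in // addrAC.
  + rewrite !inE !andbT !negb_or; apply/andP; split; [apply/andP; split|].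
    * by apply/eqP => /esym/stp_neq.
    * by apply/eqP => /esym/(stp2_neq st).
    * by apply/eqP; rewrite (addrAC w) => /esym/stp_neq.
  + by apply: (bnd [:: w + stp t; w + stp s + stp t]) => y; rewrite !inE => /orP[]/eqP ->.
  + exists (square w s t); first exact: square_four_cycle.
    rewrite /darrow /= stpD_opd => e [[->|[->|//]]|[->|->]].
    * exact: Or42. * exact: Or44. * by apply: Or41; rewrite setUC. * exact: Or43.
Qed.

Lemma square_nbr w s t x y : perp s t -> square w s t [set x; y] ->
  [/\ x = w -> y = w + stp s \/ y = w + stp t,
      x = w + stp t -> y = w \/ y = w + stp s + stp t &
      x = w + stp s + stp t -> y = w + stp s \/ y = w + stp t].
Proof.
move=> st; have ts : perp t s by rewrite perp_sym.
have n1 := @stp_neq d w s; have n2 := @stp_neq d w t; have n3 := stp2_neq (w := w) st.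
have n4 := stp_perp_neq (w := w) st; have n5 := @stp_neq d (w + stp s) t.
have n6 : w + stp s + stp t <> w + stp t by rewrite (addrAC w); exact: stp_neq.
by case=> /set2_eq [] [-> ->]; split => // e; (exfalso; congruence) || (by left) || (by right) ||
  exfalso; apply: n1; congruence.
Qed.

(** The path stays in [D] and on a 4-cycle through w + s and w, and it cannot visit w + s. So it
    runs along w, w + t, w + s + t and has at most two edges, one case for each constructor of
    [link]. *)
Lemma Ppath_link D a b : in_bdry D a -> in_bdry D b ->
  Ppath_connects (boundary D) (darrow a) (darrow b) -> a = b \/ link D a b.
Proof.
case: a b => [w s] [w' s'] aD bD; have := bD; have := aD => /andP[/= wD wsD] /andP[/= wD' wsD'].
move=> [p [[/= pp lp] up _ [E E4 EE]]].
have [t st eE] : exists2 t, perp s t & E = square w s t.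
  by apply: four_cycle_square => //; rewrite setUC; apply: EE; right; left.
rewrite eE in EE.
have pD y : y \in w :: p -> y \in D.
  by move=> /(path_component pp) /component_boundary_sub <-.
have hb : square w s t [set w'; w' + stp s'] by rewrite setUC; apply: EE; right; right.
have he e : path_edges w p e -> square w s t e by move=> h; apply: EE; left.
have st' : perp t s by rewrite perp_sym.
case: p lp up pD he {pp EE} => [|y [|y' [|y'' p]]] /=.
- move=> e _ _ _; subst w'; have [h _ _] := square_nbr st hb.
  case: (h erefl) => /addrI/stp_inj ->; first by left.
  by right; apply: Or31.
- move=> e; subst y => _ pD he.
  have [h _ _] := square_nbr st (he _ (or_introl erefl)).
  case: (h erefl) => e; first by rewrite e (negPf wsD) in wD'.
  have [_ h2 _] := square_nbr st hb.
  case: (h2 e) => e2; first by rewrite e2 wD in wsD'.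
  right; apply: Or32; exists t => //=.
  by move: e2; rewrite e (addrAC w (stp s)) => /addrI/stp_inj ->.
- move=> e; subst y' => up pD he.
  have yD : y \in D by apply: pD; rewrite !inE eqxx orbT.
  have [h _ _] := square_nbr st (he _ (or_introl erefl)).
  case: (h erefl) => e; first by rewrite e (negPf wsD) in yD.
  have [_ h2 _] := square_nbr st (he _ (or_intror (or_introl erefl))).
  case: (h2 e) => e2; first by move: up; rewrite e2 !inE eqxx orbT.
  have [_ _ h3] := square_nbr st hb.
  case: (h3 e2) => e3; last by move: wsD'; rewrite e3 -e yD.
  right; apply: Or33; exists t => //=; split; first by rewrite -e.
  congr (_, _) => //; move: e3; rewrite e2 -[in RHS](stpD_opd (w + stp s) t).
  by move=> /addrI/stp_inj.
- move=> _ up pD he.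
  have yD : y \in D by apply: pD; rewrite !inE eqxx orbT.
  have yD'' : y'' \in D by apply: pD; rewrite !inE eqxx !orbT.
  have [h _ _] := square_nbr st (he _ (or_introl erefl)).
  case: (h erefl) => e; first by rewrite e (negPf wsD) in yD.
  have [_ h2 _] := square_nbr st (he _ (or_intror (or_introl erefl))).
  case: (h2 e) => e2; first by move: up; rewrite e2 !inE eqxx !orbT.
  have [_ _ h3] := square_nbr st (he _ (or_intror (or_intror (or_introl erefl)))).
  case: (h3 e2) => e3; first by move: yD''; rewrite e3 (negPf wsD).
  by move: up; rewrite e3 -e !inE eqxx !orbT /= andbF.
Qed.

Lemma F_connected_bdry D :
  F_connected (boundary D) (directed_into (boundary D) [set` D]) <-> bdry_connected D.
Proof.
split=> [FD K [a aD Ka] cl b bD|JD J1 J2 JU JI [a Ja] [b Jb]].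
- apply: contrapT => nKb.
  (* A property closed under links and its negation would split the directed edges into two parts
     that no [P]-path connects. *)
  pose J (P : V * dir -> Prop) : set (V * V) :=
    [set u | exists c, [/\ in_bdry D c, P c & u = darrow c]].
  have [||||u [v [[c [cD Kc ->]] [c' [cD' nKc' ->]] pp]]] := FD (J K) (J (fun c => ~ K c)).
  + apply/seteqP; split => u /=.
      by case=> -[c [cD _ ->]]; apply/directed_into_boundary; exists c.
    move=> /directed_into_boundary [c cD ->].
    by have [Kc|nKc] := pselect (K c); [left|right]; exists c.
  + apply/seteqP; split => u //= -[[c [cD Kc ->]] [c' [cD' nKc' [e1 e2]]]].
    apply: nKc'; suff -> : c' = c by [].
    case: c c' {cD cD' Kc} e1 e2 => [x s] [x' s'] /= + e; rewrite e => /addrI/stp_inj ->.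
    by [].
  + by exists (darrow a), a.
  + by exists (darrow b), b.
  have [e|lk] := Ppath_link cD cD' pp; first by apply: nKc'; rewrite -e.
  by apply: nKc'; exact: cl lk.
- apply: contrapT => nex.
  have JE u : (J1 `|` J2) u <-> exists2 c, in_bdry D c & u = darrow c.
    by rewrite JU; exact: directed_into_boundary.
  have [[c cD ec] [c' cD' ec']] : (exists2 c, in_bdry D c & a = darrow c) /\
      (exists2 c, in_bdry D c & b = darrow c) by split; apply/JE; [left|right].
  have : J1 (darrow c').
    apply: (JD (fun c => J1 (darrow c))) cD'; first by exists c => //; rewrite -ec.
    move=> e e' eD eD' Je lk; apply: contrapT => nJ; apply: nex.
    exists (darrow e), (darrow e'); split => //; last exact: link_Ppath.
    by have [|//] : (J1 `|` J2) (darrow e') by apply/JE; exists e'.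
  rewrite -ec' => Jb'; have : (J1 `&` J2) b by [].
  by rewrite JI.
Qed.

Lemma Ppath_pair F (w : V) s t : perp s t ->
  Ppath_connects F (w + stp t, w) (w + stp s, w).
Proof.
move=> st; exists [::]; split => //=; first by split.
exists (square w s t); first exact: square_four_cycle.
by move=> e [] // [] ->; [apply: Or42|apply: Or41]; rewrite setUC.
Qed.

Lemma Ppath_edge_pair F (D : set V) (w : V) s t : perp s t -> D w -> F [set w; w + stp s] ->
  Ppath_connects_edge F [set w; w + stp t] (directed_into F D).
Proof.
move=> st wD Fs; exists (w + stp t), w; split; first by rewrite setUC.
by exists (w + stp s, w); [split; rewrite //= setUC|exact: Ppath_pair].
Qed.

Lemma inner_edges_pair D w s t : perp s t -> w \in D -> w + stp t \in D -> w + stp s \notin D ->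
  inner_edges D [set w; w + stp t].
Proof.
move=> st wD tD sD; split.
  split; first by exists w, (w + stp t); rewrite adj_stp.
    by move/boundary_edge; rewrite wD tD.
  by move=> x [] ->.
by apply: (@Ppath_edge_pair _ _ _ s) => //; apply/boundary_edge; rewrite wD (negPf sD).
Qed.

Lemma connected_nbr D x : vertex_connected D -> (1 < #|` D|)%N -> x \in D ->
  exists s, x + stp s \in D.
Proof.
move=> cD D2 xD; apply: contrapT => ns.
have : (#|` D| <= #|` [fset x]%fset|)%N.
  apply: fsubset_leq_card; apply/fsubsetP.
  apply: (cD (fun y => y \in [fset x]%fset) x) => //; first by rewrite inE.
  move=> y s yD ysD; rewrite inE => /eqP e; case: ns; exists s; by rewrite -e.
by rewrite cardfs1 leqNgt D2.
Qed.

(** The size condition matters: a single vertex is its own rim but is incident with no edge of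
    [P]. *)
Lemma vertices_of_inner D : vertex_connected D -> (1 < #|` D|)%N ->
  vertices_of (inner_edges D) = [set` rim D].
Proof.
move=> cD D2; apply/seteqP; split => x /=.
- move=> [f [[_ _ fD] [v [w [ef [b /directed_into_boundary [[y s] yD ->]]]]]]].
  move=> [p [_ _ _ [E E4 EE]]] fx; subst f.
  have [t st eE] : exists2 t, perp s t & E = square y s t.
    by apply: four_cycle_square => //; rewrite setUC; apply: EE; right; right.
  apply: (square_rim yD st _ fx); last exact: fD.
  by rewrite -eE; apply: EE; right; left.
- rewrite in_rim => /andP[xD /orP[/existsP[s xsD]|/existsP[s /andP[sD /existsP[t /andP[st tD]]]]]].
  + have [t tD] := connected_nbr cD D2 xD.
    have [st|/negPn/eqP st] := boolP (perp s t).
      by exists [set x; x + stp t]; [exact: inner_edges_pair xsD|left].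
    (* The neighbour found lies on the axis of the boundary edge. A perpendicular direction u helps
       in either case: x + u is a suitable neighbour, or it is the tail of a suitable boundary
       edge. *)
    have [u su _] := third i01 i02 i12 s s.
    have [uD|uD] := boolP (x + stp u \in D).
      by exists [set x; x + stp u]; [exact: inner_edges_pair xsD|left].
    exists [set x; x + stp t]; last by left.
    by apply: inner_edges_pair uD => //; rewrite /perp -st eq_sym.
  + exists [set x + stp s; x]; last by right.
    rewrite -{2}(stpD_opd x s); apply: inner_edges_pair tD => //; last by rewrite stpD_opd.
    by rewrite perp_sym.
Qed.
End Bridge.

(** * The correspondence between site-interfaces and vertex sets *)

Section Sites.
Local Open Scope classical_set_scope.
Local Open Scope ring_scope.
Variable d : nat.
Notation V := 'rV[int]_d.
Notation dir := (dir d).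
Implicit Types (F : set (set V)) (x y z : V) (D : {fset V}).
Definition enclosed D : Prop := finite_set (component (boundary D) 0).

Lemma ray_coord x (s : dir) k :
  (-1) ^+ s.2 * (x + stp s *+ k) ord0 s.1 = (-1) ^+ s.2 * x ord0 s.1 + k%:Z.
Proof.
rewrite mxE mulrDr; congr +%R; elim: k => [|k IH]; first by rewrite mulr0n mxE mulr0.
rewrite mulrSr mxE mulrDr IH stpE eqxx -exprD addnn -mul2n exprM sqrrN !expr1n.
by rewrite -addn1 PoszD.
Qed.

(** Otherwise the component would contain the entire ray, along which a coordinate is unbounded. *)
Lemma ray_infinite F x s : finite_set (component F x) ->
  exists k, F [set x + stp s *+ k; x + stp s *+ k.+1].
Proof.
move=> fin; apply: contrapT => nF.
have all_in k : component F x (x + stp s *+ k).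
  elim: k => [|k IH]; first by rewrite addr0; exact: component_refl.
  apply: component_step IH _; rewrite mulrSr addrA /adj_minus adj_stp /=.
  by apply/negP; rewrite inE => h; apply: nF; exists k; rewrite mulrSr addrA.
have ne : fset_set (component F x) != fset0.
  by apply/fset0Pn; exists x; rewrite in_fset_set // inE; exact: component_refl.
pose f (y : V) : int := (-1) ^+ s.2 * y ord0 s.1.
have [w _ wm] := fset_argmax f ne.
pose k := `|f w - f x|%N.+1.
have := wm (x + stp s *+ k); rewrite in_fset_set // inE /f ray_coord -!/(f _).
by move=> /(_ (all_in k)); rewrite /k; move: (f x) (f w) => p q; lia.
Qed.

Lemma card_eq_fset (A : {fset V}) n : ([set` A] #= `I_n)%card -> #|` A| = n.
Proof. by move=> /card_fset_set; rewrite set_fsetK. Qed.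

Lemma fset_card_eq (A : {fset V}) : ([set` A] #= `I_(#|` A|))%card.
Proof.
have [m Am] : exists m, ([set` A] #= `I_m)%card by apply/finite_setP; exact: finite_fset.
by rewrite (card_eq_fset Am).
Qed.

Variables i0 i1 i2 : 'I_d.
Hypotheses (i01 : i0 != i1) (i02 : i0 != i2) (i12 : i1 != i2).

(** Every endvertex in [C] of an edge of [dP] turns out to lie in V(P). By the site condition no
    edge of [dP] has both ends in [C], so [dP] is exactly the edge boundary of [C]. *)
Lemma site_interface_fset P dP n : is_site_interface P dP ->
  (vertices_of P #= `I_n)%card -> (0 < n)%N ->
  exists D, [/\ good D, (1 < #|` D|)%N, enclosed D, #|` rim D| = n &
    P = inner_edges D /\ dP = boundary D].
Proof.
move=> [[[PL dPL] fin0 [C [[[[x0 eC] finC meet] uC] FC eP]]] site] cP n0.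
pose D := fset_set C; have eD : [set` D] = C by rewrite fset_setK.
have inD y : (y \in D) <-> C y by rewrite -eD.
have [f Pf] : exists f, P f.
  apply: contrapT => nP; have P0 : vertices_of P = set0.
    by apply/seteqP; split => // y [f Pf _]; apply: nP; exists f.
  by move: cP; rewrite P0 card_eq_sym card_eq0 => /eqP/seteqP[/(_ 0%N)] /(_ n0).
have cl y s : C y -> ~ dP [set y; y + stp s] -> C (y + stp s).
  rewrite eC => Cy nd; apply: component_step Cy _; rewrite /adj_minus adj_stp /=.
  by apply/negP; rewrite inE.
have fC g : P g -> [/\ lattice_edges d g, ~ dP g & g `<=` C] by rewrite eP => -[].
have head w s : C w -> dP [set w; w + stp s] -> vertices_of P w.
  move=> Cw ds.
  have core r t : perp r t -> dP [set w; w + stp r] -> ~ dP [set w; w + stp t] ->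
      vertices_of P w.
    move=> rt dr nt; exists [set w; w + stp t]; last by left.
    rewrite eP; split; last exact: Ppath_edge_pair dr.
    split=> //; first by exists w, (w + stp t); rewrite adj_stp.
    by move=> y [] ->; [|exact: cl].
  (* Otherwise [C] would consist of w alone, with no room for the edge f of [P]. *)
  have [t nt] : exists t, ~ dP [set w; w + stp t].
    apply: contrapT => nt.
    have Cw1 : C `<=` [set w].
      have -> : C = component dP w by rewrite eC; apply/esym/component_eq; rewrite -eC.
      apply: component_ind => // y z _ -> /andP[/adjP[r ->]] /negP; rewrite inE => nr.
      by case: nt; exists r.
    have [[u [v [/adjP[r ->] ef]]] _ fsub] := fC f Pf.
    have eu : u = w by apply/Cw1/fsub; rewrite ef; left.
    have : u + stp r = w by apply/Cw1/fsub; rewrite ef; right.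
    by rewrite -eu => /stp_neq.
  have [st|/negPn/eqP st] := boolP (perp s t); first exact: core st ds nt.
  have [u su _] := third i01 i02 i12 s s.
  have [du|ndu] := pselect (dP [set w; w + stp u]); last exact: core su ds ndu.
  by apply: (core u t) => //; rewrite /perp -st eq_sym.
have dPE : dP = boundary D.
  apply/seteqP; split => e.
    move=> de; have [w [ew Cw]] := meet _ de.
    have [u [v [/adjP[r ev] ee]]] := dPL _ de.
    have key a s : C a -> e = [set a; a + stp s] -> boundary D e.
      move=> Ca ea; rewrite ea; apply/boundary_edge.
      have -> : a \in D by apply/inD.
      apply/negP => /eqP/esym/inD Cs; apply: (site _ de); rewrite ea => y [] ->.
        by apply: (head _ s Ca); rewrite -ea.
      by apply: (head _ (opd s) Cs); rewrite stpD_opd setUC -ea.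
    have : [set u; v] w by rewrite -ee.
    move=> -[] /= ewu; rewrite ewu in Cw.
      by apply: (key u r) => //; rewrite ee ev.
    by apply: (key v (opd r)) => //; rewrite ee ev stpD_opd setUC.
  move=> [[w s] /andP[/= /inD Cw wsD] ->]; rewrite setUC; apply: contrapT => nd.
  by move/negP: wsD; apply; apply/inD; exact: cl.
have ePI : P = inner_edges D by rewrite /inner_edges eD -dPE.
have vD : vertex_connected D.
  move=> K x xD Kx Kcl y yD.
  have : component dP x y.
    have -> : component dP x = C by rewrite eC; apply: component_eq; rewrite -eC; apply/inD.
    exact/inD.
  move: y {yD}; apply: component_ind => // y z xy Ky.
  rewrite dPE => yz; have yD : y \in D.
    by rewrite -(@component_boundary_sub _ D x) // -dPE.
  have zD : z \in D by rewrite -(adj_minus_boundary yz).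
  by move: yz zD => /andP[/adjP[r ->] _] zD; exact: Kcl.
have D2 : (1 < #|` D|)%N.
  have [[u [v [/adjP[r ->] ef]]] _ fsub] := fC f Pf.
  have : (#|` (u |` [fset (u + stp r)%R])%fset| <= #|` D|)%N.
    apply: fsubset_leq_card; apply/fsubsetP => y; rewrite !inE => /orP[]/eqP->; apply/inD/fsub; rewrite ef.
      by left.
    by right.
  by rewrite cardfsU1 cardfs1 inE; case: eqP => // /esym /stp_neq.
exists D; split => //.
- split=> //; apply/F_connected_bdry; by rewrite eD -dPE.
- by rewrite /enclosed -dPE.
- by apply: card_eq_fset; rewrite -(vertices_of_inner i01 i02 i12) // -ePI.
Qed.

(** A component disjoint from [D] that meets every boundary edge contains the vertex above a highest
    vertex of [D]; the ray upwards from there meets no boundary edge, so the component is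
    infinite. *)
Lemma fset_finite_component D : good D -> D != fset0 ->
  unique (finite_component_meeting (boundary D)) [set` D].
Proof.
move=> [vD _] D0; have [x xD] := fset0Pn _ D0; split.
  split; [|exact: finite_fset|].
    by exists x; rewrite component_boundary.
  by move=> e [[w s] /andP[wD _] ->]; exists w; split; [right|].
move=> C [[y eC] finC meet].
have [ex|nex] := pselect (exists2 z, C z & z \in D).
  have [z Cz zD] := ex; rewrite -(component_boundary vD zD) eC.
  by apply: component_eq; rewrite -eC.
have [w [wD wm _ _]] := extreme_exists i01 i02 i12 false D0.
have up0 : w + stp (up i0) \notin D.
  by apply/negP => /wm; rewrite up_coord !expr0 !mul1r; clia.
have Cw : C (w + stp (up i0)).
  have [] := meet [set w + stp (up i0); w].
    by exists (w, up i0); rewrite // /in_bdry /= wD.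
  by move=> u [[] -> // Cw]; case: nex; exists w.
have fin : finite_set (component (boundary D) (w + stp (up i0))).
  by rewrite (@component_eq _ _ y) -eC.
have [k] := ray_infinite (up i0) fin.
have out j : w + stp (up i0) + stp (up i0) *+ j \notin D.
  apply/negP => /wm; have := ray_coord (w + stp (up i0)) (up i0) j.
  by rewrite /= !expr0 !mul1r up_coord; clia.
rewrite mulrSr addrA => /boundary_edge; rewrite (negPf (out k)).
by have := out k.+1; rewrite mulrSr addrA => /negPf ->.
Qed.

Lemma fset_site_interface D : good D -> (1 < #|` D|)%N -> enclosed D ->
  is_site_interface (inner_edges D) (boundary D) /\
  (vertices_of (inner_edges D) #= `I_(#|` rim D|))%card.
Proof.
move=> gD D2 enc; have [vD jD] := gD.
have D0 : D != fset0 by rewrite -cardfs_gt0 ltnW.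
split; last by rewrite (vertices_of_inner i01 i02 i12) //; exact: fset_card_eq.
split; last first.
  move=> e [[w s] /andP[/= wD wsD] ->]; rewrite (vertices_of_inner i01 i02 i12) // => h.
  by move: wsD; rewrite (@rim_sub _ D) //; apply: (h (w + stp s)); left.
split=> //; first split.
- by move=> f [[]].
- move=> e [[w s] _ ->]; exists (w + stp s), w; rewrite adj_sym adj_stp; by split.
exists [set` D]; split => //; first exact: fset_finite_component.
exact/F_connected_bdry.
Qed.

Definition fset_sites n : set {fset V} :=
  [set D | [/\ good D, enclosed D & #|` rim D| = n]].

Definition fset_interface D := (inner_edges D, boundary D).

Lemma fset_interface_inj n : (0 < n)%N -> {in fset_sites n &, injective fset_interface}.
Proof.
move=> n0 D D'; rewrite !inE => -[gD _ eD] [gD' _ eD'] [_ eb].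
have ne (E : {fset V}) : #|` rim E| = n -> E != fset0.
  move=> eE; apply: contraTneq n0 => E0; rewrite -eE lt0n negbK cardfs_eq0 E0.
  by apply/eqP/fsetP => x; rewrite !inE.
have [f1 _] := fset_finite_component gD (ne _ eD).
have [_ u] := fset_finite_component gD' (ne _ eD').
rewrite eb in f1; have e := u _ f1.
by apply/fsetP => x; have := congr1 (fun A : set V => A x) e => /= h; apply/idP/idP; rewrite h.
Qed.

(** At n = 1 the two sides differ: a single vertex has a rim of size 1 but gives an empty [P]. *)
Lemma site_interfacesE n : (1 < n)%N -> site_interfaces d n = fset_interface @` fset_sites n.
Proof.
move=> n1; apply/seteqP; split => -[P dP].
- move=> [/= si cP].
  have [D [gD D2 enc cr [eP edP]]] := site_interface_fset si cP (ltnW n1).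
  by exists D => //; rewrite /fset_interface eP edP.
- move=> [D [gD enc cr] [<- <-]].
  have D2 : (1 < #|` D|)%N.
    rewrite (leq_trans n1) // -cr; apply: fsubset_leq_card; apply/fsubsetP => x; exact: rim_sub.
  by have [h1 h2] := fset_site_interface gD D2 enc; split => //; rewrite /= -cr.
Qed.

Lemma cdotE n : (1 < n)%N -> finite_set (fset_sites n) ->
  cdot d n = #|` fset_set (fset_sites n)|.
Proof.
move=> n1 fin; have [m h] := (finite_setP (fset_sites n)).1 fin.
rewrite (card_fset_set h) /cdot site_interfacesE //; apply: card_fset_set.
by apply: card_eq_trans h; apply: inj_card_eq; apply: fset_interface_inj; exact: ltnW.
Qed.
End Sites.

(** * Counting *)

(* Every pair (A i, B i) occurs with probability p^n q^m at least in Bernoulli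
   percolation, so that at most k simultaneous occurrences bound their number. *)
Lemma percolation_count (R : realFieldType) (T I : finType) (A B : I -> {set T})
    (p : R) (n m k : nat) : 0 <= p <= 1 ->
  (forall i, [disjoint A i & B i]) -> (forall i, #|A i| = n) -> (forall i, (#|B i| <= m)%N) ->
  (forall w : {ffun T -> bool},
    (#|[pred i | [forall t in A i, w t] && [forall t in B i, ~~ w t]]| <= k)%N) ->
  #|I|%:R * (p ^+ n * (1 - p) ^+ m) <= k%:R.
Proof.
move=> /andP[p0 p1] dis cA cB occ.
have q0 : 0 <= 1 - p by rewrite subr_ge0.
pose wt (b : bool) : R := if b then p else 1 - p.
have wt0 b : 0 <= wt b by case: b.
pose W (w : {ffun T -> bool}) := \prod_t wt (w t).
pose o i (w : {ffun T -> bool}) := [forall t in A i, w t] && [forall t in B i, ~~ w t].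
have W1 : \sum_w W w = 1.
  rewrite -(bigA_distr_bigA (fun _ b => wt b)) big1 // => t _.
  by rewrite big_bool /wt /= addrC subrK.
have oE i : \sum_(w | o i w) W w = p ^+ n * (1 - p) ^+ #|B i|.
  pose g t (b : bool) : R := if (t \in A i) && ~~ b || (t \in B i) && b then 0 else wt b.
  rewrite big_mkcond /=.
  rewrite (eq_bigr (fun w : {ffun T -> bool} => \prod_t g t (w t))); last first.
    move=> w _; rewrite /o; case: ifP => [/andP[/forallP a /forallP b]|/negbT].
      apply: eq_bigr => t _; rewrite /g; have := a t; have := b t.
      by case: (t \in A i); case: (t \in B i); case: (w t).
    rewrite negb_and => /orP[]/forallPn[t]; rewrite negb_imply => /andP[h1 h2];
    by rewrite (bigD1 t) //= /g h1 ?h2 ?(negPn h2) ?orbT mul0r.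
  rewrite -(bigA_distr_bigA g).
  rewrite (bigID (mem (A i))) /=; congr (_ * _).
    rewrite -(cA i) -prodr_const; apply: eq_bigr => t tA.
    by rewrite big_bool /g tA /= addr0 (disjointFr (dis i) tA).
  rewrite (bigID (mem (B i))) /= [X in _ * X]big1 ?mulr1; last first.
    by move=> t /andP[/negPf tA /negPf tB]; rewrite big_bool /g tA tB /= addrC subrK.
  rewrite (eq_bigl (mem (B i))); last first.
    by move=> t; rewrite /=; case tB: (t \in B i); rewrite ?andbF ?andbT // (disjointFl (dis i)).
  rewrite -prodr_const; apply: eq_bigr => t /= tB.
  have {}tB : t \in B i by []; rewrite big_bool /g tB (disjointFl (dis i)) //=.
  by rewrite add0r.
have : \sum_i \sum_(w | o i w) W w <= k%:R.
  rewrite (exchange_big_dep xpredT) //= -[leRHS]mulr1 -[X in _ * X]W1 mulr_sumr.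
  apply: ler_sum => w _; rewrite sumr_const -[leLHS]mulr_natl.
  apply: ler_wpM2r; first by apply: prodr_ge0.
  by rewrite ler_nat; exact: occ.
apply: le_trans; rewrite mulr_natl -sumr_const; apply: ler_sum => i _.
rewrite oE; apply: ler_wpM2l; first exact: exprn_ge0.
by apply: ler_wiXn2l => //; rewrite gerBl.
Qed.

(** * The percolation bound on the number of sets *)

Section Counting.
Variable d : nat.
Notation V := 'rV[int]_d.
Notation dir := (dir d).
Implicit Types D : {fset V}.
Variable i0 : 'I_d.

Lemma enclosed_ray D (s : dir) : enclosed D ->
  exists2 a, in_bdry D a & exists2 k : nat, (a = (stp s *+ k, s) \/ a = (stp s *+ k.+1, opd s)) &
    k%:Z <= (-1) ^+ s.2 * a.1 ord0 s.1.
Proof.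
move=> enc; have [k] := ray_infinite s enc; rewrite !add0r mulrSr => /boundary_edge.
have rc j := ray_coord 0 s j.
case h: (_ \in D); case h': (_ \in D) => // _.
  exists (stp s *+ k, s); first by rewrite /in_bdry /= h h'.
  by exists k; [left|have := rc k; rewrite add0r /= => ->; rewrite mxE mulr0; lia].
exists (stp s *+ k.+1, opd s); first by rewrite /in_bdry /= mulrSr stpD_opd h h'.
by exists k; [right|have := rc k.+1; rewrite add0r /= => ->; rewrite mxE mulr0; lia].
Qed.

(** The boundary also meets the half-axis opposite to b, so the boundary extends at least |b_i|
    along coordinate i and [rim_span] applies. *)
Lemma site_span D i n b : fset_sites n D -> in_bdry D b -> (`|b.1 ord0 i| < n)%N.
Proof.
move=> [[_ jD] enc <-] bD; have [b0|b0] := leP 0 (b.1 ord0 i).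
  have [a aD [k _]] := enclosed_ray (i, true) enc; rewrite /= expr1 => ak.
  by apply: (rim_span (i := i) jD aD bD); clia.
have [a aD [k _]] := enclosed_ray (i, false) enc; rewrite /= expr0 => ak.
by apply: (rim_span (i := i) jD bD aD); clia.
Qed.

(** The ray may cross the boundary outwards or inwards; the flag records which. *)
Definition ray_arrow (s : dir) (u : nat * bool) : V * dir :=
  if u.2 then (stp s *+ u.1, s) else (stp s *+ u.1.+1, opd s).

Lemma site_ray_arrow D (s : dir) n : fset_sites n D ->
  exists u : 'I_n * bool, in_bdry D (ray_arrow s (val u.1, u.2)).
Proof.
move=> sD; have [_ enc _] := sD; have [a aD [k ea ka]] := enclosed_ray s enc.
have kn : (k < n)%N.
  have := site_span s.1 sD aD; move: ka; case: (s.2); rewrite ?expr0 ?expr1; clia.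
by case: ea => ea; [exists (Ordinal kn, true)|exists (Ordinal kn, false)]; rewrite /ray_arrow /= -ea.
Qed.

(** Sets that occur together are compatible, so they are equal once their chosen boundary edges on
    the axis agree; there are 2n choices. The statement concerns finite families because finiteness
    of the whole is derived from it. *)
Lemma fset_sites_bound (R : realType) n (X : {fset {fset V}}) :
  {subset X <= fset_sites n} ->
  (#|` X|)%:R * ((2 * d).+1%:R^-1 ^+ n * (1 - (2 * d).+1%:R^-1) ^+ (2 * d * n)) <= (n * 2)%:R :> R.
Proof.
move=> sX.
have gX (D : X) : fset_sites n (val D) by have := sX _ (valP D); rewrite inE.
pose S : {fset V} := (\bigcup_(D <- X) (rim D `|` outer D))%fset.
have inS (D : X) x : x \in (rim (val D) `|` outer (val D))%fset -> x \in S.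
  by move=> h; apply/bigfcupP; exists (val D) => //; rewrite (valP D).
pose A (D : X) : {set S} := [set t | val t \in rim (val D)].
pose B (D : X) : {set S} := [set t | val t \in outer (val D)].
have card_sub (E : {fset V}) : (E `<=` S)%fset -> #|[set t : S | val t \in E]| = #|` E|.
  move=> ES; rewrite cardE -(size_map val); apply: perm_size; apply: uniq_perm.
  - by rewrite map_inj_uniq ?enum_uniq //; exact: val_inj.
  - exact: fset_uniq.
  move=> x; apply/mapP/idP => [[t] |xE]; first by rewrite mem_enum inE => h ->.
  by exists [` fsubsetP ES _ xE]%fset; rewrite // mem_enum inE.
rewrite cardfE.
apply: (percolation_count (A := A) (B := B)).
- by rewrite invr_ge0 ler0n /= invf_le1 ?ltr0n // ler1n.
- move=> D; apply/pred0P => t; rewrite /= !finset.in_set.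
  by apply/negP => /andP[/rim_outer_disj h]; rewrite (negPf h).
- move=> D; have [_ _ <-] := gX D; apply: card_sub.
  by apply/fsubsetP => x xr; apply: (inS D); rewrite inE xr.
- move=> D; have [_ _ <-] := gX D; rewrite card_sub; first exact: card_outer.
  by apply/fsubsetP => x xr; apply: (inS D); rewrite inE xr orbT.
move=> w.
pose s : dir := (i0, false).
have ex (D : X) : exists u : 'I_n * bool, in_bdry (val D) (ray_arrow s (val u.1, u.2)).
  exact: site_ray_arrow.
pose f (D : X) := xchoose (ex D); have fP (D : X) := xchooseP (ex D).
rewrite -[leqRHS](_ : #|{: 'I_n * bool}| = _); last by rewrite card_prod card_ord card_bool.
apply: (leq_card_in f).
move=> D D' /[!inE] /andP[/forallP a /forallP b] /andP[/forallP a' /forallP b'] eff.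
have disj (E E' : X) : (forall t, (t \in A E) ==> w t) -> (forall t, (t \in B E') ==> ~~ w t) ->
    [disjoint rim (val E) & outer (val E')]%fset.
  move=> aE bE; apply/fdisjointP => x xr; apply/negP => xo.
  have xS : x \in S by apply: (inS E); rewrite inE xr.
  by have := aE [` xS]%fset; have := bE [` xS]%fset; rewrite !finset.in_set xr xo /= => /negPf ->.
have [[c j] _ _] := gX D; have [[c' j'] _ _] := gX D'.
apply: val_inj; apply: compatible_inj => //; first by rewrite /compatible !disj.
by exists (ray_arrow s (val (f D).1, (f D).2)); [exact: fP|rewrite eff; exact: fP].
Qed.

End Counting.

(** * Rooted sets and supermultiplicativity *)

Section Sequences.
Variable d : nat.
Notation V := 'rV[int]_d.
Notation dir := (dir d).
Implicit Types D : {fset V}.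
Variables i0 i1 i2 : 'I_d.
Hypotheses (i01 : i0 != i1) (i02 : i0 != i2) (i12 : i1 != i2).

(** With N = 2d, (1 - 1/(N + 1))^N = (1 + 1/N)^(-N) >= exp (-1). *)
Lemma fset_sites_exp_bound (R : realType) n (X : {fset {fset V}}) :
  {subset X <= fset_sites n} ->
  (#|` X|)%:R <= (n * 2)%:R * ((2 * d).+1%:R * expR 1) ^+ n :> R.
Proof.
move=> sX; have := fset_sites_bound i0 R sX.
have d0 : (0 < d)%N by apply: leq_ltn_trans (ltn_ord i0).
set N := (2 * d)%N; have N0 : (0 < N)%N by rewrite muln_gt0.
have N0' : 0 < N%:R :> R by rewrite ltr0n.
have N1' : 0 < N.+1%:R :> R by rewrite ltr0n.
have -> : 1 - N.+1%:R^-1 = N%:R / N.+1%:R :> R.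
  by rewrite -[N.+1%:R]natr1; field; rewrite natr1 gt_eqF.
have eq : N%:R / N.+1%:R = (1 + N%:R^-1)^-1 :> R.
  by rewrite -[N.+1%:R]natr1; field; rewrite natr1 !gt_eqF.
have e1 : (1 + N%:R^-1) ^+ N <= expR 1 :> R.
  have -> : expR 1 = expR (N%:R^-1) ^+ N :> R.
    by rewrite -expRM_natl mulfV // gt_eqF.
  by apply: lerXn2r; rewrite ?nnegrE ?expR_ge0 ?addr_ge0 ?invr_ge0 ?ler0n // expR_ge1Dx.
rewrite eq !exprVn -!invfM ler_pdivrMr; last first.
  by rewrite mulr_gt0 // exprn_gt0 // ltr_wpDr // invr_ge0 ltW.
move=> h; apply: le_trans h _; rewrite exprMn mulnC exprM.
apply: ler_wpM2l; first exact: ler0n.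
apply: ler_wpM2l; first by rewrite exprn_ge0 // ltW.
apply: lerXn2r; rewrite ?nnegrE ?expR_ge0 ?exprn_ge0 ?addr_ge0 ?invr_ge0 ?ler0n //.
Qed.

Lemma finite_fset_sites (R : realType) n : finite_set (fset_sites n : set {fset V}).
Proof.
apply: contrapT => inf.
pose b : R := (n * 2)%:R * ((2 * d).+1%:R * expR 1) ^+ n.
have b0 : 0 <= b by rewrite mulr_ge0 ?exprn_ge0 ?mulr_ge0 ?expR_ge0 ?ler0n.
have [X XA] := infinite_set_fset (Num.bound b) inf.
apply/negP; rewrite -ltnNge -(ltr_nat R); apply: le_lt_trans (archi_boundP b0).
by apply: fset_sites_exp_bound => D DX; rewrite inE; exact: XA.
Qed.

Definition site_count n := #|` fset_set (fset_sites n : set {fset V})|.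

(** Normalised so that another set can be attached from below. Extreme vertices need not be unique,
    so a set may have several rooted translates. *)
Definition rooted n : set {fset V} :=
  [set D : {fset V} | [/\ good D, extreme i0 i1 i2 true D 0 & #|` rim D| = n]]%classic.

Definition root_count n := #|` fset_set (rooted n)|.

Lemma enclosed_in D : vertex_connected D -> 0 \in D -> enclosed D.
Proof. by move=> vD D0; rewrite /enclosed component_boundary //; exact: finite_fset. Qed.

Lemma rooted_sites n D : rooted n D -> fset_sites n D.
Proof. by move=> [gD [D0 _ _ _] rD]; split => //; case: gD => vD _; exact: enclosed_in. Qed.

Lemma finite_rooted (R : realType) n : finite_set (rooted n).
Proof. by apply: sub_finite_set (finite_fset_sites R n) => D; exact: rooted_sites. Qed.

Lemma mem_rooted (R : realType) n D : (D \in fset_set (rooted n)) <-> rooted n D.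
Proof. by rewrite in_fset_set ?inE //; exact: finite_rooted R n. Qed.

Lemma mem_sites (R : realType) n D : (D \in fset_set (fset_sites n)) <-> fset_sites n D.
Proof. by rewrite in_fset_set ?inE //; exact: finite_fset_sites R n. Qed.

Lemma root_count_mul (R : realType) n m :
  (root_count n * root_count m <= root_count (n + m + 1))%N.
Proof.
have ex D : exists w, D != fset0 -> extreme i0 i1 i2 false D w.
  have [->|D0] := eqVneq D fset0; first by exists 0.
  by have [w h] := extreme_exists i01 i02 i12 false D0; exists w.
(* The highest vertex is chosen as a function of the set alone, as [join_inj] requires. *)
pose w D := xget 0 [set w | D != fset0 -> extreme i0 i1 i2 false D w]%classic.
have wP D k : rooted k D -> extreme i0 i1 i2 false D (w D).
  move=> [_ [D0 _ _ _] _]; rewrite /w; case: xgetP => [v -> /=|h].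
    by apply; apply/fset0Pn; exists 0.
  by have [v /h] := ex D.
have e k D : rooted k D -> extreme i0 i1 i2 true D 0 by case.
rewrite /root_count -(size_allpairs (fun D1 D2 => join i0 D1 (w D1) D2)).
apply: uniq_leq_size.
  apply: allpairs_uniq; try exact: fset_uniq.
  move=> [D1 D2] [D1' D2'] /allpairsP[[E1 E2] /= [h1 h2 [-> ->]]].
  move=> /allpairsP[[E1' E2'] /= [h1' h2' [-> ->]]] /= ej.
  move/(mem_rooted R): h1 => h1; move/(mem_rooted R): h2 => h2.
  move/(mem_rooted R): h1' => h1'; move/(mem_rooted R): h2' => h2'.
  have [||-> -> //] := join_inj i01 i02 i12 (wP _ _ h1) (e _ _ h2) (wP _ _ h1') (e _ _ h2') _ _ ej.
    by case: h1 => _ _ ->; case: h1' => _ _ ->.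
  by move=> ->.
move=> D /allpairsP[[D1 D2] /= [/(mem_rooted R) h1 /(mem_rooted R) h2 ->]].
apply/(mem_rooted R); have w1 := wP _ _ h1; have e2 := e _ _ h2; have e1 := e _ _ h1.
case: h1 h2 => g1 _ r1 [g2 _ r2]; split.
- exact: (join_good i01 i02 i12 w1 e2 g1 g2).
- by apply: join_extreme; eassumption.
- by rewrite (join_card_rim i01 i02 i12) // r1 r2.
Qed.

(** The witness is a straight segment of vertices along [i0]. *)
Lemma root_count_gt0 (R : realType) n : (0 < n)%N -> (0 < root_count n)%N.
Proof.
case: n => // n _.
have upk k : (stp (up i0) *+ k) ord0 i0 = k%:Z.
  by have := ray_coord 0 (up i0) k; rewrite /= expr0 !mul1r [(0 : V) _ _]mxE !add0r.
have [D [gD cD D0]] : exists D : {fset V}, [/\ grow 0 D, #|` D| = n.+1 &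
    forall x, (x \in D) <-> exists2 k, (k <= n)%N & x = stp (up i0) *+ k].
  elim: n => [|n [D [gD cD D0]]].
    exists [fset 0]%fset; split; [exact: grow1|exact: cardfs1|].
    move=> x; rewrite inE; split=> [/eqP->|[k]]; first by exists 0%N.
    by rewrite leqn0 => /eqP -> ->; rewrite mulr0n.
  have inj k l : stp (up i0) *+ k = stp (up i0) *+ l -> k = l.
    by move=> e; have := upk k; rewrite e upk => -[].
  have nD : stp (up i0) *+ n.+1 \notin D.
    by apply/negP => /D0 [k kn /inj e]; move: kn; rewrite -e ltnn.
  exists (stp (up i0) *+ n.+1 |` D)%fset; split.
  - apply: (grow_leaf (s := opd (up i0))) => //; split => //.
      by apply/D0; exists n; rewrite // mulrSr stpD_opd.
    move=> t /D0 [k kn] /(congr1 (fun v : V => v ord0 i0)).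
    rewrite [LHS]mxE !upk stpE; case: t => j b /=.
    by case: eqP => [<-|_]; case: b => //= h; lia.
  - by rewrite cardfsU1 nD cD.
  - move=> x; rewrite !inE; split.
      move=> /orP[/eqP->|/D0[k kn ->]]; first by exists n.+1.
      by exists k => //; exact: leqW.
    move=> [k]; rewrite leq_eqVlt => /orP[/eqP-> ->|kn ->]; first by rewrite eqxx.
    by apply/orP; right; apply/D0; exists k.
have co x : x \in D -> 0 <= x ord0 i0 /\ (forall j, i0 != j -> x ord0 j = 0).
  move=> /D0[k _ ->]; split.
    by rewrite upk.
  move=> j ij; elim: k => [|k IH]; first by rewrite mulr0n mxE.
  by rewrite mulrSr mxE IH stpE eq_sym (negPf ij).
rewrite cardfs_gt0; apply/fset0Pn; exists D; apply/(mem_rooted R); split.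
- exact: (grow_good i01 i02 i12 gD).
- split; first exact: grow_root.
  + by move=> x /co [h _]; rewrite expr1 !mulN1r mxE oppr0 oppr_le0.
  + by apply/negP => /co [_ /(_ _ i01)]; rewrite add0r stpE eqxx.
  + by apply/negP => /co [_ /(_ _ i02)]; rewrite add0r stpE eqxx.
- by rewrite (grow_rim i01 i02 i12 gD).
Qed.

Lemma root_count_le (R : realType) n : (root_count n <= site_count n)%N.
Proof.
apply: fsubset_leq_card; apply/fsubsetP => D /(mem_rooted R) h.
by apply/(mem_sites R); exact: rooted_sites.
Qed.

(** A set is recovered from a rooted translate and the position of its extreme vertex. The latter is
    the head of a boundary edge, so [site_span] confines its coordinates. *)
Lemma site_count_le (R : realType) n : (0 < n)%N ->
  (site_count n <= (n.*2.+1 ^ d) * root_count n)%N.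
Proof.
move=> n0.
pose box := {ffun 'I_d -> 'I_n.*2.+1}.
have ex D : exists u : box * V, fset_sites n D ->
    rooted n (translate (- u.2) D) /\ (forall i, u.2 ord0 i + n%:Z = (u.1 i)%:Z).
  have [sD|//] := pselect (fset_sites n D); last by exists ([ffun=> ord0], 0).
  have [gD _ rD] := sD.
  have D0 : D != fset0.
    apply: contraTneq n0 => D0; rewrite -rD lt0n negbK cardfs_eq0 D0.
    by apply/eqP/fsetP => x; rewrite !inE.
  have [r [rinD rmin r1 r2]] := extreme_exists i01 i02 i12 true D0.
  have rb i : (`|r ord0 i| < n)%N.
    by apply: (site_span (b := (r, (i1, true))) i sD); rewrite /in_bdry /= rinD.
  exists ([ffun i => inord (absz (r ord0 i + n%:Z)%R)], r) => _; split; last first.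
    by move=> i /=; rewrite ffunE inordK; have := rb i; clia.
  split; [exact: good_translate| |by rewrite card_rim_translate].
  by apply: extreme_translate.
pose u D := xget ([ffun=> ord0], 0) [set u : box * V | fset_sites n D ->
    rooted n (translate (- u.2) D) /\ (forall i, u.2 ord0 i + n%:Z = (u.1 i)%:Z)]%classic.
have uP D : fset_sites n D ->
    rooted n (translate (- (u D).2) D) /\ (forall i, (u D).2 ord0 i + n%:Z = ((u D).1 i)%:Z).
  move=> sD; rewrite /u; case: xgetP => [v _ /(_ sD) //|h].
  by have [v /h] := ex D.
rewrite -[X in (X ^ d)%N]card_ord -[X in (_ ^ X)%N]card_ord -card_ffun mulnC cardE -/box.
rewrite /site_count /root_count -(size_allpairs (fun E (v : box) => (E, v))).
rewrite -(size_map (fun D => (translate (- (u D).2) D, (u D).1))).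
apply: uniq_leq_size.
  rewrite map_inj_in_uniq; first exact: fset_uniq.
  move=> D D' /(mem_sites R)/uP[_ h] /(mem_sites R)/uP[_ h'] [e1 e2].
  have e : (u D).2 = (u D').2.
    by apply/rowP => i; apply: (@addIr _ n%:Z); rewrite h h' e2.
  by move: e1; rewrite e => /translate_inj.
move=> [E v] /mapP[D /(mem_sites R)/uP[h _] [-> ->]].
by apply/allpairsP; exists (translate (- (u D).2) D, (u D).1); rewrite mem_enum; split => //; apply/(mem_rooted R).
Qed.
End Sequences.

(** * Fekete's argument with a shifted index *)

Section Growth.
Local Open Scope classical_set_scope.
Local Open Scope ring_scope.
Variables (R : realType) (d : nat) (t c : nat -> nat) (B : R).
Hypothesis tM : forall n m, (t n * t m <= t (n + m + 1))%N.
Hypothesis t0 : forall n, (0 < n)%N -> (0 < t n)%N.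
Hypothesis tc : forall n, (t n <= c n)%N.
Hypothesis ct : forall n, (0 < n)%N -> (c n <= n.*2.+1 ^ d * t n)%N.
Hypothesis cB : forall n, (c n)%:R <= (n * 2)%:R * B ^+ n.
Hypothesis B0 : 0 < B.

Let lt n : R := ln (t n)%:R.
Let lc n : R := ln (c n)%:R.

Let t1 n : (0 < n)%N -> 1 <= (t n)%:R :> R.
Proof. by move=> n0; rewrite ler1n t0. Qed.
Let lt_ge0 n : (0 < n)%N -> 0 <= lt n.
Proof. by move=> /t1; exact: ln_ge0. Qed.

(** Polynomial factors are absorbed by 1 + e n <= exp (e n) for arbitrarily small e. *)
Lemma ln_succ_le (e : R) n : 0 < e -> ln (n.*2.+1)%:R <= ln (2 / e + 1) + e * n%:R :> R.
Proof.
move=> e0; have p : 0 < 2 / e + 1 by rewrite addr_gt0 // divr_gt0.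
rewrite -[e * _]expRK -lnM ?posrE ?expR_gt0 // ler_ln ?posrE ?mulr_gt0 ?expR_gt0 ?ltr0n //.
apply: (@le_trans _ _ ((2 / e + 1) * (1 + e * n%:R))); last first.
  by apply: ler_wpM2l; [exact: ltW|exact: expR_ge1Dx].
rewrite -natr1 -muln2 natrM.
have -> : (2 / e + 1) * (1 + e * n%:R) = 2 / e + 1 + 2 * n%:R + e * n%:R by field; rewrite gt_eqF.
have : 0 <= e * n%:R by rewrite mulr_ge0 // ltW.
have : 0 < 2 / e by rewrite divr_gt0.
move: (2 / e) (e * n%:R) => a b; lra.
Qed.

Let lcB n : (0 < n)%N -> lc n <= ln (n.*2.+1)%:R + n%:R * ln B.
Proof.
move=> n0; rewrite /lc mulr_natl -lnXn // -lnM ?posrE ?exprn_gt0 ?ltr0n // ler_ln ?posrE ?mulr_gt0 ?exprn_gt0 ?ltr0n //; last first.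
  by apply: leq_trans (tc n); exact: t0.
apply: le_trans (cB n) _; apply: ler_wpM2r; first by rewrite exprn_ge0 // ltW.
by rewrite ler_nat; lia.
Qed.

Let lt_lc n : (0 < n)%N -> lt n <= lc n.
Proof.
by move=> n0; rewrite ler_ln ?posrE ?ltr0n ?ler_nat ?t0 //; apply: leq_trans (tc n); exact: t0.
Qed.

Let lc_lt n : (0 < n)%N -> lc n <= d%:R * ln (n.*2.+1)%:R + lt n.
Proof.
move=> n0; rewrite mulr_natl -lnXn ?ltr0n // -lnM ?posrE ?exprn_gt0 ?ltr0n ?t0 //.
rewrite ler_ln ?posrE ?mulr_gt0 ?exprn_gt0 ?ltr0n ?t0 //; last first.
  by apply: leq_trans (tc n); exact: t0.
by rewrite -natrX -natrM ler_nat ct.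
Qed.

(** Because of the extra vertex in a concatenation the natural quotients have denominator n + 1. *)
Let xs : set R := [set x | exists2 n, (0 < n)%N & x = lt n / n.+1%:R].
Let L := sup xs.

Let xs_ub : has_ubound xs.
Proof.
exists (ln (2 / 1 + 1) + 1 + `|ln B|) => _ [n n0 ->].
rewrite ler_pdivrMr ?ltr0n //; apply: le_trans (lt_lc n0) (le_trans (lcB n0) _).
have l0 : 0 <= ln (2 / 1 + 1) :> R by apply: ln_ge0; lra.
have h1 := @ln_succ_le 1 n ltr01.
have h2 := ler_norm (ln B); have h3 : 1 <= n%:R :> R by rewrite ler1n.
have h4 : 0 <= `|ln B| by [].
have h5 : n%:R * ln B <= n%:R * `|ln B| by apply: ler_wpM2l.
have h6 : 0 <= ln (2 / 1 + 1) * n%:R :> R by apply: mulr_ge0.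
move: h1 h5 h6 l0; rewrite -[n.+1%:R]natr1 mul1r (mulrC n%:R `|_|); move: (ln (2 / 1 + 1)) => K; rewrite mulrDr mulr1 !mulrDl !mul1r => *; lra.
Qed.

Let xs_ne : xs !=set0. Proof. by exists (lt 1 / 2%:R), 1%N. Qed.

Lemma growth_upper n : (0 < n)%N -> lt n <= L * n.+1%:R.
Proof.
move=> n0; rewrite -ler_pdivrMr ?ltr0n //.
by apply: ub_le_sup => //; exists n.
Qed.

(** q blocks of size m, each with its connecting vertex, and a remainder r, which has to be positive
    because [t 0] may vanish. *)
Lemma growth_power m q r : (0 < r)%N -> (0 < m)%N -> q%:R * lt m <= lt (q * m.+1 + r).
Proof.
move=> r0 m0; elim: q => [|q IH]; first by rewrite mul0r mul0n add0n lt_ge0.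
rewrite -natr1 mulrDl mul1r; apply: (@le_trans _ _ (lt (q * m.+1 + r) + lt m)).
  by rewrite lerD2r.
rewrite -lnM ?posrE ?ltr0n ?t0 ?addn_gt0 ?r0 ?orbT //.
rewrite ler_ln ?posrE ?mulr_gt0 ?ltr0n ?t0 ?addn_gt0 ?r0 ?orbT //.
rewrite -natrM ler_nat; apply: leq_trans (tM _ _) _; apply: eq_leq; congr t; lia.
Qed.

Lemma growth_lower m n : (0 < m)%N -> (m < n)%N ->
  lt m / m.+1%:R * (n%:R - m.+1%:R) <= lt n.
Proof.
move=> m0 mn; pose q := (n.-1 %/ m.+1)%N.
have en : n = (q * m.+1 + (n.-1 %% m.+1).+1)%N.
  by rewrite addnS -divn_eq prednK //; lia.
rewrite {2}en; apply: le_trans (growth_power q _ m0); last by [].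
rewrite mulrAC ler_pdivrMr ?ltr0n // mulrC mulrAC; apply: ler_wpM2r; first exact: lt_ge0.
rewrite lerBlDr -natrM -natrD ler_nat {1}en; have := ltn_pmod n.-1 (ltn0Sn m); lia.
Qed.

(** The logarithms of t and c differ by at most d ln (2n + 1), so both grow at the rate L; a single
    m with quotient close to L gives the lower estimate for all large n. *)
Lemma growth_rate : [/\ (fun n => lc n / n%:R) @ \oo --> L,
  (forall n, (0 < n)%N -> lt n <= L * n.+1%:R) & L <= ln B].
Proof.
have L0 : 0 <= L.
  apply: (@le_trans _ _ (lt 1 / 2%:R)); first by rewrite divr_ge0 // lt_ge0.
  by apply: ub_le_sup => //; exists 1%N.
have cv : (fun n => lc n / n%:R) @ \oo --> L.
  apply/cvgrPdist_le => e e0.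
  pose e' := e / (2 * (d%:R + 1)).
  have d1 : 0 < d%:R + 1 :> R by rewrite ltr_wpDl.
  have e'0 : 0 < e' by rewrite divr_gt0 // mulr_gt0.
  have [|_ [m m0 ->] xm] := @sup_adherent R xs (e / 2) _ (conj xs_ne xs_ub); first by rewrite divr_gt0.
  rewrite -/L in xm; set x := lt m / m.+1%:R in xm *.
  have x0 : 0 <= x by rewrite divr_ge0 // lt_ge0.
  pose K := 2 / e * (d%:R * ln (2 / e' + 1) + L + x * m.+1%:R).
  near=> n.
  have nm : (m < n)%N by near: n; exact: nbhs_infty_gt.
  have n0 : (0 < n)%N by apply: leq_ltn_trans nm.
  have nR : 0 < n%:R :> R by rewrite ltr0n.
  have nK : K <= n%:R by near: n; exact: nbhs_infty_ger.
  have lo := growth_lower m0 nm; rewrite -/x in lo.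
  have l1 := lt_lc n0; have l2 := lc_lt n0; have l3 := growth_upper n0.
  have l4 := ln_succ_le n e'0.
  have lge : 0 <= ln (2 / e' + 1) by apply: ln_ge0; rewrite lerDr divr_ge0 // ltW.
  have Ke : d%:R * ln (2 / e' + 1) + L + x * m.+1%:R <= e / 2 * n%:R.
    move: nK; rewrite /K mulrC -ler_pdivlMr ?divr_gt0 // => h; apply: le_trans h _.
    by rewrite invf_div mulrC.
  have de' : d%:R * e' <= e / 2.
    rewrite /e' mulrA ler_pdivrMr ?mulr_gt0 //.
    have -> : e / 2 * (2 * (d%:R + 1)) = e * (d%:R + 1) by field.
    have : 0 <= d%:R :> R by []. nra.
  have dl : d%:R * ln (n.*2.+1)%:R <= d%:R * ln (2 / e' + 1) + e / 2 * n%:R.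
    apply: le_trans (ler_wpM2l (ler0n _ _) l4) _; rewrite mulrDr lerD2l mulrA.
    by apply: ler_wpM2r => //; exact: ltW.
  have xm0 : 0 <= x * m.+1%:R by rewrite mulr_ge0.
  have dln0 : 0 <= d%:R * ln (2 / e' + 1) by rewrite mulr_ge0.
  have -> : L - lc n / n%:R = (L * n%:R - lc n) / n%:R by field; rewrite gt_eqF.
  rewrite normrM normfV (gtr0_norm nR) ler_pdivrMr // ler_norml.
  rewrite -natr1 mulrDr mulr1 in l3.
  rewrite mulrBr in lo.
  have xn : (L - e / 2) * n%:R <= x * n%:R by apply: ler_wpM2r; [exact: ltW|exact: ltW].
  rewrite mulrBl in xn.
  have ee : e * n%:R = e / 2 * n%:R + e / 2 * n%:R by field.
  apply/andP; split; lra.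
split=> //; first exact: growth_upper.
rewrite leNgt; apply/negP => LB.
(* A quarter of the gap: the distance to the limit and the two terms of [ln_succ_le] use up three
   quarters. *)
have [e e0 eE] : exists2 e, 0 < e & 4 * e = L - ln B.
  exists ((L - ln B) / 4); last by field.
  by rewrite divr_gt0 // subr_gt0.
pose K := ln (2 / e + 1) / e.
have cvl : \forall n \near \oo, `|L - lc n / n%:R| <= e.
  by move/cvgrPdist_le : cv => /(_ e e0).
near \oo => n.
have n0 : (0 < n)%N by near: n; exact: nbhs_infty_gt.
have nR : 0 < n%:R :> R by rewrite ltr0n.
have nK : K <= n%:R by near: n; exact: nbhs_infty_ger.
have : `|L - lc n / n%:R| <= e by near: n; exact: cvl.
rewrite ler_norml => /andP[_ h].
have h2 : L * n%:R - lc n <= e * n%:R.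
  by move: h; rewrite -(ler_pM2r nR) mulrBl divfK ?gt_eqF.
have h3 := lcB n0; have h4 := ln_succ_le n e0.
have h5 : ln (2 / e + 1) <= e * n%:R by move: nK; rewrite /K ler_pdivrMr // [n%:R * e]mulrC.
have : L * n%:R <= (3 * e + ln B) * n%:R.
  have -> : (3 * e + ln B) * n%:R = e * n%:R + e * n%:R + e * n%:R + n%:R * ln B by ring.
  lra.
rewrite ler_pM2r //; lra.
Unshelve. all: by end_near. Qed.
End Growth.

Lemma sum_arith_geom_le (R : realFieldType) (q : R) B : 0 <= q < 1 ->
  \sum_(n < B) n%:R * q ^+ n <= (1 - q) ^- 2.
Proof.
move=> /andP[q0 q1]; have q10 : 0 < 1 - q by rewrite subr_gt0.
(* Exact value of the partial sum, with the tail isolated as a non-negative term. *)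
have e : (\sum_(n < B) n%:R * q ^+ n) * (1 - q) ^+ 2 + q ^+ B * (B%:R * (1 - q) + q) = q.
  elim: B => [|B IH]; first by rewrite big_ord0 expr0; ring.
  rewrite big_ord_recr /= -[RHS]IH mulrDl -!addrA; congr +%R.
  by rewrite [q ^+ B.+1]exprS -natr1; move: (q ^+ B) => a; ring.
rewrite -[leRHS]mul1r ler_pdivlMr ?exprn_gt0 //.
apply: (@le_trans _ _ q); last exact: ltW.
rewrite -[leRHS]e lerDl; apply: mulr_ge0; first exact: exprn_ge0.
by apply: addr_ge0 => //; apply: mulr_ge0; [exact: ler0n|exact: ltW].
Qed.

(** * The weight of trees bounded by the counts *)

Section Upper.
Variables (R : realType) (d : nat).
Notation V := 'rV[int]_d.
Notation dir := (dir d).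
Variable off : nat -> nat -> bool.
Variables i0 i1 i2 : 'I_d.
Hypotheses (i01 : i0 != i1) (i02 : i0 != i2) (i12 : i1 != i2).

(** A code is determined by its image, and this by a rooted translate and the place of the tree's
    root among its n vertices, recorded as an index. *)
Lemma card_valid h n :
  (#|[pred c : tree_code d h | valid off c && (#|` embed c| == n)]| <= root_count i0 i1 i2 n * n)%N.
Proof.
have ex (c : tree_code d h) : exists r, extreme i0 i1 i2 true (embed c) r.
  by apply: extreme_exists => //; apply/fset0Pn; exists 0; exact: embed_root.
pose r c := xget 0 [set r | extreme i0 i1 i2 true (embed (c : tree_code d h)) r]%classic.
have rP c : extreme i0 i1 i2 true (embed c) (r c).
  by rewrite /r; case: xgetP => [v _ //|h1]; have [v /h1] := ex c.
pose E c := translate (- r c) (embed c).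
have rE c : - r c \in E c by rewrite in_translate subrr embed_root.
have cE c : #|` E c| = #|` embed c| by rewrite card_translate.
rewrite cardE -(size_map (fun c => (E c, index (- r c) (E c)))) -[X in (_ * X)%N](size_iota 0).
rewrite /root_count -(size_allpairs (fun D (k : nat) => (D, k))).
apply: uniq_leq_size.
  rewrite map_inj_in_uniq ?enum_uniq // => c c'.
  rewrite !mem_enum !inE => /andP[vc _] /andP[vc' _] [eE er].
  have e : r c = r c'.
    by apply: oppr_inj; rewrite -(nth_index 0 (rE c)) -[RHS](nth_index 0 (rE c')) er eE.
  apply: (embed_inj i01 i02 i12 vc vc'); apply: (@translate_inj _ (- r c)).
  by rewrite {2}e.
move=> [D k] /mapP[c]; rewrite mem_enum inE => /andP[vc /eqP cn] [-> ->].
apply/allpairsP; exists (E c, index (- r c) (E c)); rewrite /= mem_iota /= add0n; split => //.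
  apply/(mem_rooted i0 i1 i2 R); split.
  - by apply: good_translate; apply: (valid_good i01 i02 i12 vc).
  - exact: extreme_translate.
  - by rewrite rim_translate card_translate (valid_rim i01 i02 i12 vc).
by rewrite -cn -cE index_mem.
Qed.

(** Sorted by size, there are at most n exp (L (n + 1)) trees with n vertices, each of weight
    x^n. *)
Lemma tree_weight_upper h (x L : R) : 0 <= x -> x * expR L < 1 ->
  (forall n, (0 < n)%N -> (root_count i0 i1 i2 n)%:R <= expR (L * n.+1%:R)) ->
  tree_weight d off x h <= expR L / (1 - x * expR L) ^+ 2.
Proof.
move=> x0 q1 tL; set q := x * expR L in q1 *.
have q0 : 0 <= q by rewrite mulr_ge0 ?expR_ge0.
pose B := (\max_(c : tree_code d h) #|` embed c|).+1.
have cB (c : tree_code d h) : (#|` embed c| < B)%N by rewrite ltnS (leq_bigmax c).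
rewrite /tree_weight (eq_bigr (fun c => if valid off c then x ^+ #|` embed c| else 0)); last first.
  by move=> c _; rewrite /valid_weight; case: ifP => // vc; have [_ ->] := valid_grow x vc.
rewrite -big_mkcond (partition_big (fun c => Ordinal (cB c)) xpredT) //=.
apply: (@le_trans _ _ (expR L * \sum_(n < B) n%:R * q ^+ n)); last first.
  by apply: ler_wpM2l; rewrite ?expR_ge0 // sum_arith_geom_le // q0.
rewrite mulr_sumr; apply: ler_sum => n _.
rewrite (eq_bigr (fun _ => x ^+ n)); last by move=> c /andP[_ /eqP <-].
rewrite sumr_const -[leLHS]mulr_natl.
apply: (@le_trans _ _ ((root_count i0 i1 i2 n * n)%:R * x ^+ n)).
  apply: ler_wpM2r; first exact: exprn_ge0.
  by rewrite ler_nat; apply: leq_trans (card_valid h n).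
case: (posnP n) => [->|n0]; first by rewrite muln0 !mul0r mulr0.
have -> : expR L * (n%:R * q ^+ n) = expR (L * n.+1%:R) * n%:R * x ^+ n.
  by rewrite expRM_natr exprS /q exprMn; ring.
rewrite natrM; apply: ler_wpM2r; first exact: exprn_ge0.
by apply: ler_wpM2r; [exact: ler0n|exact: tL].
Qed.
End Upper.

(** * Bounds on the growth rate *)

Section Final.
Local Open Scope classical_set_scope.
Local Open Scope ring_scope.
Variables (R : realType) (d : nat).
Variables i0 i1 i2 : 'I_d.
Hypotheses (i01 : i0 != i1) (i02 : i0 != i2) (i12 : i1 != i2).
Local Notation N := ((2 * d)%:R : R).
Local Notation e := (expR 1 : R).

(** If x exp L <= 1 - 1/N, the trees have mass at most N exp L N^2 <= 8 N^4, whereas [tree_mass]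
    provides 64 * 2^P with P of order N. So x exp L exceeds 1 - 1/N, and inserting x gives the
    claim. *)
Lemma rate_lower (L : R) :
  (forall n, (0 < n)%N -> (root_count i0 i1 i2 n)%:R <= expR (L * n.+1%:R)) ->
  expR L <= (2 * d).+1%:R * e ->
  2 ^+ 26 <= N -> 2 * loss R <= N -> excess R <= N -> (5 * 2 ^+ 21) ^+ 5 <= N ->
  N * e - e * (1 + excess R) <= expR L.
Proof.
move=> tL Le NN Nloss Nexc Nk.
have d0 : (0 < d)%N by apply: leq_ltn_trans (ltn_ord i0).
have N0 : 0 < N by rewrite ltr0n muln_gt0.
have N1 : 1 <= N by rewrite ler1n muln_gt0.
have exc0 : 0 <= excess R.
  by rewrite !addr_ge0 ?mulr_ge0 ?addr_ge0 ?mulr_ge0 ?expR_ge0 ?exprn_ge0.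
pose P := Num.truncn (N / 2 ^+ 21).
have p21 : 0 < 2 ^+ 21 :> R by rewrite exprn_gt0.
have /andP[P1 P2] : P%:R <= N / 2 ^+ 21 < P.+1%:R.
  by apply: truncn_itv; rewrite divr_ge0 // ltW.
have NP : 2 ^+ 21 * P%:R <= N by rewrite mulrC -ler_pdivlMr.
have NP1 : N <= 2 ^+ 21 * P.+1%:R by rewrite mulrC -ler_pdivrMr // ltW.
pose x := (1 + excess R / N) * expR (-1) / N.
have a0 : 0 <= excess R / N by rewrite divr_ge0 // ltW.
have x0 : 0 < x by rewrite divr_gt0 // mulr_gt0 ?expR_gt0 // ltr_wpDr.
have Nx : N * x = (1 + excess R / N) * expR (-1) by rewrite /x mulrC divfK ?gt_eqF.
have [off [h big]] := tree_mass d0 NN Nloss Nexc NP NP1 Nx.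
have q : 1 - N^-1 < x * expR L.
  rewrite ltNge; apply/negP => q.
  have q1 : x * expR L < 1 by apply: le_lt_trans q _; rewrite gtrBl invr_gt0.
  have up := tree_weight_upper off i01 i02 i12 h (ltW x0) q1 tL.
  have : mass d x off h <= N * ((2 * d).+1%:R * e * N ^+ 2).
    apply: ler_wpM2l; first exact: ltW.
    apply: le_trans up _; apply: ler_pM; rewrite ?expR_ge0 ?invr_ge0 ?sqr_ge0 //.
    rewrite -[leRHS]invrK lef_pV2 ?posrE ?invr_gt0 ?exprn_gt0 ?subr_gt0 //.
    rewrite -exprVn; apply: lerXn2r; rewrite ?nnegrE ?invr_ge0 ?subr_ge0 ?(ltW q1) ?(ltW N0) //.
    by rewrite lerBrDr -lerBrDl.
  move=> /(le_trans big); apply/negP; rewrite -ltNge.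
  have e4 := expR1_le4 R.
  have N2 : (2 * d).+1%:R * e <= 8 * N.
    have -> : 8 * N = (2 * N) * 4 by ring.
    by apply: ler_pM; rewrite ?ler0n ?expR_ge0 // -natr1; lra.
  have pw : (N / (5 * 2 ^+ 21)) ^+ 5 <= 2 ^+ P.
    apply: le_trans (pow2_ge_pow5 R P); apply: lerXn2r.
    - by rewrite nnegrE divr_ge0 ?mulr_ge0 ?ltW.
    - by rewrite nnegrE divr_ge0 ?ler0n.
    by rewrite invfM mulrA [N / 5 / _]mulrAC ler_pM2r ?invr_gt0 // ltW.
  apply: (@lt_le_trans _ _ (64 * (N / (5 * 2 ^+ 21)) ^+ 5)); last by apply: ler_wpM2l.
  rewrite expr_div_n; set k := (5 * 2 ^+ 21) ^+ 5 in Nk *.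
  have k0 : 0 < k by rewrite exprn_gt0 // mulr_gt0.
  rewrite [ltRHS]mulrA ltr_pdivlMr //.
  apply: (@le_lt_trans _ _ (N * (8 * N * N ^+ 2) * N)).
    apply: ler_pM => //; rewrite ?mulr_ge0 ?ler0n ?expR_ge0 ?sqr_ge0 ?(ltW N0) ?(ltW k0) //.
    by apply: ler_wpM2l; [exact: ltW|apply: ler_wpM2r; rewrite ?sqr_ge0].
  have -> : N * (8 * N * N ^+ 2) * N = 8 * N ^+ 5 by ring.
  by rewrite ltr_pM2r ?exprn_gt0 // ltr_nat.
have : (1 - N^-1) * N * e < (1 + excess R / N) * expR L.
  have : (1 - N^-1) * N < (1 + excess R / N) * expR (-1) * expR L.
    by rewrite -Nx mulrC -mulrA ltr_pM2l.
  rewrite -(ltr_pM2r (expR_gt0 1)) => /lt_le_trans; apply.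
  rewrite -!mulrA [expR L * _]mulrC [expR (-1) * _]mulrA -expRD addNr expR0 mul1r.
  exact: lexx.
rewrite mulrBl mul1r mulVf ?gt_eqF // => h1.
(* The factor 1 + excess/N of x is removed by means of 1/(1 + a) >= 1 - a. *)
have h2 : (1 - excess R / N) * (1 + excess R / N) <= 1.
  rewrite -subr_sqr expr1n gerBl; exact: sqr_ge0.
have c0 : 0 <= 1 - excess R / N by rewrite subr_ge0 ler_pdivrMr // mul1r.
apply: (@le_trans _ _ ((1 - excess R / N) * ((N - 1) * e))); last first.
  apply: le_trans (ler_wpM2l c0 (ltW h1)) _.
  by rewrite mulrA ler_piMl ?expR_ge0.
have -> : (1 - excess R / N) * ((N - 1) * e) = N * e - e * (1 + excess R) + excess R / N * e.
  by field; rewrite pnatr_eq0 -lt0n.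
by rewrite lerDl mulr_ge0 ?expR_ge0.
Qed.

Lemma growth_limit : exists L : R,
  [/\ cdot_root R d @ \oo --> expR L, expR L <= (2 * d).+1%:R * e &
   forall n, (0 < n)%N -> (root_count i0 i1 i2 n)%:R <= expR (L * n.+1%:R)].
Proof.
pose B : R := (2 * d).+1%:R * e.
have B0 : 0 < B by rewrite mulr_gt0 ?expR_gt0 ?ltr0n.
have fin n := finite_fset_sites i0 R n.
have h1 := root_count_mul i01 i02 i12 R.
have h2 := root_count_gt0 i01 i02 i12 R.
have h3 := @root_count_le d i0 i1 i2 R.
have h4 := site_count_le i01 i02 i12 R.
have h5 n : (site_count d n)%:R <= (n * 2)%:R * B ^+ n.
  apply: (fset_sites_exp_bound i0) => D DX; rewrite inE; exact/(mem_sites i0 R).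
have [cv up LB] := growth_rate h1 h2 h3 h4 h5 B0.
set L := sup _ in cv up LB; exists L; split.
- apply: cvg_trans (continuous_cvg _ (@continuous_expR R L) cv).
  apply: near_eq_cvg; near=> n.
  have n1 : (1 < n)%N by near: n; exact: nbhs_infty_gt.
  rewrite /cdot_root (cdotE i01 i02 i12 n1 (fin n)) /powR pnatr_eq0.
  have -> : (#|` fset_set (fset_sites n : set {fset 'rV[int]_d})| == 0)%N = false.
    by apply/negbTE; rewrite -lt0n; apply: leq_trans (h3 n); apply: h2; exact: ltnW.
  by rewrite mulrC.
- by rewrite -[leRHS]lnK ?posrE // ler_expR.
- by move=> n n0; rewrite -[leLHS]lnK ?posrE ?ltr0n ?h2 // ler_expR; exact: up.
Unshelve. all: by end_near. Qed.
End Final.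

Local Open Scope classical_set_scope.
Local Open Scope ring_scope.

Theorem theorem3p3 (R : realType) :
  exists (C : R) (d0 : nat), forall d : nat, (2 <= d)%N -> (d0 <= d)%N ->
    cvgn (cdot_root R d) /\
    `|bdot R d - 2 * d%:R * expR 1| <= C.
Proof.
pose K : R := 2 ^+ 26 + 2 * loss R + excess R + (5 * 2 ^+ 21) ^+ 5.
have l0 : 0 <= loss R by rewrite !mulr_ge0 ?expR_ge0 ?exprn_ge0.
have x0 : 0 <= excess R.
  by rewrite !addr_ge0 ?mulr_ge0 ?addr_ge0 ?mulr_ge0 ?expR_ge0 ?exprn_ge0.
have a0 : 0 <= 2 ^+ 26 :> R by rewrite exprn_ge0.
have b0 : 0 <= (5 * 2 ^+ 21) ^+ 5 :> R by rewrite !exprn_ge0 // mulr_ge0 ?exprn_ge0.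
have K0 : 0 <= K by do 3 apply: addr_ge0 => //; apply: mulr_ge0.
(* The constant is that of [rate_lower]; it also covers the surplus e in the upper bound (2d + 1) e.
   The 3 provides three axes, and [K] dominates every lower bound imposed on N. *)
exists (expR 1 * (1 + excess R)), (3 + Num.bound K)%N => d _ dd.
have d3 : (2 < d)%N by lia.
pose i k (hk : (k < 3)%N) : 'I_d := Ordinal (leq_trans hk d3).
pose i0 := i 0%N isT; pose i1 := i 1%N isT; pose i2 := i 2%N isT.
have i01 : i0 != i1 by []. have i02 : i0 != i2 by []. have i12 : i1 != i2 by [].
have NK : K <= (2 * d)%:R.
  apply: le_trans (ltW (archi_boundP K0)) _; rewrite ler_nat; lia.
have [L [cv up tL]] := growth_limit R i01 i02 i12.
have eb : bdot R d = expR L by apply/cvg_lim.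
split; first by apply/cvg_ex; exists (expR L).
rewrite eb -natrM ler_norml.
have lo : (2 * d)%:R * expR 1 - expR 1 * (1 + excess R) <= expR L.
  by apply: (rate_lower i01 i02 i12) => //; apply: le_trans NK; rewrite /K;
     move: (loss R) (excess R) (2 ^+ 26) ((5 * 2 ^+ 21) ^+ 5) l0 x0 a0 b0 => *; lra.
have up' : expR L <= (2 * d)%:R * expR 1 + expR 1 by rewrite -[X in _ + X]mul1r -mulrDl natr1.
have e0 := expR_ge0 (1 : R); have : 0 <= expR 1 * excess R by rewrite mulr_ge0.
have eC : expR 1 * (1 + excess R) = expR 1 + expR 1 * excess R by rewrite mulrDr mulr1.
by move=> m0; rewrite eC in lo *; apply/andP; split; lra.
Qed.
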